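(* Let $(X_\ell,\dot{\mathfrak g},t)$ be one of: $X_\ell=B_\ell$ ($\ell\ge2$), $\dot{\mathfrak g}$ of type $D_{\ell+1}$, $t=2$; $X_\ell=C_\ell$ ($\ell\ge2$), $\dot{\mathfrak g}$ of type $A_{2\ell-1}$, $t=2$; $X_\ell=F_4$, $\dot{\mathfrak g}$ of type $E_6$, $t=2$; $X_\ell=G_2$, $\dot{\mathfrak g}$ of type $D_4$, $t=3$. Let $\sigma_0=\mathrm{id}$ and let $\sigma_1$ be the automorphism of $\dot{\mathfrak g}$ of order $t$ induced by a diagram automorphism of order $t$ of the Dynkin diagram (permuting Chevalley generators accordingly), with fixed subalgebra of type $X_\ell$. Then the set $R$ of non-isotropic roots of the twisted 2-toroidal Lie algebra $\mathfrak g(\sigma_0,\sigma_1)$ is the extended affine root system $X_\ell^{(1,t)}$: $$R=\{\alpha+m\delta_0+n\delta_1\mid\alpha\in R(X_\ell)\text{ short},\ m,n\in\mathbb Z\}\cup\{\alpha+m\delta_0+tn\delta_1\mid\alpha\in R(X_\ell)\text{ long},\ m,n\in\mathbb Z\},$$ where $R(X_\ell)$ is the root system of $\dot{\mathfrak g}_{(\overline0,\overline0)}$ with respect to its Cartan subalgebra $\dot{\mathfrak h}_{\overline0}$.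
   Context: Work over $\mathbb C$. Let $\dot{\mathfrak g}$ be a simple finite-dimensional Lie algebra with Killing form $(\cdot,\cdot)$, and $\sigma_0,\sigma_1$ commuting automorphisms of finite orders $n_0,n_1$ (order 1 allowed). Put $\epsilon_j=\exp(2\pi i/n_j)$ and, for $p,q\in\mathbb Z$, $\dot{\mathfrak g}_{(\overline p,\overline q)}=\{g\in\dot{\mathfrak g}\mid\sigma_0(g)=\epsilon_0^p g,\ \sigma_1(g)=\epsilon_1^q g\}$, where $\overline p=p \bmod n_0$, $\overline q=q\bmod n_1$. Let $\mathcal R=\mathbb C[t_0^{\pm1},t_1^{\pm1}]$, $\mathcal K=\Omega^1_{\mathcal R}/d\mathcal R$, $k_i=t_i^{-1}dt_i$, and let $\mathcal K(\Sigma)\subset\mathcal K$ be spanned by the elements $t_0^{n_0a}t_1^{n_1b}k_i$ ($a,b\in\mathbb Z$, $i=0,1$). The twisted 2-toroidal Lie algebra is $$\mathfrak g(\sigma_0,\sigma_1)=\bigoplus_{m,n\in\mathbb Z}\dot{\mathfrak g}_{(\overline m,\overline n)}\otimes t_0^mt_1^n\ \oplus\ \mathcal K(\Sigma)\ \oplus\ \mathbb Cd_0\oplus\mathbb Cd_1,$$ with bracket $[g_1\otimes f_1,g_2\otimes f_2]=[g_1,g_2]\otimes f_1f_2+(g_1,g_2)f_2\,df_1$; $\mathcal K(\Sigma)$ commutes with itself and with all $g\otimes f$; $d_j=t_j\partial/\partial t_j$ acts by $[d_j,g\otimes t_0^{r_0}t_1^{r_1}]=r_j\,g\otimes t_0^{r_0}t_1^{r_1}$,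 $[d_j,t_0^{r_0}t_1^{r_1}k_i]=r_j\,t_0^{r_0}t_1^{r_1}k_i$; and $[d_0,d_1]=0$. Let $\dot{\mathfrak h}_{\overline 0}$ be a Cartan subalgebra of the reductive algebra $\dot{\mathfrak g}_{(\overline 0,\overline 0)}$ and $\mathfrak h=\dot{\mathfrak h}_{\overline 0}\oplus\mathbb Cd_0\oplus\mathbb Cd_1\oplus\mathbb Ck_0\oplus\mathbb Ck_1$. Elements of $\dot{\mathfrak h}_{\overline 0}^*$ are extended to $\mathfrak h$ by $0$ on all $d_i,k_i$; $\delta_i\in\mathfrak h^*$ is defined by $\delta_i(d_j)=\delta_{ij}$ and zero on $\dot{\mathfrak h}_{\overline 0}$ and all $k_j$. Let $V=\dot{\mathfrak h}_{\overline 0}^*\oplus\mathbb C\delta_0\oplus\mathbb C\delta_1$ with the bilinear form $(\cdot,\cdot)_V$ which on $\dot{\mathfrak h}_{\overline 0}^*$ is dual to the restriction of the Killing form to $\dot{\mathfrak h}_{\overline 0}$ and has $\delta_0,\delta_1$ in its radical. Then $R$ is the set of $\beta\in V$ with $(\beta,\beta)_V\ne0$ whose weight space in $\mathfrak g(\sigma_0,\sigma_1)$ under the adjoint action of $\mathfrak h$ is nonzero. *)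

(* Defs.v *)
From HB Require Import structures.
From mathcomp Require Import all_boot ssrAC all_order all_algebra all_fingroup.
From mathcomp Require Import finmap boolp classical_sets reals trigo complex.
From mathcomp Require Import generic_quotient ring_quotient monalg ring.

Set Implicit Arguments.
Unset Strict Implicit.
Unset Printing Implicit Defensive.

Import Order.TTheory GRing.Theory Num.Theory.
Local Open Scope ring_scope.
Local Open Scope complex_scope.
Local Open Scope classical_set_scope.

(** * Lie algebras *)

HB.mixin Record Lmodule_isLieAlgebra (K : nzRingType) L
    of GRing.Lmodule K L := {
  lie : L -> L -> L;
  lieDZl : forall a x y z, lie (a *: x + y) z = a *: lie x z + lie y z;
  lieDZr : forall a x y z, lie z (a *: x + y) = a *: lie z x + lie z y;
  liexx : forall x, lie x x = 0;
  jacobi : forall x y z,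
    lie x (lie y z) + lie y (lie z x) + lie z (lie x y) = 0 }.

#[short(type="lieAlgType")]
HB.structure Definition LieAlgebra (K : nzRingType) :=
  { L of GRing.Lmodule K L & Lmodule_isLieAlgebra K L }.

#[short(type="finLieAlgType")]
HB.structure Definition FinLieAlgebra (K : nzRingType) :=
  { L of Vector K L & Lmodule_isLieAlgebra K L }.

Lemma lie_linear_r (K : nzRingType) (L : lieAlgType K) (x : L) :
  linear (lie x).
Proof. by move=> a y z; rewrite lieDZr. Qed.

HB.instance Definition _ (K : nzRingType) (L : lieAlgType K) (x : L) :=
  GRing.isLinear.Build K L L _ (lie x) (@lie_linear_r K L x).

Section FiniteDimensional.
Context (K : fieldType) (L : finLieAlgType K).
Implicit Types (x y : L) (U G H I : {vspace L}).

Definition ad x : 'End(L) := linfun (lie x).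

Definition lfun_trace (f : 'End(L)) : K :=
  \sum_(i < \dim {:L}) coord (vbasis {:L}) i (f (vbasis {:L})`_i).

Definition killing x y : K := lfun_trace (ad x \o ad y)%VF.

Definition simple_lie_algebra : Prop :=
  (exists x y, lie x y != 0) /\
  (forall I, (forall x y, y \in I -> lie x y \in I) -> I = 0%VS \/ I = fullv).

Definition lie_automorphism (s : 'End(L)) : Prop :=
  bijective s /\ forall x y, s (lie x y) = lie (s x) (s y).

Definition has_order (s : 'End(L)) (n : nat) : Prop :=
  [/\ (0 < n)%N, forall x, iter n s x = x &
      forall m, (0 < m < n)%N -> exists x, iter m s x != x].

Definition lie_span U G : {vspace L} :=
  <<[seq lie x y | x <- vbasis U, y <- vbasis G]>>%VS.

(* Cartan subalgebra of the subalgebra G: nilpotent (via the lower central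
   series of H) and self-normalizing in G. *)
Definition cartan_subalgebra G H : Prop :=
  [/\ (H <= G)%VS,
      forall x y, x \in H -> y \in H -> lie x y \in H,
      exists n, iter n (lie_span H) H = 0%VS &
      forall x, x \in G -> (forall h, h \in H -> lie x h \in H) -> x \in H].

Definition dual_space H := 'Hom(subvs_of H, K^o).

Definition killing_flat H : 'Hom(subvs_of H, dual_space H) :=
  linfun (fun h => linfun (fun h' => killing (vsval h) (vsval h') : K^o)
    : dual_space H).

(* The form on H^* dual to the restriction to H of the Killing form of L
   (meaningful when that restriction is nondegenerate). *)
Definition dual_form H (a b : dual_space H) : K := b ((killing_flat H)^-1%VF a).

Definition root_vector H (a : dual_space H) x : Prop :=
  forall h : subvs_of H, lie (vsval h) x = a h *: x.

Definition lie_roots G H : set (dual_space H) :=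
  [set a | a != 0 /\ exists x, [/\ x \in G, x != 0 & root_vector a x]].

(* b is a base (system of simple roots) of the root system of G with respect
   to H. *)
Definition root_base G H n (b : n.-tuple (dual_space H)) : Prop :=
  [/\ basis_of fullv b, forall i, lie_roots G (tnth b i) &
      forall a, lie_roots G a -> exists c : 'I_n -> nat,
        a = \sum_i tnth b i *+ c i \/ a = - \sum_i tnth b i *+ c i].

(* A i j = <b_j, b_i^vee> *)
Definition has_cartan_matrix H n (A : 'M[int]_n) (b : n.-tuple (dual_space H)) :=
  forall i j, 2 * dual_form (tnth b i) (tnth b j) /
    dual_form (tnth b i) (tnth b i) = (A i j)%:~R.

(* e_i, f_i, h_i = [e_i, f_i] are Chevalley generators attached to the simple
   roots b_i; the h_i are the coroots, normalized by b_i(h_i) = 2. *)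
Definition chevalley_generators H n (b : n.-tuple (dual_space H))
    (e f : 'I_n -> L) : Prop :=
  forall i, [/\ root_vector (tnth b i) (e i), root_vector (- tnth b i) (f i) &
    exists2 h : subvs_of H, vsval h = lie (e i) (f i) & tnth b i h = 2].

End FiniteDimensional.

Section Killing.
Context (K : fieldType) (L : finLieAlgType K).
Implicit Types (f g : 'End(L)) (x y z : L).

Lemma lfun_traceC f g : lfun_trace (f \o g)%VF = lfun_trace (g \o f)%VF.
Proof.
pose b := vbasis {:L}.
have E (f' g' : 'End(L)) : lfun_trace (f' \o g')%VF =
    \sum_(i < \dim {:L}) \sum_(j < \dim {:L}) coord b j (g' b`_i) * coord b i (f' b`_j).
  apply: eq_bigr => i _; rewrite lfunE /=.
  rewrite {1}(coord_vbasis (memvf (g' b`_i))) linear_sum linear_sum.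
  by apply: eq_bigr => j _; rewrite !linearZ.
rewrite !E exchange_big; apply: eq_bigr => i _; apply: eq_bigr => j _.
exact: mulrC.
Qed.

Lemma lfun_trace_linear : linear (@lfun_trace K L : 'End(L) -> K^o).
Proof.
move=> a f g; rewrite /lfun_trace scaler_sumr -big_split /=.
by apply: eq_bigr => i _; rewrite !lfunE /= lfunE linearP.
Qed.

Lemma lieC x y : lie x y = - lie y x.
Proof.
apply/eqP; rewrite -addr_eq0; apply/eqP.
have lieDl a b c : lie (a + b) c = lie a c + lie b c :> L.
  by rewrite -[a in LHS]scale1r lieDZl scale1r.
by have := liexx (x + y); rewrite lieDl !linearD /= !liexx add0r addr0.
Qed.

Lemma adE x y : ad x y = lie x y. Proof. by rewrite lfunE. Qed.

Lemma ad_linear : linear (@ad K L).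
Proof.
move=> a x y; apply/lfunP => z.
by rewrite add_lfunE scale_lfunE !adE lieDZl.
Qed.

Lemma ad_lie x y : ad (lie x y) = ((ad x \o ad y) - (ad y \o ad x))%VF.
Proof.
apply/lfunP => z; rewrite add_lfunE opp_lfunE !comp_lfunE !adE.
have /eqP := jacobi x y z; rewrite (lieC z (lie x y)) subr_eq0 => /eqP <-.
by rewrite (lieC z x) linearN.
Qed.

Lemma killingC x y : killing x y = killing y x.
Proof. exact: lfun_traceC. Qed.

Lemma killing_linear x : linear (killing x : L -> K^o).
Proof.
by move=> a y z; rewrite /killing ad_linear comp_lfunDr -comp_lfunZr
  lfun_trace_linear.
Qed.

Lemma killing_invariant x y z : killing x (lie y z) = killing z (lie x y).
Proof.
have lD f g : lfun_trace (f - g) = lfun_trace f - lfun_trace g.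
  rewrite addrC -scaleN1r lfun_trace_linear.
  by rewrite addrC scaleN1r.
rewrite (killingC z) /killing !ad_lie comp_lfunDr comp_lfunDl.
rewrite comp_lfunNr comp_lfunNl !lD -!comp_lfunA; congr (_ - _).
by rewrite (lfun_traceC (ad y)) -comp_lfunA.
Qed.

Lemma killing_flatE (H : {vspace L}) (h h' : subvs_of H) :
  killing_flat H h h' = killing (vsval h) (vsval h').
Proof.
pose F (k : subvs_of H) : subvs_of H -> K^o :=
  fun k' => killing (vsval k) (vsval k').
have F_lin k : linear (F k).
  by move=> a x y; rewrite /F linearP killing_linear.
have FE k k' : linfun (F k) k' = F k k'.
  pose FL := GRing.isLinear.Build _ _ _ _ (F k) (F_lin k).
  pose Fk : {linear _ -> _} := HB.pack (F k) FL.
  exact: (lfunE Fk).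
have G_lin : linear (fun k => linfun (F k) : dual_space H).
  move=> a x y; apply/lfunP => z.
  rewrite add_lfunE scale_lfunE !FE /F linearP.
  by rewrite killingC killing_linear !(killingC (vsval z)).
pose GL := GRing.isLinear.Build _ _ _ _ _ G_lin.
pose G : {linear _ -> _} := HB.pack (fun k => linfun (F k) : dual_space H) GL.
by rewrite /killing_flat (lfunE G) /= FE.
Qed.

End Killing.

(** * Vector-valued Laurent polynomials in t_0, t_1 *)

(* V (x) C[t_0^{+-1}, t_1^{+-1}], as finitely supported functions on the
   exponents. *)
Definition laurent (K : nzRingType) (V : lmodType K) : Type :=
  {malg V[(int * int)%type]}.

HB.instance Definition _ (K : nzRingType) (V : lmodType K) :=
  GRing.Zmodule.on (laurent V).

HB.lock Definition lcoef (K : nzRingType) (V : lmodType K) (u : laurent V)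
  (m : int * int) : V := u@_m.

(* v (x) t_0^{m.1} t_1^{m.2} *)
HB.lock Definition monomial (K : nzRingType) (V : lmodType K) (v : V)
  (m : int * int) : laurent V := << v *g m >>.

HB.lock Definition lsupport (K : nzRingType) (V : lmodType K)
  (u : laurent V) : seq (int * int) := msupp u.

HB.lock Definition lmap (K : nzRingType) (V W : lmodType K)
    (F : int * int -> V -> W) (u : laurent V) : laurent W :=
  \sum_(m <- lsupport u) monomial (F m (lcoef u m)) m.

(* The product with u_m (x) t^m . v_n (x) t^n = B m n u_m v_n (x) t^{m+n}. *)
HB.lock Definition lmul (K : nzRingType) (U V W : lmodType K)
    (B : int * int -> int * int -> U -> V -> W)
    (u : laurent U) (v : laurent V) : laurent W :=
  \sum_(m <- lsupport u) \sum_(n <- lsupport v)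
    monomial (B m n (lcoef u m) (lcoef v n)) (m + n).

Section Laurent.
Context (K : nzRingType).
Implicit Types (U V W : lmodType K) (m n : int * int).

Lemma laurentP V (u v : laurent V) : lcoef u =1 lcoef v -> u = v.
Proof. by move=> uv; apply/malgP => m; have := uv m; rewrite lcoef.unlock. Qed.

Lemma lcoefD V (u v : laurent V) m : lcoef (u + v) m = lcoef u m + lcoef v m.
Proof. by rewrite lcoef.unlock; exact: mcoeffD. Qed.

Lemma lcoef0 V m : lcoef (0 : laurent V) m = 0.
Proof. by rewrite lcoef.unlock; exact: mcoeff0. Qed.

Lemma lcoef_monomial V (v : V) m n :
  lcoef (monomial v m) n = if m == n then v else 0.
Proof. by rewrite lcoef.unlock monomial.unlock mcoeffU; case: eqP. Qed.

Lemma lcoef_out V (u : laurent V) m : m \notin lsupport u -> lcoef u m = 0.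
Proof. by rewrite lsupport.unlock lcoef.unlock => /mcoeff_outdom. Qed.

Lemma lsupport_uniq V (u : laurent V) : uniq (lsupport u).
Proof. by rewrite lsupport.unlock; exact: fset_uniq. Qed.

Lemma laurentE V (u : laurent V) :
  u = \sum_(m <- lsupport u) monomial (lcoef u m) m.
Proof.
by rewrite lsupport.unlock lcoef.unlock monomial.unlock; exact: monalgE.
Qed.

Lemma lcoef_sum V (I : Type) (r : seq I) (F : I -> laurent V) m :
  lcoef (\sum_(i <- r) F i) m = \sum_(i <- r) lcoef (F i) m.
Proof.
elim/big_rec2: _ => [|i x y _ <-]; first exact: lcoef0.
exact: lcoefD.
Qed.

Lemma lcoef_lmap V W (F : int * int -> V -> W) u m : F m 0 = 0 ->
  lcoef (lmap F u) m = F m (lcoef u m).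
Proof.
move=> F0; rewrite lmap.unlock lcoef_sum.
have [mu|mu] := boolP (m \in lsupport u).
  rewrite (bigD1_seq m) ?lsupport_uniq //= lcoef_monomial eqxx big1 ?addr0 //.
  by move=> n nm; rewrite lcoef_monomial (negPf nm).
rewrite (lcoef_out mu) F0 big_seq big1 // => n nu.
by rewrite lcoef_monomial; case: eqP nu mu => // -> ->.
Qed.

Fact lscaleA V (a b : K) (u : laurent V) :
  lmap (fun _ v => a *: v) (lmap (fun _ v => b *: v) u) =
  lmap (fun _ v => (a * b) *: v) u.
Proof. by apply: laurentP => m; rewrite !lcoef_lmap ?scaler0 // scalerA. Qed.
Fact lscale1 V (u : laurent V) : lmap (fun _ v => 1 *: v) u = u.
Proof. by apply: laurentP => m; rewrite lcoef_lmap ?scaler0 // scale1r. Qed.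
Fact lscaleDr V (a : K) :
  {morph @lmap K V V (fun _ v => a *: v) : u w / u + w}.
Proof.
by move=> u w; apply: laurentP => m;
  rewrite lcoefD !lcoef_lmap ?scaler0 // lcoefD scalerDr.
Qed.
Fact lscaleDl V (u : laurent V) :
  {morph (fun a : K => lmap (fun _ v => a *: v) u) : a b / a + b}.
Proof.
by move=> a b; apply: laurentP => m;
  rewrite lcoefD !lcoef_lmap ?scaler0 // scalerDl.
Qed.

HB.instance Definition _ V := GRing.Zmodule_isLmodule.Build K (laurent V)
  (@lscaleA V) (@lscale1 V) (@lscaleDr V) (@lscaleDl V).

Lemma lcoefZ V (a : K) (u : laurent V) m : lcoef (a *: u) m = a *: lcoef u m.
Proof. by rewrite lcoef_lmap ?scaler0. Qed.

Lemma lcoefDZ V (a : K) (u v : laurent V) m :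
  lcoef (a *: u + v) m = a *: lcoef u m + lcoef v m.
Proof. by rewrite lcoefD lcoefZ. Qed.

Lemma linear_fun0 V W (f : V -> W) : linear f -> f 0 = 0.
Proof.
by move=> lf; have := lf (-1) 0 0;
  rewrite scaleN1r oppr0 add0r => ->; rewrite scaleN1r addNr.
Qed.

Lemma linear_fun_sum V W (f : V -> W) (I : Type) (r : seq I) (F : I -> V) :
  linear f -> f (\sum_(i <- r) F i) = \sum_(i <- r) f (F i).
Proof.
move=> lf; elim/big_rec2: _ => [|i x y _ <-]; first exact: linear_fun0.
by have := lf 1 (F i) y; rewrite !scale1r.
Qed.

Lemma laurent_ext V W (f g : laurent V -> W) : linear f -> linear g ->
  (forall v m, f (monomial v m) = g (monomial v m)) -> f =1 g.
Proof.
move=> lf lg fg u; rewrite (laurentE u) !linear_fun_sum //.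
by apply: eq_bigr => m _; exact: fg.
Qed.

Lemma monomial_linear V m : linear (fun v : V => monomial v m).
Proof.
move=> a u v; apply: laurentP => n.
by rewrite lcoefDZ !lcoef_monomial; case: ifP; rewrite // scaler0 addr0.
Qed.

Lemma lmap_linear V W (F : int * int -> V -> W) :
  (forall m, linear (F m)) -> linear (lmap F).
Proof.
move=> lF a u v; apply: laurentP => m.
by rewrite !(lcoefDZ, lcoef_lmap) ?lF //; exact: linear_fun0.
Qed.

Lemma lmapU V W (F : int * int -> V -> W) v m : (forall m, linear (F m)) ->
  lmap F (monomial v m) = monomial (F m v) m.
Proof.
move=> lF; have F0 k : F k 0 = 0 by exact: linear_fun0.
apply: laurentP => n; rewrite lcoef_lmap // !lcoef_monomial.
by case: eqP => [->|].
Qed.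

Lemma lmul_lmap U V W (B : int * int -> int * int -> U -> V -> W) u v :
  (forall m n b, linear (fun a => B m n a b)) ->
  (forall m n a, linear (B m n a)) -> forall s : seq (int * int),
  uniq s -> {subset lsupport u <= s} ->
  lmul B u v = \sum_(m <- s) \sum_(n <- lsupport v)
    monomial (B m n (lcoef u m) (lcoef v n)) (m + n).
Proof.
move=> lB1 lB2 s us uss; rewrite lmul.unlock.
rewrite [RHS](bigID (mem (lsupport u))) /= [X in _ + X]big1 ?addr0; last first.
  move=> m mu; rewrite big1 // => n _.
  rewrite lcoef_out // (linear_fun0 (lB1 m n _)).
  exact: (linear_fun0 (monomial_linear _)).
rewrite -[RHS]big_filter; apply: perm_big; apply: uniq_perm.
- exact: lsupport_uniq.
- exact: filter_uniq.
by move=> m; rewrite mem_filter; case: (boolP (m \in _)) => // /uss ->.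
Qed.

Lemma lmulDZl U V W (B : int * int -> int * int -> U -> V -> W) v :
  (forall m n b, linear (fun a => B m n a b)) ->
  (forall m n a, linear (B m n a)) -> linear (fun u => lmul B u v).
Proof.
move=> lB1 lB2 a x y.
pose s := undup (lsupport x ++ lsupport y ++ lsupport (a *: x + y)).
have us : uniq s by exact: undup_uniq.
rewrite !(@lmul_lmap _ _ _ _ _ _ lB1 lB2 s us);
  try by move=> m mx; rewrite mem_undup !mem_cat mx ?orbT.
rewrite scaler_sumr -big_split /=; apply: eq_bigr => m _.
rewrite scaler_sumr -big_split /=; apply: eq_bigr => n _.
by rewrite lcoefDZ lB1 monomial_linear.
Qed.

Lemma lmulC U V W (B : int * int -> int * int -> U -> V -> W) u v :
  lmul B u v = lmul (fun m n a b => B n m b a) v u.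
Proof.
rewrite !lmul.unlock exchange_big /=; apply: eq_bigr => n _.
by apply: eq_bigr => m _; rewrite addrC.
Qed.

Lemma lmulDZr U V W (B : int * int -> int * int -> U -> V -> W) u :
  (forall m n b, linear (fun a => B m n a b)) ->
  (forall m n a, linear (B m n a)) -> linear (lmul B u).
Proof.
move=> lB1 lB2 a x y; rewrite !(lmulC B u); exact: lmulDZl.
Qed.

Lemma lmulU U V W (B : int * int -> int * int -> U -> V -> W) a b m n :
  (forall m n b, linear (fun a => B m n a b)) ->
  (forall m n a, linear (B m n a)) ->
  lmul B (monomial a m) (monomial b n) = monomial (B m n a b) (m + n).
Proof.
move=> lB1 lB2.
have mono0 p : monomial (0 : W) p = 0 by exact: (linear_fun0 (monomial_linear _)).
have supp (T : lmodType K) (c : T) p k : k \in lsupport (monomial c p) -> k = p.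
  rewrite lsupport.unlock monomial.unlock msuppU; case: ifP => // _.
  by rewrite inE => /eqP.
rewrite (@lmul_lmap _ _ _ _ _ _ lB1 lB2 [:: m]) //; last first.
  by move=> k /supp ->; rewrite inE.
rewrite big_seq1.
pose G k := monomial (B m k (lcoef (monomial a m) m)
  (lcoef (monomial b n) k)) (m + k).
have -> : \sum_(k <- lsupport (monomial b n)) G k = G n.
  have [nb|nb] := boolP (n \in lsupport (monomial b n)).
    rewrite (bigD1_seq n) ?lsupport_uniq //= big1_seq ?addr0 // => k.
    by move=> /andP[/eqP + /supp].
  rewrite big1_seq => [|k /= /[dup] /supp -> nb']; last by rewrite nb' in nb.
  by rewrite /G (lcoef_out nb) (linear_fun0 (lB2 m n _)) mono0.
by rewrite /G !lcoef_monomial !eqxx.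
Qed.

End Laurent.


(** * The twisted 2-toroidal Lie algebra *)

Section Kahler.
Context (K : numFieldType).

(* The free module of 1-forms over K[t_0^{+-1}, t_1^{+-1}] on the basis
   k_0 = t_0^-1 dt_0, k_1 = t_1^-1 dt_1: the coefficient (a, b) at t^m stands
   for a t^m k_0 + b t^m k_1. *)
Definition omega : lmodType K := laurent (K^o * K^o)%type.

(* d (t^m) = m.1 t^m k_0 + m.2 t^m k_1 *)
Definition dlaurent (f : laurent K^o) : omega :=
  lmap (fun m (c : K^o) => (c * m.1%:~R, c * m.2%:~R) : K^o * K^o) f.

Fact dlaurent_linear : linear dlaurent.
Proof.
apply: lmap_linear => m a u v.
by congr pair; rewrite /= mulrDl -scalerAl.
Qed.

Definition exact_form : {pred omega} :=
  fun w => `[< exists f, w = dlaurent f >].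

Fact exact_formP w : reflect (exists f, w = dlaurent f) (w \in exact_form).
Proof. exact: asboolP. Qed.

Fact exact_form_linear a u v :
  u \in exact_form -> v \in exact_form -> a *: u + v \in exact_form.
Proof.
move=> /exact_formP[f ->] /exact_formP[g ->]; apply/exact_formP.
by exists (a *: f + g); rewrite dlaurent_linear.
Qed.

Fact exact_form0 : 0 \in exact_form.
Proof.
by apply/exact_formP; exists 0; rewrite (linear_fun0 dlaurent_linear).
Qed.

Fact exact_form_zmod_closed : zmod_closed exact_form.
Proof.
split=> [|u v ue ve]; first exact: exact_form0.
by rewrite addrC -scaleN1r; exact: exact_form_linear.
Qed.

HB.instance Definition _ :=
  GRing.isZmodClosed.Build omega exact_form exact_form_zmod_closed.

Definition kahler : Type := Quotient.quot exact_form.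

HB.instance Definition _ := EqQuotient.on kahler.
HB.instance Definition _ := GRing.Zmodule.on kahler.

Definition kahler_class (w : omega) : kahler := (\pi_kahler w)%qT.

Lemma kahler_classD u v :
  kahler_class (u + v) = kahler_class u + kahler_class v.
Proof. exact: raddfD. Qed.

Lemma kahler_class_eq u v :
  (kahler_class u = kahler_class v) <-> (u - v \in exact_form).
Proof.
split=> [/eqP|uv]; first by rewrite -Quotient.idealrBE.
by apply/eqP; rewrite -Quotient.idealrBE.
Qed.

Lemma kahler_classP (w : kahler) : exists u, w = kahler_class u.
Proof. by exists (repr w); rewrite /kahler_class reprK. Qed.

Definition kahler_lift (f : omega -> omega) (w : kahler) : kahler :=
  kahler_class (f (repr w)).

Lemma kahler_liftE (f : omega -> omega) w : linear f ->
  {in exact_form, forall u, f u \in exact_form} ->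
  kahler_lift f (kahler_class w) = kahler_class (f w).
Proof.
move=> lf fe; apply/kahler_class_eq.
have := lf (-1) w (repr (kahler_class w)).
rewrite !scaleN1r ![- _ + _]addrC => <-; apply: fe.
by apply/kahler_class_eq; rewrite /kahler_class reprK.
Qed.

Let scale_lin (a : K) : linear ( *:%R a : omega -> omega).
Proof. by move=> b u v; rewrite scalerDr !scalerA mulrC. Qed.

Let scale_exact (a : K) : {in exact_form, forall u, a *: u \in exact_form}.
Proof.
by move=> u ue; rewrite -[_ *: _]addr0; exact: exact_form_linear exact_form0.
Qed.

Fact kahler_scaleE a w :
  kahler_lift ( *:%R a) (kahler_class w) = kahler_class (a *: w).
Proof. by rewrite kahler_liftE. Qed.

Fact kahler_scaleA a b (w : kahler) :
  kahler_lift ( *:%R a) (kahler_lift ( *:%R b) w) =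
  kahler_lift ( *:%R (a * b)) w.
Proof. by have [u ->] := kahler_classP w; rewrite !kahler_scaleE scalerA. Qed.
Fact kahler_scale1 (w : kahler) : kahler_lift ( *:%R 1) w = w.
Proof. by have [u ->] := kahler_classP w; rewrite kahler_scaleE scale1r. Qed.
Fact kahler_scaleDr a : {morph kahler_lift ( *:%R a) : u v / u + v}.
Proof.
move=> w w'; have [u ->] := kahler_classP w; have [v ->] := kahler_classP w'.
by rewrite -kahler_classD !kahler_scaleE -kahler_classD scalerDr.
Qed.
Fact kahler_scaleDl (w : kahler) :
  {morph (fun a => kahler_lift ( *:%R a) w) : a b / a + b}.
Proof.
move=> a b; have [u ->] := kahler_classP w.
by rewrite !kahler_scaleE -kahler_classD scalerDl.
Qed.

HB.instance Definition _ := GRing.Zmodule_isLmodule.Build K kahler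
  kahler_scaleA kahler_scale1 kahler_scaleDr kahler_scaleDl.

Lemma kahler_classDZ (a : K) u v :
  kahler_class (a *: u + v) = a *: kahler_class u + kahler_class v.
Proof. by rewrite kahler_classD -kahler_scaleE. Qed.

(* The action of a.1 d_0 + a.2 d_1 *)
Definition degree_der (V : lmodType K) (a : K^o * K^o) (u : laurent V) :
    laurent V :=
  lmap (fun m v => (a.1 * m.1%:~R + a.2 * m.2%:~R) *: v) u.

Lemma degree_der_linear (V : lmodType K) a : linear (@degree_der V a).
Proof.
by apply: lmap_linear => m b u v; rewrite scalerDr !scalerA mulrC.
Qed.

Lemma degree_der_exact a :
  {in exact_form, forall w, degree_der a w \in exact_form}.
Proof.
move=> _ /exact_formP[f ->]; apply/exact_formP; exists (degree_der a f).
apply: laurentP => m; rewrite !lcoef_lmap ?scaler0 ?mul0r //=.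
by congr pair; exact: mulrA.
Qed.

Definition kahler_der (a : K^o * K^o) : kahler -> kahler :=
  kahler_lift (degree_der a).

Lemma kahler_derE a w :
  kahler_der a (kahler_class w) = kahler_class (degree_der a w).
Proof.
by apply: kahler_liftE; [exact: degree_der_linear|exact: degree_der_exact].
Qed.

End Kahler.

Lemma jacobi_zmod (V : zmodType) (j1 j2 j3 x1 x2 x3 x4 x5 x6 e1 e2 e3 : V) :
  j1 + (x1 - x2) + ((- x5 + x3) + (e1 - e2)) +
  (j2 + (x4 - x3) + ((- x1 + x6) + (e3 - e1))) +
  (j3 + (x5 - x6) + ((- x4 + x2) + (e2 - e3))) = j1 + j2 + j3.
Proof.
rewrite !addrA.
rewrite [LHS](ACl ((1*8*15)*(2*11)*(3*19)*(4*16)*(5*10)*(6*14)*(7*20)*(9*18)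
  *(12*17)*(13*21)))/=.
by rewrite !(subrr, addNr, addr0).
Qed.

Section Toroidal.
Context (K : numFieldType) (L : finLieAlgType K).
Implicit Types (u v p : laurent L) (w : kahler K) (a b c : K^o * K^o).

(* ((u, w), a) is u + w + a.1 d_0 + a.2 d_1, with u in L (x) K[t_0^{+-1},
   t_1^{+-1}] and w a class of 1-forms. *)
Definition toroidal : Type := (laurent L * kahler K * (K^o * K^o))%type.

HB.instance Definition _ := GRing.Lmodule.on toroidal.

Definition loop_part (x : toroidal) : laurent L := x.1.1.
Definition central_part (x : toroidal) : kahler K := x.1.2.
Definition der_part (x : toroidal) : K^o * K^o := x.2.

(* [x (x) t^m, y (x) t^n] = [x, y] (x) t^{m+n}, up to the central term *)
Definition loop_bracket u v : laurent L := lmul (fun _ _ x y => lie x y) u v.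

(* (x, y) t^n d(t^m) = (x, y) (m.1 t^{m+n} k_0 + m.2 t^{m+n} k_1) *)
Definition cocycle u v : kahler K :=
  kahler_class (lmul (fun m _ x y =>
    (killing x y * m.1%:~R, killing x y * m.2%:~R) : K^o * K^o) u v).

Definition toroidal_bracket (x y : toroidal) : toroidal :=
  (loop_bracket (loop_part x) (loop_part y)
     + (degree_der (der_part x) (loop_part y)
        - degree_der (der_part y) (loop_part x)),
   cocycle (loop_part x) (loop_part y)
     + (kahler_der (der_part x) (central_part y)
        - kahler_der (der_part y) (central_part x)),
   0).

Let lie_l (m n : int * int) (y : L) : linear (fun x : L => lie x y).
Proof. by move=> a x z; rewrite lieDZl. Qed.
Let lie_r (m n : int * int) (x : L) : linear (lie x).
Proof. by move=> a y z; rewrite lieDZr. Qed.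

Let kil_r (m n : int * int) (x : L) : linear (fun y : L =>
  (killing x y * m.1%:~R, killing x y * m.2%:~R) : K^o * K^o).
Proof. by move=> a y z; rewrite killing_linear; congr pair;
  rewrite /= mulrDl; congr (_ + _); exact/esym/mulrA. Qed.
Let kil_l (m n : int * int) (y : L) : linear (fun x : L =>
  (killing x y * m.1%:~R, killing x y * m.2%:~R) : K^o * K^o).
Proof.
by move=> a x z; rewrite !(killingC _ y) killing_linear; congr pair;
  rewrite /= mulrDl; congr (_ + _); exact/esym/mulrA.
Qed.

Lemma loop_bracket_l v : linear (loop_bracket^~ v).
Proof. exact: lmulDZl. Qed.
Lemma loop_bracket_r u : linear (loop_bracket u).
Proof. exact: lmulDZr. Qed.
Lemma loop_bracketU (x y : L) m n :
  loop_bracket (monomial x m) (monomial y n) = monomial (lie x y) (m + n).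
Proof. exact: lmulU. Qed.

Lemma cocycle_l v : linear (cocycle^~ v).
Proof.
by move=> a u u'; rewrite /cocycle (lmulDZl _ kil_l kil_r) kahler_classDZ.
Qed.
Lemma cocycle_r u : linear (cocycle u).
Proof.
by move=> a v v'; rewrite /cocycle (lmulDZr _ kil_l kil_r) kahler_classDZ.
Qed.
Lemma cocycleU (x y : L) m n :
  cocycle (monomial x m) (monomial y n) =
  kahler_class (monomial
    ((killing x y * m.1%:~R, killing x y * m.2%:~R) : K^o * K^o) (m + n)).
Proof. by rewrite /cocycle lmulU. Qed.

Lemma degree_derU (V : lmodType K) a (x : V) m :
  degree_der a (monomial x m) =
  monomial ((a.1 * m.1%:~R + a.2 * m.2%:~R) *: x) m.
Proof.
by apply: lmapU => n b y z; rewrite scalerDr !scalerA mulrC.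
Qed.

Lemma degree_derC (V : lmodType K) a b (u : laurent V) :
  degree_der a (degree_der b u) = degree_der b (degree_der a u).
Proof.
by apply: laurentP => m; rewrite !lcoef_lmap ?scaler0 // !scalerA mulrC.
Qed.

Lemma degree_der0 (V : lmodType K) (u : laurent V) : degree_der 0 u = 0.
Proof.
by apply: laurentP => m;
  rewrite lcoef_lmap ?scaler0 // !mul0r addr0 scale0r lcoef0.
Qed.

Lemma degree_derl (V : lmodType K) (u : laurent V) :
  linear (fun a => degree_der a u).
Proof.
move=> e a b; apply: laurentP => m.
rewrite lcoefDZ !lcoef_lmap ?scaler0 // scalerA -scalerDl; congr (_ *: _).
by rewrite /= !mulrDl mulrDr -!scalerAl addrACA.
Qed.

Lemma kahler_derl w : linear (fun a => kahler_der a w).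
Proof.
have [u ->] := kahler_classP w => e a b.
by rewrite !kahler_derE degree_derl kahler_classDZ.
Qed.

Lemma kahler_derr a : linear (kahler_der a).
Proof.
move=> e w w'; have [u ->] := kahler_classP w.
have [u' ->] := kahler_classP w'.
by rewrite -kahler_classDZ !kahler_derE degree_der_linear kahler_classDZ.
Qed.

Lemma kahler_derC a b w :
  kahler_der a (kahler_der b w) = kahler_der b (kahler_der a w).
Proof.
by have [u ->] := kahler_classP w; rewrite !kahler_derE degree_derC.
Qed.

Lemma kahler_der0 w : kahler_der 0 w = 0.
Proof.
have [u ->] := kahler_classP w; rewrite kahler_derE degree_der0.
exact: raddf0.
Qed.

Let lD (V W : lmodType K) (f g : V -> W) :
  linear f -> linear g -> linear (fun x => f x + g x).
Proof. by move=> lf lg a x y; rewrite lf lg scalerDr addrACA. Qed.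

Let lN (V W : lmodType K) (f : V -> W) :
  linear f -> linear (fun x => - f x).
Proof. by move=> lf a x y; rewrite lf opprD scalerN. Qed.

Let l0 (V W : lmodType K) : linear (fun _ : V => 0 : W).
Proof. by move=> a x y; rewrite scaler0 addr0. Qed.

Let lcomp (U V W : lmodType K) (f : V -> W) (g : U -> V) :
  linear f -> linear g -> linear (fun x => f (g x)).
Proof. by move=> lf lg a x y; rewrite lg lf. Qed.

Let fD (V W : lmodType K) (f : V -> W) x y :
  linear f -> f (x + y) = f x + f y.
Proof. by move=> lf; have := lf 1 x y; rewrite !scale1r. Qed.

Let fN (V W : lmodType K) (f : V -> W) x : linear f -> f (- x) = - f x.
Proof.
move=> lf; have := lf (-1) x 0.
by rewrite !scaleN1r addr0 (linear_fun0 lf) addr0.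
Qed.

Let monomialD (V : lmodType K) (x y : V) m :
  monomial (x + y) m = monomial x m + monomial y m.
Proof. exact: (fD _ _ (monomial_linear m)). Qed.

Let monomialN (V : lmodType K) (x : V) m :
  monomial (- x) m = - monomial x m.
Proof. exact: (fN _ (monomial_linear m)). Qed.

Lemma loop_bracketC u v : loop_bracket u v = - loop_bracket v u.
Proof.
move: u; apply: laurent_ext => [||x m].
- exact: loop_bracket_l.
- exact/lN/loop_bracket_r.
move: v; apply: laurent_ext => [||y n].
- exact: loop_bracket_r.
- exact/lN/loop_bracket_l.
by rewrite !loop_bracketU lieC addrC monomialN.
Qed.

Lemma degree_der_loop a u v : degree_der a (loop_bracket u v) =
  loop_bracket (degree_der a u) v + loop_bracket u (degree_der a v).
Proof.
move: u; apply: laurent_ext => [||x m].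
- by apply: lcomp (@degree_der_linear _ _ _) (loop_bracket_l _).
- apply: lD (loop_bracket_l _).
  exact: lcomp (loop_bracket_l _) (@degree_der_linear _ _ _).
move: v; apply: laurent_ext => [||y n].
- by apply: lcomp (@degree_der_linear _ _ _) (loop_bracket_r _).
- apply: lD (loop_bracket_r _) _.
  exact: lcomp (loop_bracket_r _) (@degree_der_linear _ _ _).
rewrite !(degree_derU, loop_bracketU) -monomialD.
congr monomial; rewrite linearZ /=.
have -> e : lie (e *: x) y = e *: lie x y.
  by rewrite lieC linearZ -scalerN -lieC.
rewrite -scalerDl; congr (_ *: _).
by rewrite /= !intrD !mulrDr addrACA.
Qed.

Lemma degree_der_cocycle a u v : kahler_der a (cocycle u v) =
  cocycle (degree_der a u) v + cocycle u (degree_der a v).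
Proof.
move: u; apply: laurent_ext => [||x m].
- by apply: lcomp (kahler_derr _) (cocycle_l _).
- apply: lD (cocycle_l _).
  exact: lcomp (cocycle_l _) (@degree_der_linear _ _ _).
move: v; apply: laurent_ext => [||y n].
- by apply: lcomp (kahler_derr _) (cocycle_r _).
- apply: lD (cocycle_r _) _.
  exact: lcomp (cocycle_r _) (@degree_der_linear _ _ _).
rewrite !(degree_derU, cocycleU) kahler_derE -kahler_classD degree_derU.
rewrite -monomialD.
congr (kahler_class (monomial _ _)).
have -> e : killing x (e *: y) = e * killing x y.
  by have := killing_linear x e y 0;
    rewrite addr0 (linear_fun0 (killing_linear x)) addr0.
have -> e : killing (e *: x) y = e * killing x y.
  by rewrite !(killingC _ y); have := killing_linear y e x 0;
    rewrite addr0 (linear_fun0 (killing_linear y)) addr0.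
congr pair; rewrite /= !intrD -[_ *: (_ * _)]/(_ * (_ * _)); ring.
Qed.

Lemma exact_monomial (c : K) m :
  kahler_class (monomial ((c * m.1%:~R, c * m.2%:~R) : K^o * K^o) m) = 0.
Proof.
have <- : kahler_class 0 = 0 :> kahler K by exact: raddf0.
apply/kahler_class_eq; rewrite subr0; apply/exact_formP.
exists (monomial (c : K^o) m); rewrite /dlaurent lmapU // => n a x y.
by congr pair; rewrite /= mulrDl; congr (_ + _); exact/esym/mulrA.
Qed.

Lemma cocycleC u v : cocycle u v = - cocycle v u.
Proof.
move: u; apply: laurent_ext => [||x m].
- exact: cocycle_l.
- exact/lN/cocycle_r.
move: v; apply: laurent_ext => [||y n].
- exact: cocycle_r.
- exact/lN/cocycle_l.
apply/eqP; rewrite -addr_eq0 !cocycleU (addrC n) -kahler_classD.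
rewrite -monomialD.
rewrite -[X in _ == X](exact_monomial (killing x y) (m + n)); apply/eqP.
congr (kahler_class (monomial _ _)); rewrite (killingC y x).
by congr pair; rewrite /= intrD mulrDr.
Qed.

Lemma cyclic_ext (W : lmodType K) (T : laurent L -> laurent L -> laurent L -> W) :
  (forall v p, linear (fun u => T u v p)) ->
  (forall u p, linear (fun v => T u v p)) ->
  (forall u v, linear (T u v)) ->
  (forall x m y n z k,
     T (monomial x m) (monomial y n) (monomial z k) +
     T (monomial y n) (monomial z k) (monomial x m) +
     T (monomial z k) (monomial x m) (monomial y n) = 0) ->
  forall u v p, T u v p + T v p u + T p u v = 0.
Proof.
move=> l1 l2 l3 T0 u v p; move: u.
apply: (laurent_ext (g := fun=> 0) _ (@l0 _ _)) => [|x m]; first exact: lD (lD _ _) _.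
move: v; apply: (laurent_ext (g := fun=> 0) _ (@l0 _ _)) => [|y n]; first exact: lD (lD _ _) _.
move: p; apply: (laurent_ext (g := fun=> 0) _ (@l0 _ _)) => [|z k]; first exact: lD (lD _ _) _.
exact: T0.
Qed.

Lemma loop_jacobi u v p : loop_bracket u (loop_bracket v p) +
  loop_bracket v (loop_bracket p u) + loop_bracket p (loop_bracket u v) = 0.
Proof.
move: u v p; apply: cyclic_ext => [v p|u p|u v|x m y n z k].
- exact: loop_bracket_l.
- exact: lcomp (loop_bracket_r _) (loop_bracket_l _).
- exact: lcomp (loop_bracket_r _) (loop_bracket_r _).
rewrite !loop_bracketU.
have -> : n + (k + m) = m + (n + k) by rewrite addrA addrC.
have -> : k + (m + n) = m + (n + k) by rewrite addrCA (addrC k).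
by rewrite -!monomialD jacobi (linear_fun0 (monomial_linear _)).
Qed.

Lemma cocycle_jacobi u v p : cocycle u (loop_bracket v p) +
  cocycle v (loop_bracket p u) + cocycle p (loop_bracket u v) = 0.
Proof.
move: u v p; apply: cyclic_ext => [v p|u p|u v|x m y n z k].
- exact: cocycle_l.
- exact: lcomp (cocycle_r _) (loop_bracket_l _).
- exact: lcomp (cocycle_r _) (loop_bracket_r _).
rewrite !loop_bracketU !cocycleU.
have -> : n + (k + m) = m + (n + k) by rewrite addrA addrC.
have -> : k + (m + n) = m + (n + k) by rewrite addrCA (addrC k).
rewrite -!kahler_classD -!monomialD.
rewrite -[RHS](exact_monomial (killing x (lie y z)) (m + (n + k))).
congr (kahler_class (monomial _ _)).
rewrite -(killing_invariant x y z) (killing_invariant y z x).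
by congr pair; rewrite /= !intrD !mulrDr addrA.
Qed.

Fact toroidal_bracket_l (a : K) (x y z : toroidal) : toroidal_bracket (a *: x + y) z =
  a *: toroidal_bracket x z + toroidal_bracket y z.
Proof.
have lcB (V : lmodType K) (p q r s t v : V) :
    a *: p + q + (a *: r + s - (a *: t + v)) =
    a *: (p + (r - t)) + (q + (s - v)).
  by rewrite opprD (addrACA (a *: r)) [LHS]addrACA -scalerBr -scalerDr.
congr (_, _, _).
- rewrite /= /loop_part /= loop_bracket_l degree_derl degree_der_linear.
  exact: lcB.
- rewrite /= /loop_part /central_part /= cocycle_l kahler_derl kahler_derr.
  exact: lcB.
by rewrite -[RHS]/(a *: (0 : K^o * K^o) + 0) scaler0 addr0.
Qed.

Fact toroidal_bracketC (x y : toroidal) : toroidal_bracket x y = - toroidal_bracket y x.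
Proof.
congr (_, _, _).
- by rewrite /= loop_bracketC -opprB -opprD.
- by rewrite /= cocycleC -opprB -opprD.
exact/esym/oppr0.
Qed.

Fact toroidal_bracket_r (a : K) (x y z : toroidal) : toroidal_bracket z (a *: x + y) =
  a *: toroidal_bracket z x + toroidal_bracket z y.
Proof.
by rewrite !(toroidal_bracketC z) toroidal_bracket_l scalerN opprD.
Qed.

Fact toroidal_bracketxx x : toroidal_bracket x x = 0.
Proof.
have opp0 (V : lmodType K) (v : V) : v = - v -> v = 0.
  move/eqP; rewrite -addr_eq0 -mulr2n -scaler_nat scaler_eq0 pnatr_eq0.
  by move/eqP.
exact: (opp0 _ _ (toroidal_bracketC x x)).
Qed.

Fact toroidal_jacobi x y z :
  toroidal_bracket x (toroidal_bracket y z) +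
  toroidal_bracket y (toroidal_bracket z x) +
  toroidal_bracket z (toroidal_bracket x y) = 0.
Proof.
case: x y z => [[u w] a] [[v w'] b] [[p w''] c].
rewrite /toroidal_bracket /loop_part /central_part /der_part /=.
rewrite !(degree_der0, kahler_der0) !subr0.
congr (_, _, _); last by rewrite -[LHS]/(0 + 0 + 0 : K^o * K^o) !addr0.
- rewrite /= -(loop_jacobi u v p).
  rewrite !(fD _ _ (loop_bracket_r _)) !(fN _ (loop_bracket_r _)).
  rewrite !(fD _ _ (degree_der_linear _)) !(fN _ (degree_der_linear _)).
  rewrite !degree_der_loop.
  rewrite (loop_bracketC (degree_der a v)) (loop_bracketC (degree_der b p)).
  rewrite (loop_bracketC (degree_der c u)).
  rewrite (degree_derC b a) (degree_derC c a) (degree_derC c b).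
  exact: jacobi_zmod.
- rewrite /= -(cocycle_jacobi u v p).
  rewrite !(fD _ _ (cocycle_r _)) !(fN _ (cocycle_r _)).
  rewrite !(fD _ _ (kahler_derr _)) !(fN _ (kahler_derr _)).
  rewrite !degree_der_cocycle.
  rewrite (cocycleC (degree_der a v)) (cocycleC (degree_der b p)).
  rewrite (cocycleC (degree_der c u)).
  rewrite (kahler_derC b a) (kahler_derC c a) (kahler_derC c b).
  exact: jacobi_zmod.
Qed.

HB.instance Definition _ := Lmodule_isLieAlgebra.Build K toroidal
  toroidal_bracket_l toroidal_bracket_r toroidal_bracketxx toroidal_jacobi.

End Toroidal.

Section Twisted.
Context (R : realType) (L : finLieAlgType R[i]).
Local Notation C := R[i].
Implicit Types (H : {vspace L}).

(* exp (2 pi i / n) *)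
Definition root_of_unity (n : nat) : C :=
  cos (2 * trigo.pi / n%:R) +i* sin (2 * trigo.pi / n%:R).

Definition graded_part (s0 s1 : 'End(L)) (n0 n1 : nat) (p q : int) : {vspace L} :=
  (passmx.leigenspace s0 (root_of_unity n0 ^ p)
    :&: passmx.leigenspace s1 (root_of_unity n1 ^ q))%VS.

(* The span of the classes of t_0^{n0 a} t_1^{n1 b} k_i. *)
Definition kahler_sigma (n0 n1 : nat) : set (kahler C) :=
  [set kahler_class u | u in
    [set u | forall m : int * int, lcoef u m != 0 ->
      (n0 %| m.1)%Z /\ (n1 %| m.2)%Z]].

Definition twisted_toroidal (s0 s1 : 'End(L)) (n0 n1 : nat) : set (toroidal L) :=
  [set x | (forall m, lcoef (loop_part x) m \in
              graded_part s0 s1 n0 n1 m.1 m.2) /\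
           kahler_sigma n0 n1 (central_part x)].

Definition kahler_k0 : kahler C := kahler_class (monomial ((1, 0) : C^o * C^o) 0).
Definition kahler_k1 : kahler C := kahler_class (monomial ((0, 1) : C^o * C^o) 0).

(* (h, d, z) stands for h + d.1 d_0 + d.2 d_1 + z.1 k_0 + z.2 k_1. *)
Definition toral H : Type := (subvs_of H * (C^o * C^o) * (C^o * C^o))%type.

Definition toral_val H (h : toral H) : toroidal L :=
  ((monomial (vsval h.1.1) 0, h.2.1 *: kahler_k0 + h.2.2 *: kahler_k1), h.1.2).

(* (a, c) stands for a + c.1 delta_0 + c.2 delta_1; a is extended by 0 on
   d_i and k_i. *)
Definition ext_dual H : lmodType C := (dual_space H * (C^o * C^o))%type.

Definition inj_dual H (a : dual_space H) : ext_dual H := (a, 0).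
Definition delta0 H : ext_dual H := (0, (1, 0)).
Definition delta1 H : ext_dual H := (0, (0, 1)).

Definition ext_eval H (b : ext_dual H) (h : toral H) : C :=
  b.1 h.1.1 + b.2.1 * h.1.2.1 + b.2.2 * h.1.2.2.

Definition ext_form H (b c : ext_dual H) : C := dual_form b.1 c.1.

Definition weight_space (s0 s1 : 'End(L)) (n0 n1 : nat) H (b : ext_dual H) :
    set (toroidal L) :=
  [set x | twisted_toroidal s0 s1 n0 n1 x /\
    forall h : toral H, lie (toral_val h) x = ext_eval b h *: x].

Definition nonisotropic_roots (s0 s1 : 'End(L)) (n0 n1 : nat) H :
    set (ext_dual H) :=
  [set b | ext_form b b != 0 /\
    exists2 x, weight_space s0 s1 n0 n1 b x & x != 0].

(* For a root a the number (a, a) is a positive rational, so that any two are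
   comparable for the partial order of C. *)
Definition short_roots (G H : {vspace L}) : set (dual_space H) :=
  [set a | lie_roots G a /\
    forall b : dual_space H, lie_roots G b -> dual_form a a <= dual_form b b].
Definition long_roots (G H : {vspace L}) : set (dual_space H) :=
  [set a | lie_roots G a /\
    forall b : dual_space H, lie_roots G b -> dual_form b b <= dual_form a a].

End Twisted.

(** * Dynkin types *)

Variant dynkin :=
  | TypeA of nat | TypeB of nat | TypeC of nat | TypeD of nat
  | TypeE6 | TypeF4 | TypeG2.

Definition dynkin_rank (X : dynkin) : nat :=
  match X with
  | TypeA n | TypeB n | TypeC n | TypeD n => n
  | TypeE6 => 6 | TypeF4 => 4 | TypeG2 => 2
  end.

(* Nodes are numbered from 0, in Bourbaki's order. The entry (i, j) is
   2 (a_i, a_j) / (a_i, a_i), so an entry < -1 is in the row of the shorter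
   root. *)
Definition cartan_entry (X : dynkin) (i j : nat) : int :=
  let chain := (i == j.+1) || (j == i.+1) in
  if i == j then 2 else
  match X with
  | TypeA n => if chain then - 1 else 0
  | TypeB n => if (i.+1 == n) && (i == j.+1) then - 2
               else if chain then - 1 else 0
  | TypeC n => if (j.+1 == n) && (j == i.+1) then - 2
               else if chain then - 1 else 0
  | TypeD n => if (i.+1 == n) || (j.+1 == n)
               then if (i.+3 == n) || (j.+3 == n) then - 1 else 0
               else if chain then - 1 else 0
  | TypeE6 => if (minn i j, maxn i j) \in
                   [:: (0, 2); (2, 3); (3, 4); (4, 5); (1, 3)]%N
              then - 1 else 0
  | TypeF4 => if (i, j) == (2, 1)%N then - 2 else if chain then - 1 else 0
  | TypeG2 => if (i, j) == (0, 1)%N then - 3 else - 1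
  end.

Definition cartan_matrix (X : dynkin) : 'M[int]_(dynkin_rank X) :=
  \matrix_(i, j) cartan_entry X i j.

Definition diagram_automorphism (X : dynkin) (p : 'S_(dynkin_rank X)) : Prop :=
  forall i j, cartan_matrix X (p i) (p j) = cartan_matrix X i j.

(* folding X Y t: folding Y by a diagram automorphism of order t gives X. *)
Variant folding : dynkin -> dynkin -> nat -> Prop :=
  | folding_B l of (2 <= l)%N : folding (TypeB l) (TypeD l.+1) 2
  | folding_C l of (2 <= l)%N : folding (TypeC l) (TypeA (2 * l).-1) 2
  | folding_F : folding TypeF4 TypeE6 2
  | folding_G : folding TypeG2 (TypeD 4) 3.

Definition has_root_system_type (K : fieldType) (L : finLieAlgType K)
    (G H : {vspace L}) (X : dynkin) : Prop :=
  exists b : (dynkin_rank X).-tuple (dual_space H),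
    root_base G b /\ has_cartan_matrix (cartan_matrix X) b.

(* Main.v *)
Require Import Defs.
From mathcomp Require Import all_boot all_order all_algebra all_fingroup.
From mathcomp Require Import boolp classical_sets reals complex trigo spectral pgroup sylow ring zify.

Set Implicit Arguments.
Unset Strict Implicit.
Unset Printing Implicit Defensive.

Import Order.TTheory GRing.Theory Num.Theory.
Local Open Scope ring_scope.

(** The weights of g under H0 and sigma1 are pairs (l, z), z an eigenvalue of sigma1, and the
    non-isotropic roots of the toroidal algebra are the l + m delta_0 + n delta_1 with l != 0 and
    (l, zeta^n) a weight, zeta = exp(2 pi i / t). Traces on strings of weights show, as for root
    systems, that nonzero weights have multiplicity one, integral pairings and a reflection
    symmetry; so it remains to see that the nonzero weights of the eigenspaces z != 1 are exactly
    the short roots of the fixed algebra.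

    A fixed node of the diagram automorphism gives a fixed Chevalley generator x, which is extremal:
    [x, [x, y]] = - N (x, y) x, with N the square length of the roots of g with respect to H. The
    component of x of maximal length with respect to H0 is again extremal; this compares H and H0
    without conjugacy theorems. Hence long roots of the fixed algebra are extremal of square length
    N: a weight with z != 1 pairs with their coroots to at most 1 in absolute value, which with the
    integrality conditions leaves the short roots as only dominant weight, except for the spin
    weight of B_4 and the fourth fundamental weight of C_4. These two are excluded by the identity
    sum_m (2 (m, a) / (a, a))^2 = 4 / (a, a) over all weights m with multiplicity: it gives 32 with
    respect to H (types D_5 and A_7) and at least 36 with respect to H0. Finally, some nonzero
    weight with z != 1 exists for each z != 1 with z^t = 1, since otherwise the eigenspaces z != 1
    would span a proper ideal, and the short roots are conjugate under the Weyl group. *)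

(** * Weights of a toral subalgebra and a commuting automorphism *)

(** A Cartan subalgebra is only given as nilpotent and self-normalizing, so nothing says at the
    outset that it acts semisimply. Hence the weight spaces are generalized eigenspaces, and true
    eigenvectors appear once the spaces of nonzero weight are known to be lines. Commutativity of
    [A] comes from the simple roots, which span the dual space and are characters of [A].
    Nondegeneracy of the Killing form does not come from Cartan's criterion: the diagonal entries 2
    of a Cartan matrix force nonzero square lengths, which a vanishing Killing form would
    contradict.

    The automorphism is carried along with [A] from the start. The same theory then serves twice:
    for [H] in the whole algebra with the identity as automorphism, and for [H0] with [sigma1].

    The base field is only partially ordered. Inequalities between lengths therefore rest on
    integrality, which makes the products of weights real. *)

Section RestrictedTrace.
Context (K : fieldType) (L : finLieAlgType K).
Implicit Types (f g : 'End(L)) (U V : {vspace L}) (x y : L).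

Definition nil_at g x := exists n, iter n g x = 0.

Lemma iter_lin0 n g : iter n g 0 = 0.
Proof. by elim: n => //= n ->; rewrite linear0. Qed.

Lemma iter_linD n g x y : iter n g (x + y) = iter n g x + iter n g y.
Proof. by elim: n => //= n ->; rewrite linearD. Qed.

Lemma iter_linZ n g a x : iter n g (a *: x) = a *: iter n g x.
Proof. by elim: n => //= n ->; rewrite linearZ. Qed.

Lemma iter_zero_le n m g x : (n <= m)%N -> iter n g x = 0 -> iter m g x = 0.
Proof. by move=> nm gx; rewrite -(subnK nm) iterD gx iter_lin0. Qed.

Lemma nil_atD g x y : nil_at g x -> nil_at g y -> nil_at g (x + y).
Proof.
move=> [n gx] [m gy]; exists (maxn n m).
rewrite iter_linD (iter_zero_le (leq_maxl _ _) gx).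
by rewrite (iter_zero_le (leq_maxr _ _) gy) addr0.
Qed.

Lemma nil_atZ g a x : nil_at g x -> nil_at g (a *: x).
Proof. by move=> [n gx]; exists n; rewrite iter_linZ gx scaler0. Qed.

Lemma nil_at0 g : nil_at g 0. Proof. by exists 0%N. Qed.

Lemma nil_at_unif g U : (forall x, x \in U -> nil_at g x) ->
  exists n, forall x, x \in U -> iter n g x = 0.
Proof.
move=> gU; have [i|n Hn] := @choice 'I_(\dim U) _ (fun i n => iter n g (vbasis U)`_i = 0).
  by apply: gU; apply: vbasis_mem; rewrite mem_nth ?size_tuple.
pose N := (\max_i n i)%N; exists N => x xU; rewrite (coord_vbasis xU).
have HN (i : 'I_(\dim U)) : iter N g (vbasis U)`_i = 0.
  by apply: (iter_zero_le _ (Hn i)); exact: (leq_bigmax i).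
clearbody N; elim/big_rec: _ => [|i y _ IH]; first exact: iter_lin0.
by rewrite iter_linD iter_linZ IH HN scaler0 addr0.
Qed.

(** For an [f]-stable [U] this is the trace of the restriction of [f]; composing with a projection
    keeps every operator an endomorphism of [L]. *)
Definition vtrace U f : K := lfun_trace (f \o projv U)%VF.

Lemma lfun_traceD f g : lfun_trace (f + g) = lfun_trace f + lfun_trace g.
Proof. by have := lfun_trace_linear 1 f g; rewrite !scale1r. Qed.

Lemma lfun_traceZ a f : lfun_trace (a *: f) = a * lfun_trace f.
Proof.
have t0 : lfun_trace (0 : 'End(L)) = 0 by exact: (linear_fun0 (@lfun_trace_linear K L)).
by have := lfun_trace_linear a f 0; rewrite !addr0 t0 addr0.
Qed.

Lemma vtraceD U f g : vtrace U (f + g) = vtrace U f + vtrace U g.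
Proof. by rewrite /vtrace comp_lfunDl lfun_traceD. Qed.

Lemma vtraceZ U a f : vtrace U (a *: f) = a * vtrace U f.
Proof. by rewrite /vtrace -comp_lfunZl lfun_traceZ. Qed.

Lemma vtrace0 f : vtrace 0 f = 0.
Proof.
rewrite /vtrace; have -> : (f \o projv 0)%VF = 0 *: f.
  apply/lfunP => x; rewrite comp_lfunE scale0r zero_lfunE.
  by have := memv_proj 0 x; rewrite memv0 => /eqP ->; rewrite linear0.
by rewrite lfun_traceZ mul0r.
Qed.

Lemma vtrace_full f : vtrace fullv f = lfun_trace f.
Proof.
congr lfun_trace; apply/lfunP => x.
by rewrite comp_lfunE projv_id ?memvf.
Qed.

(** With P and Q the projections onto [U] and [V], the map f P = Q f P has the trace of f P Q = f Q,
    by cyclicity. *)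
Lemma vtrace_sub U V f : (V <= U)%VS -> (forall x, x \in U -> f x \in V) ->
  vtrace U f = vtrace V f.
Proof.
move=> VU fUV; rewrite /vtrace.
have -> : (f \o projv U)%VF = (projv V \o (f \o projv U))%VF.
  apply/lfunP => x; rewrite !comp_lfunE [RHS]projv_id //.
  by apply: fUV; exact: memv_proj.
rewrite lfun_traceC -comp_lfunA; congr lfun_trace; congr comp_lfun.
apply/lfunP => x; rewrite comp_lfunE projv_id //.
by apply: (subvP VU); exact: memv_proj.
Qed.

Lemma vtrace_comm U f g : (forall x, x \in U -> f x \in U) ->
  (forall x, x \in U -> g x \in U) ->
  vtrace U (f \o g)%VF = vtrace U (g \o f)%VF.
Proof.
move=> fU gU; rewrite /vtrace.
have E (h h' : 'End(L)) : (forall x, x \in U -> h' x \in U) ->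
    ((h \o h') \o projv U = (h \o projv U) \o (h' \o projv U))%VF.
  move=> hU; apply/lfunP => x; rewrite !comp_lfunE [projv U (h' _)]projv_id //.
  by apply: hU; exact: memv_proj.
by rewrite !E // lfun_traceC.
Qed.

Lemma vtraceB U f g : vtrace U (f - g) = vtrace U f - vtrace U g.
Proof. by rewrite vtraceD -scaleN1r vtraceZ mulN1r. Qed.

Lemma vtrace_direct U V f : (U :&: V = 0)%VS -> (forall x, x \in U -> f x \in U) ->
  (forall x, x \in V -> f x \in V) ->
  vtrace (U + V) f = vtrace U f + vtrace V f.
Proof.
move=> UV fU fV.
have part (U' V' : {vspace L}) : (U' :&: V' = 0)%VS -> (forall x, x \in U' -> f x \in U') ->
    (U' <= U + V)%VS ->
    lfun_trace (f \o (daddv_pi U' V' \o projv (U + V)))%VF = vtrace U' f.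
  move=> UV' fU' sU; rewrite /vtrace.
  have -> : (f \o (daddv_pi U' V' \o projv (U + V)) =
             (f \o projv U') \o (daddv_pi U' V' \o projv (U + V)))%VF.
    by apply/lfunP => x; rewrite !comp_lfunE [projv U' _]projv_id // memv_pi.
  rewrite lfun_traceC; congr lfun_trace; apply/lfunP => x; rewrite !comp_lfunE.
  have fx : f (projv U' x) \in U' by apply: fU'; exact: memv_proj.
  rewrite (_ : projv (U + V) _ = f (projv U' x)); last exact: (projv_id (subvP sU _ fx)).
  exact: daddv_pi_id.
have VU : (V :&: U = 0)%VS by rewrite capvC.
rewrite -(part U V) ?addvSl // -(part V U) ?addvSr // -lfun_traceD.
congr lfun_trace; apply/lfunP => x; rewrite add_lfunE !comp_lfunE -linearD.
by rewrite daddv_pi_add // memv_proj.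
Qed.

(** Passing from [U] to its image keeps the trace, and nilpotency makes the image strictly smaller
    unless [U] is zero. *)
Lemma vtrace_nil U f : (forall x, x \in U -> f x \in U) ->
  (forall x, x \in U -> nil_at f x) -> vtrace U f = 0.
Proof.
move: {2}(\dim U).+1 (ltnSn (\dim U)) => n; elim: n U => // n IH U.
rewrite ltnS => dU fU nU.
have fUU : (f @: U <= U)%VS by apply/subvP => _ /memv_imgP[x xU ->]; exact: fU.
have inU x : x \in (f @: U)%VS -> x \in U by exact: (subvP fUU).
have [sUf|nUf] := boolP (U <= f @: U)%VS.
  have [m Hm] := nil_at_unif nU.
  have : (U <= 0)%VS.
    have step k : forall x, x \in U -> exists2 y, y \in U & x = iter k f y.
      elim: k => [|k IHk] x xU; first by exists x.
      have [y yU ->] := IHk x xU.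
      have /memv_imgP[z zU ->] := subvP sUf _ yU.
      by exists z => //; rewrite iterSr.
    apply/subvP => x /(step m)[y yU ->].
    by rewrite Hm // mem0v.
  by rewrite subv0 => /eqP ->; exact: vtrace0.
rewrite (vtrace_sub fUU) => [|x xU]; last exact: memv_img.
apply: IH => [|x xU|x xU].
- rewrite (leq_trans _ dU) // ltn_neqAle (dimvS fUU) andbT.
  by rewrite (dimv_leqif_sup fUU).
- by apply: memv_img; exact: inU.
- by apply: nU; exact: inU.
Qed.

Lemma vtrace_line x : x != 0 -> vtrace <[x]> \1%VF = 1.
Proof.
move=> x0; rewrite /vtrace comp_lfun1l.
pose c := coord [tuple x] ord0.
have fx : free [tuple x] by rewrite seq1_free.
have xE y : y \in <[x]>%VS -> y = c y *: x.
  move=> /vlineP[k ->]; rewrite /c linearZ /=.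
  by rewrite (coord_free ord0 ord0 fx) eqxx mulr1.
pose B := vbasis {:L}.
have -> : lfun_trace (projv <[x]>%VS) =
    c (projv <[x]>%VS (\sum_(i < \dim {:L}) coord B i x *: B`_i)).
  rewrite /lfun_trace [projv _ _]linear_sum /c linear_sum.
  apply: eq_bigr => i _ /=.
  rewrite {1}(xE _ (memv_proj _ B`_i)) /= 3!linearZ /= mulrC.
  by [].
rewrite -(coord_vbasis (memvf x)) projv_id ?memv_line //.
by rewrite /c (coord_free ord0 ord0 fx) eqxx.
Qed.

Lemma vtrace_id U : vtrace U \1%VF = (\dim U)%:R.
Proof.
move: {2}(\dim U) (erefl (\dim U)) => n; elim: n U => [|n IH] U dU.
  by move/eqP: dU; rewrite dimv_eq0 => /eqP ->; rewrite vtrace0 dimv0.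
pose x := vpick U; have x0 : x != 0 by rewrite vpick0 -dimv_eq0 dU.
have xU : (<[x]> <= U)%VS by rewrite -memvE memv_pick.
have cap0 : (<[x]> :&: (U :\: <[x]>) = 0)%VS.
  by rewrite capvC capv_diff.
have UE : (<[x]> + (U :\: <[x]>) = U)%VS.
  by rewrite addvC addv_diff; apply/addv_idPl.
have dD : \dim (U :\: <[x]>) = n.
  have := dimv_disjoint_sum cap0; rewrite UE dU dim_vline x0 add1n.
  by case.
rewrite -{1}UE vtrace_direct ?vtrace_line ?IH //; last 2 first.
- by move=> y; rewrite id_lfunE.
- by move=> y; rewrite id_lfunE.
by rewrite dD dU -natr1 addrC.
Qed.

Lemma vtrace_gen U f c : (forall x, x \in U -> f x \in U) ->
  (forall x, x \in U -> nil_at (f - c *: \1)%VF x) -> vtrace U f = c * (\dim U)%:R.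
Proof.
move=> fU nU; have -> : f = (f - c *: \1)%VF + (c *: \1)%VF by rewrite subrK.
rewrite vtraceD vtraceZ vtrace_id vtrace_nil ?add0r // => x xU.
rewrite add_lfunE opp_lfunE scale_lfunE id_lfunE.
by rewrite memvB ?memvZ ?fU.
Qed.

(** Vectors satisfying [P] are adjoined one at a time; the dimension of [L] bounds the number of
    steps. *)
Lemma pred_vspace (P : L -> Prop) : P 0 -> (forall a x y, P x -> P y -> P (a *: x + y)) ->
  exists U : {vspace L}, forall x, x \in U <-> P x.
Proof.
move=> P0 PD.
suff H n : forall U : {vspace L}, (forall x, x \in U -> P x) ->
    (\dim {:L} - \dim U <= n)%N -> exists U : {vspace L}, forall x, x \in U <-> P x.
  apply: (H _ 0%VS _ (leqnn _)) => x; rewrite memv0 => /eqP -> //.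
elim: n => [|n IH] U UP dU.
  exists U => x; split=> [|_]; first exact: UP.
  suff -> : U = fullv by exact: memvf.
  by apply/eqP; rewrite eqEdim subvf /=; move: dU; rewrite leqn0 subn_eq0.
have [[x [Px xU]]|no] := pselect (exists x, P x /\ x \notin U); last first.
  exists U => x; split=> [|Px]; first exact: UP.
  by apply/negPn/negP => xU; apply: no; exists x.
apply: (IH (U + <[x]>)%VS) => [y|].
  move=> /memv_addP[u uU [v /vlineP[k ->] ->]]; rewrite addrC.
  by apply: PD => //; exact: UP.
rewrite leq_subLR; apply: (leq_trans (n := (\dim U).+1 + n)).
  by rewrite addSnnS -leq_subLR.
rewrite leq_add2r ltnNge; apply/negP => dl; move/negP: xU; apply.
have sUx : (U <= U + <[x]>)%VS by exact: addvSl.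
have /eqP -> : U == (U + <[x]>)%VS by rewrite eqEdim sUx.
by rewrite memvE addvSr.
Qed.

(** Turns a linear condition stated in [Prop], such as local nilpotency, into a subspace; the value
    is [0] when the condition describes none. *)
Definition vspace_of (P : L -> Prop) : {vspace L} :=
  if pselect (exists U : {vspace L}, forall x, x \in U <-> P x) is left ex
  then sval (cid ex) else 0%VS.

Lemma mem_vspace_of (P : L -> Prop) : P 0 ->
  (forall a x y, P x -> P y -> P (a *: x + y)) ->
  forall x, x \in vspace_of P <-> P x.
Proof.
move=> P0 PD; rewrite /vspace_of; case: pselect => [ex|[]].
  exact: svalP (cid ex).
exact: pred_vspace.
Qed.

End RestrictedTrace.

(** * Joint generalized eigenspaces of a commuting family *)

Record toral_pair (C : numClosedFieldType) (L : finLieAlgType C) (s : 'End(L))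
    (t : nat) (A : {vspace L}) : Prop := ToralPair {
  tp_gt0 : (0 < t)%N;
  tp_order : forall x, iter t s x = x;
  tp_lie : forall x y, s (lie x y) = lie (s x) (s y);
  tp_fix : forall x, x \in A -> s x = x;
  tp_abelian : forall x y, x \in A -> y \in A -> lie x y = 0 }.

Section JointEigenspaces.
Context (C : numClosedFieldType) (L : finLieAlgType C).
Context (s : 'End(L)) (t : nat) (A : {vspace L}) (TP : toral_pair s t A).
Implicit Types (x y : L) (l m : dual_space A) (z w : C) (U V : {vspace L}).
Local Notation op := (option (subvs_of A)).
Implicit Types (o : op).

Lemma lfun_eigenvector (f : 'End(L)) U : U != 0%VS ->
  (forall x, x \in U -> f x \in U) ->
  exists c, exists2 v, v \in U & v != 0 /\ f v = c *: v.
Proof.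
move=> U0 fU; pose B := vbasis U.
have dU : (0 < \dim U)%N by rewrite lt0n dimv_eq0.
pose M := \matrix_(i < \dim U, j < \dim U) coord B j (f B`_i).
have [c /eigenvalueP[u uM u0]] := eigenvalue_closed M dU.
have BU (i : 'I_(\dim U)) : B`_i \in U by apply: vbasis_mem; rewrite mem_nth ?size_tuple.
have fB : free B by exact: basis_free (vbasisP U).
exists c; exists (\sum_i u 0 i *: B`_i).
  by apply: memv_suml => i _; exact: memvZ.
split.
  apply: contra u0 => /eqP u0; apply/eqP/rowP => i; rewrite mxE.
  by have /freeP H := fB; exact: (H (u 0) u0 i).
rewrite linear_sum scaler_sumr.
transitivity (\sum_i \sum_j (u 0 i * M i j) *: B`_j).
  apply: eq_bigr => i _; rewrite linearZ /= {1}(coord_vbasis (fU _ (BU i))).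
  by rewrite scaler_sumr; apply: eq_bigr => j _; rewrite mxE scalerA.
rewrite exchange_big; apply: eq_bigr => j _ /=.
rewrite scalerA -scaler_suml; congr (_ *: _).
by move/rowP: uM => /(_ j); rewrite !mxE.
Qed.

(** [None] stands for the automorphism and [Some h] for [ad h], so that the whole commuting family
    is treated at once. *)
Definition op_fun o : 'End(L) := if o is Some h then ad (vsval h) else s.
Definition op_val l z o : C := if o is Some h then l h else z.

Lemma op_comm o o' x : op_fun o (op_fun o' x) = op_fun o' (op_fun o x).
Proof.
case: o o' => [h|] [h'|] //=; rewrite ?adE.
- have := ad_lie (vsval h) (vsval h'); rewrite (tp_abelian TP (subvsP h) (subvsP h')).
  move/lfunP => /(_ x); rewrite adE add_lfunE opp_lfunE !comp_lfunE !adE.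
  rewrite (lieC 0) linear0 oppr0 => /esym/eqP.
  by rewrite subr_eq0 => /eqP.
- by rewrite (tp_lie TP) (tp_fix TP (subvsP _)).
- by rewrite (tp_lie TP) (tp_fix TP (subvsP _)).
Qed.

Definition op_stable U := forall o x, x \in U -> op_fun o x \in U.

Lemma shiftE (f : 'End(L)) (c : C) x : (f - c *: \1)%VF x = f x - c *: x.
Proof. by rewrite add_lfunE opp_lfunE scale_lfunE id_lfunE. Qed.

(** If every operator is scalar on [U], any nonzero vector will do. Otherwise an eigenspace of a
    non-scalar one is nonzero, smaller, and stable because the operators commute. *)
Lemma joint_eigenvector U : U != 0%VS -> op_stable U ->
  exists v l z, [/\ v \in U, v != 0 & forall o, op_fun o v = op_val l z o *: v].
Proof.
move: {2}(\dim U).+1 (ltnSn (\dim U)) => n; elim: n U => // n IH U.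
rewrite ltnS => dU U0 sU.
have [|] := pselect (forall o, exists c, forall x, x \in U -> op_fun o x = c *: x).
  move=> H; pose v := vpick U; have v0 : v != 0 by rewrite vpick0.
  have vU : v \in U by exact: memv_pick.
  have [z zE] := H None.
  have fv : free [tuple v] by rewrite seq1_free.
  (* The eigenvalue of [ad h] is read off as the coordinate of [h, v] = - [v, h] along [v], which
     makes it linear in [h] by construction. *)
  pose l : dual_space A := ((linfun (coord [tuple v] ord0 : L -> C^o)) \o
    ((- ad v) \o linfun (vsval : subvs_of A -> L)))%VF.
  exists v, l, z; split=> // -[h|] /=; last exact: zE.
  rewrite /l !comp_lfunE opp_lfunE. rewrite !lfunE /= -lieC.
  have [c cE] := H (Some h); have /= := cE v vU; rewrite adE => ->.
  rewrite linearZ /= (coord_free ord0 ord0 fv) eqxx.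
  by rewrite mulr1.
move=> /existsNP[o /forallNP H].
have [c [v vU [v0 vE]]] := lfun_eigenvector U0 (sU o).
pose U' := (U :&: lker (op_fun o - c *: \1)%VF)%VS.
have inU' x : x \in U' = (x \in U) && (op_fun o x == c *: x).
  by rewrite memv_cap memv_ker shiftE subr_eq0.
have U'U : (U' <= U)%VS by exact: capvSl.
have dU' : (\dim U' < \dim U)%N.
  rewrite ltnNge; apply/negP => dd; apply: (H c) => x xU.
  have /eqP U'E : U' == U by rewrite eqEdim U'U.
  by move: xU; rewrite -U'E inU' => /andP[_ /eqP].
have [|||v' [l [z [v'U v'0 v'E]]]] := IH U'.
- exact: leq_trans dU' dU.
- apply/eqP => U'0; have : v \in U' by rewrite inU' vU vE eqxx.
  by rewrite U'0 memv0 (negPf v0).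
- move=> o' x; rewrite !inU' => /andP[xU /eqP xE].
  by rewrite sU //= op_comm xE linearZ.
by exists v', l, z; split=> //; exact: (subvP U'U).
Qed.

Definition joint_gen l z x := forall o, nil_at (op_fun o - op_val l z o *: \1)%VF x.

Definition gen_weight l z : {vspace L} := vspace_of (joint_gen l z).
Local Notation gw := gen_weight.

Lemma gen_weightP l z x : x \in gw l z <-> joint_gen l z x.
Proof.
apply: mem_vspace_of => [o|a y y' yP y'P o]; first exact: nil_at0.
by apply: nil_atD => //; exact: nil_atZ.
Qed.

Lemma iter_commute (f g : 'End(L)) n x : (forall y, f (g y) = g (f y)) ->
  iter n f (g x) = g (iter n f x).
Proof. by move=> fg; elim: n => //= n ->. Qed.

Lemma op_shift_commr o o' c x :
  (op_fun o - c *: \1)%VF (op_fun o' x) = op_fun o' ((op_fun o - c *: \1)%VF x).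
Proof. by rewrite !shiftE [RHS]linearB [in RHS]linearZ /= op_comm. Qed.

Lemma gen_weight_stable l z : op_stable (gw l z).
Proof.
move=> o x /gen_weightP xP; apply/gen_weightP => o'; have [n xn] := xP o'.
by exists n; rewrite iter_commute ?xn ?linear0 // => y; exact: op_shift_commr.
Qed.

(** Fitting decomposition. If [U] exceeds the generalized weight space of one of its eigenvectors,
    some shifted operator [f] is not nilpotent on [U]. The part killed by powers of [f] and the
    image of a high power are then both stable and smaller. *)
Lemma gen_weight_span U : op_stable U ->
  exists W : seq (dual_space A * C), (U <= \sum_(u <- W) gw u.1 u.2)%VS /\
    forall u, u \in W -> gw u.1 u.2 != 0%VS.
Proof.
move: {2}(\dim U).+1 (ltnSn (\dim U)) => n; elim: n U => // n IH U.
rewrite ltnS => dU sU.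
have [->|U0] := eqVneq U 0%VS; first by exists [::]; rewrite sub0v.
have [v [l [z [vU v0 vE]]]] := joint_eigenvector U0 sU.
have vg : v \in gw l z.
  by apply/gen_weightP => o; exists 1%N; rewrite /= shiftE vE subrr.
have [Ug|] := pselect (forall x, x \in U -> x \in gw l z).
  exists [:: (l, z)]; rewrite big_seq1; split; first exact/subvP.
  move=> u; rewrite inE => /eqP -> /=; apply: contra v0 => /eqP g0.
  by rewrite -memv0 -g0.
move=> /existsNP[x /not_implyP[xU xg]].
have /existsNP[o xo] : ~ joint_gen l z x by move/gen_weightP.
pose f := (op_fun o - op_val l z o *: \1)%VF; rewrite -/f in xo.
pose K := vspace_of (fun y => y \in U /\ nil_at f y).
have KP y : y \in K <-> y \in U /\ nil_at f y.
  apply: mem_vspace_of => [|a y1 y2 [y1U y1n] [y2U y2n]].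
    by split; [exact: mem0v|exact: nil_at0].
  by split; [rewrite memvD ?memvZ|apply: nil_atD => //; exact: nil_atZ].
have [N HN] : exists N, forall y, y \in K -> iter N f y = 0.
  by apply: nil_at_unif => y /KP[].
pose g := iter N (fun h => f \o h)%VF \1%VF.
have gE y : g y = iter N f y.
  rewrite /g; elim: (N) => [|k IHk] /=; first by rewrite id_lfunE.
  by rewrite comp_lfunE IHk.
have fU y : y \in U -> f y \in U.
  by move=> yU; rewrite shiftE memvB ?memvZ ?sU.
have gU y : y \in U -> g y \in U.
  by rewrite gE => yU; elim: (N) => //= k; exact: fU.
pose I := (g @: U)%VS.
have KU : (K <= U)%VS by apply/subvP => y /KP[].
have IU : (I <= U)%VS by apply/subvP => _ /memv_imgP[y yU ->]; exact: gU.
have KE : (U :&: lker g = K)%VS.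
  apply/vspaceP => y; rewrite memv_cap memv_ker gE; apply/andP/idP.
    by move=> [yU /eqP yN]; apply/KP; split=> //; exists N.
  by move=> yK; rewrite HN //; split=> //; have /KP[] := yK.
have KI : (K :&: I = 0)%VS.
  apply/eqP; rewrite -subv0; apply/subvP => y; rewrite memv_cap.
  move=> /andP[/KP[_ [k yk]] /memv_imgP[u uU yE]].
  have : u \in K by apply/KP; split=> //; exists (k + N)%N; rewrite iterD -gE -yE.
  by rewrite yE gE => /HN ->; rewrite mem0v.
have dKI := limg_ker_dim g U; rewrite KE -/I in dKI.
have UKI : (U = K + I)%VS.
  apply/eqP; rewrite eq_sym eqEdim subv_add KU IU dimv_disjoint_sum //=.
  by rewrite dKI.
have dI : (\dim I < \dim U)%N.
  rewrite -dKI -[ltnLHS]add0n ltn_add2r lt0n dimv_eq0; apply: contra v0 => /eqP K0.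
  rewrite -memv0 -K0; apply/KP; split=> //; exists 1%N.
  by rewrite /= shiftE vE subrr.
have dK : (\dim K < \dim U)%N.
  rewrite ltnNge; apply/negP => dd; apply: xo.
  have /eqP E : K == U by rewrite eqEdim KU.
  by move: xU; rewrite -E => /KP[].
have sK : op_stable K.
  move=> o' y /KP[yU [k yk]]; apply/KP; split; first exact: sU.
  by exists k; rewrite iter_commute ?yk ?linear0 // => u; exact: op_shift_commr.
have sI : op_stable I.
  move=> o' _ /memv_imgP[y yU ->]; apply/memv_imgP; exists (op_fun o' y).
    exact: sU.
  by rewrite !gE iter_commute // => u; exact: op_shift_commr.
have [W1 [sW1 W1P]] := IH K (leq_trans dK dU) sK.
have [W2 [sW2 W2P]] := IH I (leq_trans dI dU) sI.
exists (W1 ++ W2); rewrite big_cat UKI; split; first exact: addvS.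
by move=> u; rewrite mem_cat => /orP[/W1P|/W2P].
Qed.

Lemma nil_at_inj (f : 'End(L)) c c' x : c != c' ->
  nil_at (f - c *: \1)%VF x -> nil_at (f - c' *: \1)%VF x -> x = 0.
Proof.
move=> cc' [n]; elim: n x => //= n IH x; rewrite -iterS iterSr => xn [m xm].
have /IH x' := xn.
have : f x = c *: x.
  apply/eqP; rewrite -subr_eq0 -shiftE; apply/eqP/x'; exists m.
  rewrite iter_commute ?xm ?linear0 // => y.
  rewrite !shiftE !linearB !linearZ /= !scalerA (mulrC c).
  exact: addrACA.
move=> fx; have : iter m (f - c' *: \1)%VF x = (c - c') ^+ m *: x.
  elim: m {xm} => [|m IHm]; first by rewrite expr0 scale1r.
  by rewrite iterS IHm linearZ /= shiftE fx -scalerBl scalerA exprSr.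
rewrite xm => /esym/eqP; rewrite scaler_eq0 expf_eq0 subr_eq0 (negPf cc') andbF.
by move/eqP.
Qed.

(** A product of high powers of shifted operators, one for each element of [W], with the operator
    chosen to distinguish that weight from [(l, z)]. It yields directness of the sum of weight
    spaces. *)
Lemma separating (W : seq (dual_space A * C)) l z : (l, z) \notin W ->
  exists f : 'End(L), [/\ forall m w, (m, w) \in W -> forall x, x \in gw m w -> f x = 0,
    forall x, x \in gw l z -> f x = 0 -> x = 0 &
    forall m w x, x \in gw m w -> f x \in gw m w].
Proof.
elim: W => [|[m w] W IH].
  move=> _; exists \1%VF; split=> // [x _|m w x]; by rewrite id_lfunE.
rewrite inE negb_or => /andP[ne /IH[f [f1 f2 f3]]].
have [o oP] : exists o, op_val m w o != op_val l z o.
  have [wz|] := eqVneq w z; last by move=> wz; exists None.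
  have /eqP ml : m != l by apply: contra ne => /eqP ->; rewrite wz.
  have [h hP] : exists h, m h != l h.
    apply: contrapT => H; apply: ml; apply/lfunP => h; apply/eqP/negPn/negP => hP.
    by apply: H; exists h.
  by exists (Some h).
pose g := (op_fun o - op_val m w o *: \1)%VF.
have [N HN] : exists N, forall y, y \in gw m w -> iter N g y = 0.
  by apply: nil_at_unif => y /gen_weightP; exact.
pose gN := iter N (fun h => g \o h)%VF \1%VF.
have gNE y : gN y = iter N g y.
  rewrite /gN; elim: (N) => [|k IHk] /=; first by rewrite id_lfunE.
  by rewrite comp_lfunE IHk.
have stab m' w' x : x \in gw m' w' -> gN x \in gw m' w'.
  rewrite gNE => xP; elim: (N) => //= k IHk.
  by rewrite shiftE memvB ?memvZ // gen_weight_stable.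
exists (gN \o f)%VF; split=> [m' w'|x xl|m' w' x xP]; last first.
- by rewrite comp_lfunE; exact/stab/f3.
- rewrite comp_lfunE gNE => fx; apply: f2 => //; apply: (@nil_at_inj (op_fun o) _ _ _ oP).
    by exists N.
  by have /gen_weightP := f3 _ _ _ xl; exact.
rewrite inE => /orP[/eqP[-> ->] x xP|/f1 fW x xP]; rewrite comp_lfunE.
  by rewrite gNE HN // f3.
by rewrite fW ?linear0.
Qed.

End JointEigenspaces.

(** * Weight decomposition and the Killing form *)

Section WeightDecomposition.
Context (C : numClosedFieldType) (L : finLieAlgType C).
Context (s : 'End(L)) (t : nat) (A : {vspace L}) (TP : toral_pair s t A).
Implicit Types (x y : L) (l m : dual_space A) (z w : C) (U V : {vspace L}).
Implicit Types (u v : (dual_space A * C)%type) (W : seq (dual_space A * C)).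
Local Notation gw := (gen_weight s).

(** Operators of finite order are diagonalizable in characteristic zero: if f x = c x + y and f y =
    c y, then f^n x = c^n x + n c^(n-1) y, and f^n = 1 forces y = 0. *)
Lemma nil_at_sep (f : 'End(L)) (n : nat) c x : (forall y, iter n f y = y) ->
  (0 < n)%N -> nil_at (f - c *: \1)%VF x -> f x = c *: x.
Proof.
move=> fn n0 [k]; elim: k x => [|k IH] x /=; first by move=> ->; rewrite linear0 scaler0.
rewrite -iterS iterSr => /IH; set y := (f - c *: \1)%VF x => fy.
have fx : f x = c *: x + y by rewrite /y shiftE addrC subrK.
suff y0 : y = 0 by rewrite fx y0 addr0.
have iterx j : iter j.+1 f x = c ^+ j.+1 *: x + (j.+1%:R * c ^+ j) *: y.
  elim: j => [|j IHj]; first by rewrite /= fx expr1 mulr1 scale1r.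
  rewrite iterS IHj linearD !linearZ /= fx fy scalerDr !scalerA -addrA -scalerDl.
  by congr (_ *: _ + _ *: _); rewrite -?exprSr // -[j.+2%:R]natr1 mulrDl mul1r -mulrA -exprSr addrC.
have itery j : iter j f y = c ^+ j *: y.
  elim: j => [|j IHj]; first by rewrite scale1r.
  by rewrite iterS IHj linearZ /= fy scalerA -exprSr.
have [//|y0] := eqVneq y 0.
have cn : c ^+ n = 1.
  apply/eqP; rewrite -subr_eq0; have /eqP := itery n; rewrite fn -subr_eq0.
  by rewrite -{1}[y]scale1r -scalerBl scaler_eq0 (negPf y0) orbF -oppr_eq0 opprB.
case: n n0 fn cn => // n _ fn cn; have := iterx n; rewrite fn cn scale1r.
move/eqP; rewrite -subr_eq0 opprD addNKr oppr_eq0 scaler_eq0 (negPf y0) orbF.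
rewrite mulf_eq0 pnatr_eq0 /= expf_eq0 => /andP[_ /eqP c0].
by move: cn; rewrite c0 expr0n /= => /eqP; rewrite eq_sym oner_eq0.
Qed.

Lemma gen_weight_aut l z x : x \in gw l z -> s x = z *: x.
Proof.
move=> /gen_weightP/(_ None) /=; apply: (@nil_at_sep _ t); last exact: tp_gt0 TP.
exact: tp_order TP.
Qed.

Lemma lieDl x y x' : lie (x + y) x' = lie x x' + lie y x'.
Proof. by have := lieDZl 1 x y x'; rewrite !scale1r. Qed.

Lemma lieZl (a : C) x y : lie (a *: x) y = a *: lie x y.
Proof. by rewrite lieC linearZ /= -scalerN -lieC. Qed.

Lemma lieNl x y : lie (- x) y = - lie x y.
Proof. by rewrite -scaleN1r lieZl scaleN1r. Qed.

Lemma lieBr x y x' : lie x (y - x') = lie x y - lie x x'.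
Proof. exact: linearB. Qed.

Lemma lieZr (a : C) x y : lie x (a *: y) = a *: lie x y.
Proof. exact: linearZ. Qed.

Lemma lie0l x : lie 0 x = 0.
Proof. by rewrite lieC linear0 oppr0. Qed.

Lemma lie_leibniz h x y : lie h (lie x y) = lie (lie h x) y + lie x (lie h y).
Proof.
have := jacobi h x y; rewrite (lieC y (lie h x)) (lieC y h) linearN /=.
move=> /eqP; rewrite -addrA addr_eq0 => /eqP ->.
by rewrite opprD !opprK addrC.
Qed.

(** The shifted operator on the bracket is the sum of the shifted operators on the two arguments, so
    each application lowers one of the two exponents. *)
Lemma bracket_nil h (c d : C) x y : nil_at (ad h - c *: \1)%VF x ->
  nil_at (ad h - d *: \1)%VF y -> nil_at (ad h - (c + d) *: \1)%VF (lie x y).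
Proof.
move=> [a xa] [b yb]; exists (a + b)%N.
elim: a b x y xa yb => [|a IHa] b x y; first by move=> /= -> _; rewrite lie0l iter_lin0.
elim: b x y => [|b IHb] x y xa yb.
  have -> : lie x y = 0 by have -> : y = 0 by []; rewrite linear0.
  exact: iter_lin0.
rewrite addSn iterSr.
have -> : (ad h - (c + d) *: \1)%VF (lie x y) =
    lie ((ad h - c *: \1)%VF x) y + lie x ((ad h - d *: \1)%VF y).
  rewrite !shiftE !adE lieBr lieZr lieDl lieNl lieZl scalerDl.
  rewrite lie_leibniz.
  by rewrite opprD addrACA.
rewrite iter_linD (IHa b.+1 ((ad h - c *: \1)%VF x) y) ?add0r -?iterSr //.
by rewrite -addSnnS IHb // -iterSr.
Qed.

Lemma gen_weight_lie l z m w x y : x \in gw l z -> y \in gw m w ->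
  lie x y \in gw (l + m) (z * w).
Proof.
move=> xl ym; apply/gen_weightP => -[h|] /=.
  rewrite add_lfunE; apply: bracket_nil.
    by have /gen_weightP/(_ (Some h)) := xl.
  by have /gen_weightP/(_ (Some h)) := ym.
exists 1%N; rewrite /= shiftE (tp_lie TP) (gen_weight_aut xl) (gen_weight_aut ym).
by rewrite lieZl linearZ /= scalerA subrr.
Qed.

Lemma gen_weight_cap l z W : (l, z) \notin W ->
  (gw l z :&: \sum_(u <- W) gw u.1 u.2 = 0)%VS.
Proof.
move=> /(separating TP)[f [f1 f2 _]]; apply/eqP; rewrite -subv0; apply/subvP => x.
rewrite memv_cap => /andP[xl xW]; rewrite memv0; apply/eqP/f2 => //.
have sub : (\sum_(u <- W) gw u.1 u.2 <= lker f)%VS.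
  rewrite big_seq; elim/big_ind: _ => [|U V sU sV|[m w] mw].
  - exact: sub0v.
  - by rewrite subv_add sU.
  by apply/subvP => y /(f1 _ _ mw) fy; rewrite memv_ker fy.
by apply/eqP; rewrite -memv_ker; exact: (subvP sub).
Qed.

Lemma sumv_sup_seq (T : eqType) (F : T -> {vspace L}) (r : seq T) (P : pred T) i : i \in r ->
  P i -> (F i <= \sum_(j <- r | P j) F j)%VS.
Proof. by move=> ir Pi; rewrite (big_rem _ ir) /= Pi addvSl. Qed.

Lemma weight_list_exists : exists W, [/\ uniq W,
  forall u, (u \in W) = (gw u.1 u.2 != 0%VS) &
  (\sum_(u <- W) gw u.1 u.2 = fullv)%VS].
Proof.
have [|W [sW WP]] := @gen_weight_span _ _ s t A TP fullv; first by move=> o x _; exact: memvf.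
have full : (\sum_(u <- undup W) gw u.1 u.2 = fullv)%VS.
  apply/eqP; rewrite eqEsubv subvf /=; apply: subv_trans sW _.
  rewrite big_seq; elim/big_ind: _ => [|U V sU sV|u uW].
  - exact: sub0v.
  - by rewrite subv_add sU.
  by apply: (sumv_sup_seq (fun u => gw u.1 u.2)); rewrite ?mem_undup.
exists (undup W); split=> // [|[l z]]; first exact: undup_uniq.
apply/idP/idP; first by rewrite mem_undup; exact: WP.
by apply: contraNT => /gen_weight_cap; rewrite full capvf => ->.
Qed.

Definition weight_list : seq (dual_space A * C) := sval (cid weight_list_exists).
Local Notation WL := weight_list.

Lemma weight_list_uniq : uniq WL.
Proof. by rewrite /WL; case: cid => W []. Qed.

Lemma mem_weight_list u : (u \in WL) = (gw u.1 u.2 != 0%VS).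
Proof. by rewrite /WL; case: cid => W []. Qed.

Lemma weight_list_full : (\sum_(u <- WL) gw u.1 u.2 = fullv)%VS.
Proof. by rewrite /WL; case: cid => W []. Qed.

Definition weight_comp u : 'End(L) :=
  daddv_pi (gw u.1 u.2) (\sum_(v <- WL | v != u) gw v.1 v.2)%VS.

Lemma weight_comp_cap u : (gw u.1 u.2 :&: \sum_(v <- WL | v != u) gw v.1 v.2 = 0)%VS.
Proof.
rewrite -big_filter; apply: gen_weight_cap.
by rewrite -surjective_pairing mem_filter eqxx.
Qed.

Lemma weight_comp_id u x : x \in gw u.1 u.2 -> weight_comp u x = x.
Proof. by move=> xu; rewrite /weight_comp daddv_pi_id // weight_comp_cap. Qed.

Lemma weight_comp_mem u x : weight_comp u x \in gw u.1 u.2.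
Proof. exact: memv_pi. Qed.

Lemma weight_comp_ne u v x : x \in gw v.1 v.2 -> v != u -> weight_comp u x = 0.
Proof.
move=> xv vu; have [x0|x0] := eqVneq x 0; first by rewrite x0 linear0.
set V := (\sum_(w <- WL | w != u) gw w.1 w.2)%VS.
have cap := weight_comp_cap u; rewrite -/V in cap.
have xV : x \in V.
  have vW : v \in WL.
    by rewrite mem_weight_list; apply: contra x0 => /eqP g0; rewrite -memv0 -g0.
  exact: (subvP (sumv_sup_seq (fun u => gw u.1 u.2) vW vu) _ xv).
have := @daddv_pi_add _ _ (gw u.1 u.2) V x cap (subvP (addvSr _ _) _ xV).
rewrite -/(weight_comp u) [X in _ + X]daddv_pi_id //; last by rewrite capvC.
by move/eqP; rewrite -subr_eq0 addrK => /eqP.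
Qed.

Lemma weight_comp_sum x : x = \sum_(u <- WL) weight_comp u x.
Proof.
pose T := (\1 - \sum_(u <- WL) weight_comp u)%VF.
suff : x \in lker T.
  rewrite memv_ker add_lfunE opp_lfunE id_lfunE subr_eq0 => /eqP {1}->.
  by rewrite sum_lfunE.
suff sub : (fullv <= lker T)%VS by exact: (subvP sub _ (memvf x)).
rewrite -weight_list_full big_seq; elim/big_ind: _ => [|U V sU sV|v vW].
- exact: sub0v.
- by rewrite subv_add sU.
apply/subvP => y yv; rewrite memv_ker add_lfunE opp_lfunE id_lfunE subr_eq0 sum_lfunE.
rewrite (bigD1_seq v) ?weight_list_uniq //= weight_comp_id // big1 ?addr0 // => u uv.
by apply: weight_comp_ne yv _; rewrite eq_sym.
Qed.

Lemma gen_weight_unique l z m w x : x \in gw l z -> x \in gw m w -> x != 0 ->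
  l = m /\ z = w.
Proof.
move=> xl xm x0; have [[-> ->] //|ne] := eqVneq (l, z) (m, w).
have := @weight_comp_ne (m, w) (l, z) x xl ne.
by rewrite weight_comp_id // => xE; rewrite xE eqxx in x0.
Qed.

Lemma vtrace_sum_weights W (f : 'End(L)) : uniq W ->
  (forall u x, x \in gw u.1 u.2 -> f x \in gw u.1 u.2) ->
  vtrace (\sum_(u <- W) gw u.1 u.2) f = \sum_(u <- W) vtrace (gw u.1 u.2) f.
Proof.
move=> + fP; elim: W => [_|u W IH /= /andP[uW /IH IHW]]; first by rewrite !big_nil vtrace0.
rewrite !big_cons vtrace_direct ?IHW //; first by apply: gen_weight_cap; rewrite -surjective_pairing.
  exact: fP.
move=> x xW.
have sub : (\sum_(u <- W) gw u.1 u.2 <= f @^-1: (\sum_(u <- W) gw u.1 u.2))%VS.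
  rewrite {1}big_seq; elim/big_ind: _ => [|U V sU sV|v vW].
  - exact: sub0v.
  - by rewrite subv_add sU.
  apply/subvP => y yv; rewrite -memv_preim.
  by apply: (subvP (sumv_sup_seq (fun u => gw u.1 u.2) vW isT)); exact: fP.
by rewrite memv_preim; exact: (subvP sub).
Qed.

Lemma gen_weight_ad l z (h : subvs_of A) x : x \in gw l z -> ad (vsval h) x \in gw l z.
Proof. exact: (@gen_weight_stable _ _ s t A TP l z (Some h)). Qed.

Lemma gen_weight_nil l z (h : subvs_of A) x : x \in gw l z ->
  nil_at (ad (vsval h) - l h *: \1)%VF x.
Proof. by move=> /gen_weightP/(_ (Some h)). Qed.

Lemma vtrace_ad U l z (h : subvs_of A) : (U <= gw l z)%VS ->
  (forall x, x \in U -> lie (vsval h) x \in U) ->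
  vtrace U (ad (vsval h)) = (l h : C) * (\dim U)%:R.
Proof.
move=> Ul hU; apply: vtrace_gen => x xU; first by rewrite adE hU.
by apply: (@gen_weight_nil l z); exact: (subvP Ul).
Qed.

(** After the scalar [l h] is subtracted from [ad h], the product with the commuting [ad h'] is
    nilpotent and has trace zero. *)
Lemma vtrace_ad2 l z (h h' : subvs_of A) :
  vtrace (gw l z) (ad (vsval h) \o ad (vsval h'))%VF =
  (l h : C) * (l h' : C) * (\dim (gw l z))%:R.
Proof.
have -> : (ad (vsval h) \o ad (vsval h') =
  ((ad (vsval h) - l h *: \1) \o ad (vsval h')) + l h *: ad (vsval h'))%VF.
  by apply/lfunP => x; rewrite add_lfunE scale_lfunE !comp_lfunE shiftE subrK.
rewrite vtraceD vtraceZ (@vtrace_ad _ l z) //; last first.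
  by move=> x xl; rewrite -adE; exact: gen_weight_ad.
rewrite vtrace_nil ?add0r ?mulrA // => x xl.
  by rewrite comp_lfunE shiftE memvB ?memvZ ?gen_weight_ad.
have [n xn] := gen_weight_nil h xl.
have comm y : (ad (vsval h) - l h *: \1)%VF (ad (vsval h') y) =
    ad (vsval h') ((ad (vsval h) - l h *: \1)%VF y).
  exact: (@op_shift_commr _ _ s t A TP (Some h) (Some h')).
have E k y : iter k ((ad (vsval h) - l h *: \1) \o ad (vsval h'))%VF y =
    iter k (ad (vsval h')) (iter k (ad (vsval h) - l h *: \1)%VF y).
  elim: k y => // k IHk y; rewrite iterSr IHk comp_lfunE comm.
  by rewrite iter_commute // -!iterSr.
by exists n; rewrite E xn iter_lin0.
Qed.

Lemma killing_toral (h h' : subvs_of A) : killing (vsval h) (vsval h') =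
  \sum_(u <- WL) (u.1 h : C) * (u.1 h' : C) * (\dim (gw u.1 u.2))%:R.
Proof.
rewrite /killing -vtrace_full -weight_list_full vtrace_sum_weights ?weight_list_uniq //.
  by apply: eq_bigr => u _; exact: vtrace_ad2.
by move=> u x xu; rewrite comp_lfunE !gen_weight_ad.
Qed.

Lemma killingDl x y x' : killing (x + y) x' = killing x x' + killing y x'.
Proof.
by rewrite !(killingC _ x'); have := killing_linear x' 1 x y; rewrite !scale1r.
Qed.

Lemma killingZl (a : C) x y : killing (a *: x) y = a * killing x y.
Proof.
rewrite !(killingC _ y); have := killing_linear y a x 0; rewrite addr0 => ->.
by rewrite (linear_fun0 (killing_linear y)) addr0.
Qed.

Lemma killingZr (a : C) x y : killing y (a *: x) = a * killing y x.
Proof. by rewrite killingC killingZl killingC. Qed.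

Lemma killingDr x y x' : killing x' (x + y) = killing x' x + killing x' y.
Proof. by rewrite !(killingC x') killingDl. Qed.

Lemma killing0l x : killing 0 x = 0.
Proof. by rewrite -(scale0r 0) killingZl mul0r. Qed.

Lemma killing0r x : killing x 0 = 0.
Proof. by rewrite killingC killing0l. Qed.

Lemma killing_ad h x y : killing (lie h x) y = - killing x (lie h y).
Proof.
by rewrite killingC killing_invariant lieC -scaleN1r killingZr mulN1r.
Qed.

Lemma killing_nil h (c d : C) x y : nil_at (ad h - c *: \1)%VF x ->
  nil_at (ad h - d *: \1)%VF y -> c + d != 0 -> killing x y = 0.
Proof.
move=> [a xa] [b yb] cd.
elim: a b x y xa yb => [|a IHa] b x y; first by move=> /= -> _; rewrite killing0l.
elim: b x y => [|b IHb] x y xa yb.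
  have -> : y = 0 by []. exact: killing0r.
apply: (mulfI cd); rewrite mulr0.
have -> : (c + d) * killing x y =
    - (killing ((ad h - c *: \1)%VF x) y + killing x ((ad h - d *: \1)%VF y)).
  rewrite !shiftE !adE killingDl killingDr -!scaleNr killingZl killingZr killing_ad.
  by ring.
by rewrite (IHa b.+1 ((ad h - c *: \1)%VF x) y) ?add0r ?IHb ?oppr0 // -iterSr.
Qed.

(** This is invariance under conjugation by [s], whose inverse is the power with exponent [t.-1]. *)
Lemma lfun_trace_aut (f : 'End(L)) : lfun_trace f =
  lfun_trace (s \o (f \o iter t.-1 (fun g => s \o g)%VF \1))%VF.
Proof.
have sE k x : iter k (fun g => s \o g)%VF \1%VF x = iter k s x.
  elim: k => [|k IHk] /=; first by rewrite id_lfunE.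
  by rewrite comp_lfunE IHk.
rewrite lfun_traceC; congr lfun_trace; apply/lfunP => x.
rewrite !comp_lfunE sE -iterSr prednK ?(tp_gt0 TP) //.
by rewrite (tp_order TP).
Qed.

Lemma killing_aut x y : killing (s x) (s y) = killing x y.
Proof.
rewrite /killing [RHS]lfun_trace_aut; congr lfun_trace; apply/lfunP => v.
rewrite !comp_lfunE !adE !(tp_lie TP); congr (lie _ (lie _ _)).
have sE k y' : iter k (fun g => s \o g)%VF \1%VF y' = iter k s y'.
  elim: k => [|k IHk] /=; first by rewrite id_lfunE.
  by rewrite comp_lfunE IHk.
by rewrite sE -iterS prednK ?(tp_gt0 TP) // (tp_order TP).
Qed.

Lemma killing_gen_weight l z m w x y : x \in gw l z -> y \in gw m w ->
  killing x y != 0 -> m = - l /\ w = z^-1.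
Proof.
move=> xl ym k0; split.
  apply/lfunP => h; rewrite opp_lfunE; apply/eqP; rewrite -addr_eq0 addrC.
  apply: contraNT k0 => hh; apply/eqP; apply: killing_nil hh.
    exact: gen_weight_nil xl.
  exact: gen_weight_nil ym.
have := killing_aut x y; rewrite (gen_weight_aut xl) (gen_weight_aut ym).
rewrite killingZl killingZr mulrA => /eqP.
rewrite -subr_eq0 -{2}[killing x y]mul1r -mulrBl mulf_eq0 (negPf k0) orbF subr_eq0.
move=> /eqP zw; have z0 : z != 0.
  by apply/eqP => z0; move: zw; rewrite z0 mul0r => /eqP; rewrite eq_sym oner_eq0.
by apply: (mulfI z0); rewrite zw divff.
Qed.

Lemma gen_weight_order l z : gw l z != 0%VS -> z ^+ t = 1.
Proof.
rewrite -vpick0 => v0; have vl := memv_pick (gw l z).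
have : iter t s (vpick (gw l z)) = z ^+ t *: vpick (gw l z).
  elim: (t) => [|k IHk]; first by rewrite scale1r.
  by rewrite iterS IHk linearZ /= (gen_weight_aut vl) scalerA -exprSr.
rewrite (tp_order TP) => /eqP; rewrite -subr_eq0 -{1}[vpick _]scale1r -scalerBl.
by rewrite scaler_eq0 (negPf v0) orbF subr_eq0 => /eqP.
Qed.

Lemma gen_weight_neq0 l z : gw l z != 0%VS -> z != 0.
Proof.
move=> /gen_weight_order zt; apply/eqP => z0; move: zt.
by rewrite z0 expr0n gtn_eqF ?(tp_gt0 TP) // => /eqP; rewrite eq_sym oner_eq0.
Qed.

Lemma weight_vector l z U : (U <= gw l z)%VS -> U != 0%VS ->
  (forall (h : subvs_of A) x, x \in U -> lie (vsval h) x \in U) ->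
  exists2 v : L, v \in U & v != 0 /\ forall h : subvs_of A, lie (vsval h) v = l h *: v.
Proof.
move=> Ul U0 hU.
have [||v [l' [z' [vU v0 vE]]]] := @joint_eigenvector _ _ s t A TP U => //.
  case=> [h|] x xU /=; first by rewrite adE hU.
  by rewrite (gen_weight_aut (subvP Ul _ xU)) memvZ.
have vl' : v \in gw l' z'.
  by apply/gen_weightP => o; exists 1%N; rewrite /= shiftE vE subrr.
have [ll _] := gen_weight_unique (subvP Ul _ vU) vl' v0.
by exists v => //; split=> // h; have /= := vE (Some h); rewrite adE ll.
Qed.

Lemma weight_vector_mem l z (v : L) : s v = z *: v ->
  (forall h : subvs_of A, lie (vsval h) v = l h *: v) -> v \in gw l z.
Proof.
move=> sv hv; apply/gen_weightP => -[h|] /=; exists 1%N; rewrite /= shiftE ?adE.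
  by rewrite hv subrr.
by rewrite sv subrr.
Qed.

End WeightDecomposition.

(** * Roots: multiplicity one and integral pairings *)

Record split_pair (C : numClosedFieldType) (L : finLieAlgType C) (s : 'End(L))
    (t : nat) (A : {vspace L}) : Prop := SplitPair {
  sp_toral : toral_pair s t A;
  sp_nondeg : forall x : L, (forall y, killing x y = 0) -> x = 0;
  sp_zero : forall x, x \in gen_weight s (0 : dual_space A) 1 <-> x \in A }.

Section Roots.
Context (C : numClosedFieldType) (L : finLieAlgType C).
Context (s : 'End(L)) (t : nat) (A : {vspace L}) (SP : split_pair s t A).
Implicit Types (x y : L) (l m : dual_space A) (z w : C) (U V : {vspace L}).
Implicit Types (u v : (dual_space A * C)%type) (W : seq (dual_space A * C)).
Local Notation gw := (gen_weight s).
Let TP := sp_toral SP.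
Local Notation WL := (weight_list TP).

Definition is_weight l z := gw l z != 0%VS.
Local Notation wt := is_weight.

Lemma mem_WL l z : ((l, z) \in WL) = wt l z.
Proof. exact: mem_weight_list. Qed.

Lemma wt_unit l z : wt l z -> z != 0.
Proof. exact: (gen_weight_neq0 TP). Qed.

(** [A] is the weight space of [(0, 1)], which the Killing form pairs to zero with every other
    weight space. An element of [A] orthogonal to [A] is therefore orthogonal to [L]. *)
Lemma killing_flat_inj : lker (killing_flat A) == 0%VS.
Proof.
rewrite -subv0; apply/subvP => h; rewrite memv_ker memv0 => /eqP h0.
have : vsval h = 0.
  apply: (sp_nondeg SP) => y; rewrite (weight_comp_sum TP y).
  have kl : linear (killing (vsval h) : L -> C^o) by exact: killing_linear.
  rewrite (linear_fun_sum _ _ kl) big1_seq // => u _.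
  apply/eqP/negPn/negP => k0; move/negP: (k0); apply; apply/eqP.
  have h1 : vsval h \in gw (0 : dual_space A) 1 by apply/(sp_zero SP); exact: subvsP.
  have [E1 E2] := killing_gen_weight TP h1 (weight_comp_mem TP u y) k0.
  have uA : weight_comp TP u y \in A.
    apply/(sp_zero SP); have := weight_comp_mem TP u y.
    by rewrite E1 E2 oppr0 invr1.
  have := killing_flatE h (vsproj A (weight_comp TP u y)).
  by rewrite h0 zero_lfunE vsprojK // => ->.
by move=> h00; apply/eqP/val_inj.
Qed.

Lemma killing_flat_bij l : killing_flat A ((killing_flat A)^-1%VF l) = l.
Proof.
apply: limg_lfunVK; suff -> : limg (killing_flat A) = fullv by exact: memvf.
apply/eqP; rewrite eqEdim subvf /= limg_dim_eq; last first.
  by rewrite (eqP killing_flat_inj) capv0.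
by rewrite !dimvf /dim /= muln1.
Qed.

Definition dual_vec l : subvs_of A := (killing_flat A)^-1%VF l.
Local Notation tv := dual_vec.

Lemma dual_vecP l h : killing (vsval (tv l)) (vsval h) = l h.
Proof. by rewrite -killing_flatE killing_flat_bij. Qed.

Lemma dual_formE l m : dual_form l m = m (tv l).
Proof. by []. Qed.

Lemma dual_formC l m : dual_form l m = dual_form m l.
Proof. by rewrite !dual_formE -dual_vecP killingC dual_vecP. Qed.

Lemma dual_formDr l m m' : dual_form l (m + m') = dual_form l m + dual_form l m'.
Proof. by rewrite !dual_formE add_lfunE. Qed.

Lemma dual_formZr l (c : C) m : dual_form l (c *: m) = c * dual_form l m.
Proof. by rewrite !dual_formE scale_lfunE. Qed.

Lemma dual_formNr l m : dual_form l (- m) = - dual_form l m.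
Proof. by rewrite !dual_formE opp_lfunE. Qed.

Lemma dual_formDl l l' m : dual_form (l + l') m = dual_form l m + dual_form l' m.
Proof. by rewrite !(dual_formC _ m) dual_formDr. Qed.

Lemma dual_formZl l (c : C) m : dual_form (c *: l) m = c * dual_form l m.
Proof. by rewrite !(dual_formC _ m) dual_formZr. Qed.

Lemma dual_formNl l m : dual_form (- l) m = - dual_form l m.
Proof. by rewrite !(dual_formC _ m) dual_formNr. Qed.

Lemma dual_form0r l : dual_form l 0 = 0.
Proof. by rewrite dual_formE zero_lfunE. Qed.

Lemma dual_form0l l : dual_form 0 l = 0.
Proof. by rewrite dual_formC dual_form0r. Qed.

Lemma dual_form_sumr l (I : Type) (r : seq I) (F : I -> dual_space A) :
  dual_form l (\sum_(i <- r) F i) = \sum_(i <- r) dual_form l (F i).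
Proof. by rewrite dual_formE sum_lfunE. Qed.

Lemma toral_nondeg x : x \in A -> (forall h : subvs_of A, killing x (vsval h) = 0) -> x = 0.
Proof.
move=> xA xh; have : vsproj A x \in lker (killing_flat A).
  rewrite memv_ker; apply/eqP/lfunP => h.
  by rewrite killing_flatE zero_lfunE vsprojK.
rewrite (eqP killing_flat_inj) memv0 => /eqP x0.
by rewrite -(vsprojK xA) x0 linear0.
Qed.

Lemma weight_pairing l z x : x \in gw l z -> x != 0 ->
  exists2 y, y \in gw (- l) z^-1 & killing x y = 1.
Proof.
move=> xl x0.
have [y ky] : exists y, killing x y != 0.
  apply: contrapT => H; move/eqP: x0; apply; apply: (sp_nondeg SP) => y.
  by apply/eqP/negPn/negP => ky; apply: H; exists y.
have [u ku] : exists u, killing x (weight_comp TP u y) != 0.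
  apply: contrapT => H; move/negP: ky; apply; rewrite (weight_comp_sum TP y).
  have kl : linear (killing x : L -> C^o) by exact: killing_linear.
  rewrite (linear_fun_sum _ _ kl) big1_seq // => u _.
  by apply/eqP/negPn/negP => ky; apply: H; exists u.
have [E1 E2] := killing_gen_weight TP xl (weight_comp_mem TP u y) ku.
exists ((killing x (weight_comp TP u y))^-1 *: weight_comp TP u y).
  by rewrite memvZ // -E1 -E2; exact: weight_comp_mem.
by rewrite killingZr mulVf.
Qed.

Lemma wt_neg l z : wt l z -> wt (- l) z^-1.
Proof.
rewrite /wt -vpick0 => /(weight_pairing (memv_pick _))[y yl ky].
apply/eqP => g0; move: yl; rewrite g0 memv0 => /eqP y0.
by move: ky; rewrite y0 killing0r => /eqP; rewrite eq_sym oner_eq0.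
Qed.

Lemma weight_lie_opp l z x y : z != 0 -> x \in gw l z -> y \in gw (- l) z^-1 ->
  (forall h : subvs_of A, lie (vsval h) x = l h *: x) ->
  lie x y = killing x y *: vsval (tv l).
Proof.
move=> z0 xl yl hx; apply/eqP; rewrite -subr_eq0; apply/eqP/toral_nondeg => [|h].
  rewrite memvB ?memvZ ?subvsP //; apply/(sp_zero SP).
  by have := gen_weight_lie TP xl yl; rewrite subrr divff.
rewrite killingDl -scaleN1r !killingZl mulN1r dual_vecP killingC.
by rewrite killing_invariant killingC hx killingZl mulrC subrr.
Qed.

Lemma wt_pair l z : wt l z -> exists x y, [/\ x \in gw l z, x != 0, y \in gw (- l) z^-1,
  lie x y = vsval (tv l) & forall h : subvs_of A, lie (vsval h) x = l h *: x].
Proof.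
move=> wl; have [|||x xl [x0 hx]] := @weight_vector _ _ s t A TP l z (gw l z) => //.
  by move=> h x xl; rewrite -adE; exact: (gen_weight_ad TP).
have [y yl kxy] := weight_pairing xl x0.
exists x, y; split=> //.
by rewrite (weight_lie_opp (wt_unit wl) xl yl hx) kxy scale1r.
Qed.

Lemma trace_lie U x y h : (forall v : L, v \in U -> lie x v \in U) ->
  (forall v : L, v \in U -> lie y v \in U) -> lie x y = h -> vtrace U (ad h) = 0.
Proof.
move=> xU yU <-; rewrite ad_lie vtraceB vtrace_comm ?subrr // => v vU.
  by rewrite adE xU.
by rewrite adE yU.
Qed.

Definition sumW W : {vspace L} := (\sum_(u <- W) gw u.1 u.2)%VS.

Lemma sumW_ind W (P : L -> Prop) : (forall x y, P x -> P y -> P (x + y)) -> P 0 ->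
  (forall u x, u \in W -> x \in gw u.1 u.2 -> P x) -> forall x, x \in sumW W -> P x.
Proof.
move=> PD P0; rewrite /sumW; elim: W => [|u W IH] PW x.
  by rewrite big_nil memv0 => /eqP ->.
rewrite big_cons => /memv_addP[y yu [y' y'W ->]]; apply: PD.
  by apply: (PW u) yu; rewrite mem_head.
by apply: IH y'W => u' x' u'W; apply: PW; rewrite inE u'W orbT.
Qed.

Lemma mem_sumW W u x : u \in W -> x \in gw u.1 u.2 -> x \in sumW W.
Proof.
by move=> uW xu; exact: (subvP (sumv_sup_seq (fun u => gw u.1 u.2) uW isT) _ xu).
Qed.

Lemma sumW_lie W W' l z x : x \in gw l z ->
  (forall u, u \in W -> wt (l + u.1) (z * u.2) -> (l + u.1, z * u.2) \in W') ->
  forall v : L, v \in sumW W -> lie x v \in sumW W'.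
Proof.
move=> xl HW; apply: sumW_ind => [v v' vW v'W||u v uW vu].
- by rewrite linearD memvD.
- by rewrite linear0 mem0v.
have := gen_weight_lie TP xl vu => xv.
have [->|xv0] := eqVneq (lie x v) 0; first exact: mem0v.
apply: (@mem_sumW _ (l + u.1, z * u.2)) => //; apply: HW => //.
by apply: contra xv0 => /eqP g0; rewrite -memv0 -g0.
Qed.

Lemma vtrace_sumW W (h : subvs_of A) : uniq W ->
  vtrace (sumW W) (ad (vsval h)) = \sum_(u <- W) (u.1 h : C) * (\dim (gw u.1 u.2))%:R.
Proof.
move=> uW; rewrite /sumW (vtrace_sum_weights TP uW).
  apply: eq_bigr => u _; apply: (vtrace_ad (s := s) (z := u.2)) => // x xu.
  by rewrite -adE; exact: (gen_weight_ad TP).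
by move=> u x; exact: (gen_weight_ad TP).
Qed.

(** The vector representing [l] is a bracket of vectors of weights [(l, z)] and [(- l, z^-1)], so it
    has trace zero on any sum of weight spaces that both of them preserve. *)
Lemma weight_trace l z W : wt l z -> uniq W ->
  (forall u, u \in W -> wt (l + u.1) (z * u.2) -> (l + u.1, z * u.2) \in W) ->
  (forall u, u \in W -> wt (- l + u.1) (z^-1 * u.2) -> (- l + u.1, z^-1 * u.2) \in W) ->
  \sum_(u <- W) dual_form l u.1 * (\dim (gw u.1 u.2))%:R = 0.
Proof.
move=> /wt_pair[x [y [xl x0 yl xy hx]]] uW Wp Wm.
rewrite -(vtrace_sumW (tv l) uW).
by apply: (@trace_lie _ x y) => //; apply: sumW_lie; eassumption.
Qed.

Lemma dim_gt0 l z : wt l z -> (0 : C) < (\dim (gw l z))%:R.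
Proof. by move=> wl; rewrite ltr0n lt0n dimv_eq0. Qed.

Lemma killing_dual l m : dual_form l m =
  \sum_(u <- WL) dual_form l u.1 * dual_form m u.1 * (\dim (gw u.1 u.2))%:R.
Proof.
rewrite dual_formE -dual_vecP (killing_toral TP).
by apply: eq_bigr => u _; rewrite [_ * u.1 _]mulrC.
Qed.

Lemma dual_form_nondeg l : (forall m, dual_form l m = 0) -> l = 0.
Proof.
move=> l0; apply/lfunP => h; rewrite zero_lfunE -dual_vecP killingC.
have := l0 (killing_flat A h).
rewrite dual_formC dual_formE /dual_vec (lker0_lfunK killing_flat_inj) => lh.
by rewrite killingC dual_vecP.
Qed.

(** If (l, l) = 0, then [l] has the same product with every weight of the string m + i l, and the
    vanishing trace there gives (l, m) = 0. Since this holds for all weights [m], [killing_dual]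
    yields l = 0. *)
Lemma weight_dual_neq0 l z : wt l z -> l != 0 -> dual_form l l != 0.
Proof.
move=> wl l0; apply: contra l0 => /eqP ll.
have z0 := wt_unit wl.
suff H m w : wt m w -> dual_form l m = 0.
  apply/eqP/dual_form_nondeg => m; rewrite killing_dual big1_seq // => u.
  rewrite andTb (surjective_pairing u) mem_WL /= => /H ->; by rewrite !mul0r.
move=> wm; pose Q u := `[< exists i : int, u = (m + l *~ i, w * z ^ i) >].
have QE (i : int) : Q (m + l *~ i, w * z ^ i) by apply/asboolP; exists i.
have := @weight_trace l z [seq u <- WL | Q u] wl (filter_uniq _ (weight_list_uniq TP)).
have shift (e : int) u : u \in [seq u <- WL | Q u] -> wt (l *~ e + u.1) (z ^ e * u.2) ->
    (l *~ e + u.1, z ^ e * u.2) \in [seq u <- WL | Q u].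
  rewrite !mem_filter mem_WL => /andP[/asboolP[i ->] _] /= ->; rewrite andbT.
  by rewrite addrCA -mulrzDr mulrCA -expfzDr.
have sh1 u := @shift 1 u; have shm u := @shift (-1) u.
move=> /(_ sh1)/(_ shm) T.
have E : \sum_(u <- [seq u <- WL | Q u]) dual_form l u.1 * (\dim (gw u.1 u.2))%:R =
   dual_form l m * \sum_(u <- [seq u <- WL | Q u]) (\dim (gw u.1 u.2))%:R.
  rewrite mulr_sumr; apply: eq_big_seq => u; rewrite mem_filter => /andP[/asboolP[i ->] _] /=.
  by rewrite dual_formDr -scaler_int dual_formZr ll mulr0 addr0.
move/eqP: T; rewrite E mulf_eq0 => /orP[/eqP //|].
have mwW : (m, w) \in [seq u <- WL | Q u].
  by rewrite mem_filter mem_WL wm andbT; have := QE 0; rewrite mulr0z addr0 expr0z mulr1.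
rewrite (big_rem _ mwW) /= gt_eqF // ltr_wpDr ?dim_gt0 // sumr_ge0 //.
Qed.

Lemma mulr2n_dual_neq0 l n : l != 0 -> l *+ n.+1 != 0.
Proof.
by move=> l0; rewrite -scaler_nat scaler_eq0 negb_or pnatr_eq0.
Qed.

(* The trace of t_l on C x + A + sum_(i >= 1) L_(-il) is l(t_l) (1 - sum_i i dim L_(-il)). *)
Lemma weight_dims l z : wt l z -> l != 0 ->
  forall n, (n.+1 * \dim (gw (- (l *+ n.+1)) (z ^- n.+1)) <= 1)%N.
Proof.
move=> wl l0; have z0 := wt_unit wl; have ll := weight_dual_neq0 wl l0.
have [x [y [xl x0 yl xy hx]]] := wt_pair wl.
pose Q u := `[< exists i : nat, u = (- (l *+ i.+1), z ^- i.+1) >].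
pose W := [seq u <- WL | Q u].
have WP i : wt (- (l *+ i.+1)) (z ^- i.+1) -> (- (l *+ i.+1), z ^- i.+1) \in W.
  by move=> wi; rewrite mem_filter mem_WL wi andbT; apply/asboolP; exists i.
pose W0 := (0 : dual_space A, 1 : C) :: W.
have z01 : (0 : dual_space A, 1 : C) \notin W.
  apply/negP; rewrite mem_filter => /andP[/asboolP[i [/esym/eqP + _]] _].
  by rewrite oppr_eq0 (negPf (mulr2n_dual_neq0 i l0)).
have uW : uniq W by rewrite filter_uniq // (weight_list_uniq TP).
have uW0 : uniq W0 by rewrite /= z01.
have lW0 : (l, z) \notin W0.
  rewrite inE negb_or xpair_eqE negb_and l0 /= mem_filter negb_and; apply/orP; left.
  apply/negP => /asboolP[i [/eqP + _]].
  by rewrite -subr_eq0 opprK -mulrS (negPf (mulr2n_dual_neq0 i.+1 l0)).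
have cap : (<[x]> :&: sumW W0 = 0)%VS.
  apply/eqP; rewrite -subv0 -(gen_weight_cap TP lW0).
  by rewrite capvS // -memvE.
have AW (v : L) : v \in A -> v \in sumW W0.
  by move=> vA; apply: (@mem_sumW _ (0, 1)); [exact: mem_head|exact/(sp_zero SP)].
have tx (h : subvs_of A) (v : L) : v \in <[x]>%VS -> lie (vsval h) v \in <[x]>%VS.
  by move=> /vlineP[k ->]; rewrite linearZ /= hx memvZ // memvZ // memv_line.
have tW (h : subvs_of A) (v : L) : v \in sumW W0 -> lie (vsval h) v \in sumW W0.
  move: v; apply: sumW_ind => [v v' vW v'W||u v uW' vu].
  - by rewrite linearD memvD.
  - by rewrite linear0 mem0v.
  by apply: (mem_sumW uW'); rewrite -adE; exact: (gen_weight_ad TP).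
have step (i : nat) : - l + - (l *+ i.+1) = - (l *+ i.+2) by rewrite -opprD -mulrS.
have stepz (i : nat) : z^-1 * z ^- i.+1 = z ^- i.+2 by rewrite -invfM -exprS.
have xM (v : L) : v \in (<[x]> + sumW W0)%VS -> lie x v \in (<[x]> + sumW W0)%VS.
  move=> /memv_addP[_ /vlineP[k ->] [v' v'W ->]].
  rewrite linearD linearZ /= liexx scaler0 add0r; move: v' v'W.
  apply: sumW_ind => [v1 v2 v1W v2W||u v1 uW0' v1u].
  - by rewrite linearD memvD.
  - by rewrite linear0 mem0v.
  move: uW0' v1u; rewrite inE => /orP[/eqP -> /= /(sp_zero SP) v1A|].
    rewrite lieC -[v1](vsprojK v1A) hx -scaleNr; apply: (subvP (addvSl _ _)).
    by rewrite memvZ // memv_line.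
  rewrite mem_filter => /andP[/asboolP[i ->] _] /= v1i; apply: (subvP (addvSr _ _)).
  have := gen_weight_lie TP xl v1i.
  have [->|nz] := eqVneq (lie x v1) 0; first by rewrite !mem0v.
  case: i v1i => [|i] _.
    by rewrite mulr1n subrr expr1 divff // => /(sp_zero SP)/AW.
  have -> : l - l *+ i.+2 = - (l *+ i.+1) by rewrite -step addrA subrr add0r.
  have -> : z * z ^- i.+2 = z ^- i.+1 by rewrite -stepz mulrA divff // mul1r.
  move=> mem; apply: (@mem_sumW _ (- (l *+ i.+1), z ^- i.+1)) => //.
  rewrite inE WP ?orbT //; apply: contra nz => /eqP g0.
  by rewrite -memv0 -g0.
have yM (v : L) : v \in (<[x]> + sumW W0)%VS -> lie y v \in (<[x]> + sumW W0)%VS.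
  move=> /memv_addP[_ /vlineP[k ->] [v' v'W ->]].
  rewrite linearD linearZ /= lieC xy; apply: memvD.
    by apply: (subvP (addvSr _ _)); rewrite memvZ // memvN AW // subvsP.
  apply: (subvP (addvSr _ _)); apply: (sumW_lie yl) v'W => u.
  rewrite inE => /orP[/eqP -> /=|].
    rewrite addr0 mulr1 inE => wy; apply/orP; right.
    by have := WP 0%N; rewrite mulr1n expr1; exact.
  rewrite mem_filter => /andP[/asboolP[i ->] _] /=; rewrite step stepz => wi.
  by rewrite inE WP ?orbT.
have := trace_lie xM yM xy; rewrite vtrace_direct //; last 2 first.
- by move=> v; rewrite adE; exact: tx.
- by move=> v; rewrite adE; exact: tW.
rewrite vtrace_sumW // (vtrace_ad (s := s) (l := l) (z := z)) -?memvE //; last exact: tx.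
rewrite dim_vline x0 mulr1 big_cons zero_lfunE mul0r add0r => T.
(* Dividing the trace identity by (l, l) turns the weight - (i+1) l into the positive integer i+1.
   The terms then sum to 1, so none exceeds it. *)
pose k u : C := - (u.1 (tv l) : C) / dual_form l l.
have kE i : k (- (l *+ i.+1), z ^- i.+1) = i.+1%:R.
  rewrite /k /= -scaler_nat opp_lfunE opprK scale_lfunE.
  by rewrite -[_ *: _]/(i.+1%:R * dual_form l l) mulfK.
have T' : \sum_(u <- W) k u * (\dim (gw u.1 u.2))%:R = 1.
  transitivity (- (\sum_(u <- W) (u.1 (tv l) : C) * (\dim (gw u.1 u.2))%:R) / dual_form l l).
    rewrite -sumrN mulr_suml; apply: eq_bigr => u _.
    by rewrite /k; ring.
  by move/eqP: T; rewrite addr_eq0 => /eqP <-; rewrite -dual_formE divff.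
move=> n; have [g0|wn] := eqVneq (gw (- (l *+ n.+1)) (z ^- n.+1)) 0%VS.
  by rewrite g0 dimv0 muln0.
rewrite -(ler_nat C) natrM -kE -[leRHS]/(1 : C) -[leRHS]T' (big_rem _ (WP n wn)) /= lerDl.
rewrite big_seq; apply: sumr_ge0 => u /mem_rem.
rewrite mem_filter => /andP[/asboolP[i ->] _].
by rewrite kE mulr_ge0 ?ler0n.
Qed.

Lemma wt_dim1 l z : wt l z -> l != 0 -> \dim (gw l z) = 1%N.
Proof.
move=> wl l0; have := weight_dims (wt_neg wl) _ 0%N.
rewrite oppr_eq0 l0 mulr1n opprK expr1 invrK mul1n => /(_ isT) d.
by apply/eqP; rewrite eqn_leq d lt0n dimv_eq0.
Qed.

Lemma wt_double l z : wt l z -> l != 0 -> ~~ wt (l *+ 2) (z ^+ 2).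
Proof.
move=> wl l0; have := weight_dims (wt_neg wl) _ 1%N.
rewrite oppr_eq0 l0 mulNrn opprK exprVn invrK => /(_ isT).
rewrite /wt; case: eqVneq => //; rewrite -dimv_eq0.
by case: (\dim _) => // k _; rewrite mul2n doubleS.
Qed.

Lemma wt_line l z x : wt l z -> l != 0 -> x \in gw l z -> x != 0 -> gw l z = <[x]>%VS.
Proof.
move=> wl l0 xl x0; apply/eqP; rewrite eq_sym eqEdim -memvE xl.
by rewrite dim_vline x0 (wt_dim1 wl).
Qed.

Lemma wt_eigen l z x (h : subvs_of A) : l != 0 -> x \in gw l z ->
  lie (vsval h) x = l h *: x.
Proof.
move=> l0 xl; have [wl|] := boolP (wt l z); last first.
  by rewrite negbK => /eqP g0; move: xl; rewrite g0 memv0 => /eqP ->; rewrite linear0 scaler0.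
have [v [_ [vl v0 _ _ hv]]] := wt_pair wl.
move: xl; rewrite (wt_line wl l0 vl v0) => /vlineP[k ->].
by rewrite linearZ /= hv scalerA mulrC -scalerA.
Qed.

Lemma string_end l z m w : wt m w -> wt l z -> l != 0 -> exists c : nat,
  (forall i, (i <= c)%N -> wt (m + l *+ i) (w * z ^+ i)) /\
  ~~ wt (m + l *+ c.+1) (w * z ^+ c.+1).
Proof.
move=> wm wl l0.
have [n wn] : exists n, ~~ wt (m + l *+ n.+1) (w * z ^+ n.+1).
  apply: contrapT => H; have H' n : wt (m + l *+ n.+1) (w * z ^+ n.+1).
    by apply: contrapT => /negP wn; apply: H; exists n.
  pose f i := (m + l *+ i.+1, w * z ^+ i.+1).
  have fi : injective f.
    move=> i j [/addrI/eqP + _]; rewrite -!scaler_nat -subr_eq0 -scalerBl scaler_eq0.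
    by rewrite (negPf l0) orbF subr_eq0 eqr_nat eqSS => /eqP.
  have := @uniq_leq_size _ (map f (iota 0 (size WL).+1)) WL.
  rewrite map_inj_uniq ?iota_uniq // => /(_ isT).
  rewrite size_map size_iota ltnn => H1; apply/notF/H1 => u /mapP[i _ ->].
  by rewrite mem_WL H'.
have ex : exists n, ~~ wt (m + l *+ n.+1) (w * z ^+ n.+1) by exists n.
case: (ex_minnP ex) => c wc cmin; exists c; split=> // -[_|i ic].
  by rewrite mulr0n addr0 expr0 mulr1.
by apply: contraT => /cmin; rewrite leqNgt ic.
Qed.

(* The trace of t_l on the maximal string of weights through m in the direction l vanishes. *)
Lemma root_string l z m w : wt l z -> l != 0 -> wt m w ->
  exists n : int, 2 * dual_form l m = n%:~R * dual_form l l /\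
    wt (m - l *~ n) (w * z ^ (- n)).
Proof.
move=> wl l0 wm; have z0 := wt_unit wl.
have [b [bP bN]] := string_end wm wl l0.
have [|a [aP aN]] := string_end wm (wt_neg wl); first by rewrite oppr_eq0.
have wti (i : int) : - (a%:Z) <= i <= b%:Z -> wt (m + l *~ i) (w * z ^ i).
  case: i => i /andP[ai ib]; first exact: bP.
  have := aP i.+1 _; rewrite mulNrn exprVn; apply.
  by move: ai; rewrite NegzE lerN2.
have bN' : ~~ wt (m + l *~ b.+1%:Z) (w * z ^ b.+1%:Z) by [].
have aN' : ~~ wt (m + l *~ - a.+1%:Z) (w * z ^ (- a.+1%:Z)).
  by rewrite mulrNz -exprz_inv; move: aN; rewrite mulNrn.
pose c := (a + b)%N; pose g (j : nat) : int := j%:Z - a%:Z.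
pose f j := (m + l *~ g j, w * z ^ g j).
have gP j : (j <= c)%N -> - (a%:Z) <= g j <= b%:Z.
  by move=> jc; rewrite /g lerBlDr -PoszD [(b + a)%N]addnC lez_nat jc andbT lerBrDr addNr.
have fi : injective f.
  move=> i j [/addrI/eqP + _]; rewrite -subr_eq0 -mulrzBr -scaler_int scaler_eq0.
  rewrite (negPf l0) orbF intr_eq0 /g opprB addrA subrK subr_eq0.
  by move=> /eqP[].
have [r rE] : exists r, r = iota 0 c.+1 by exists (iota 0 c.+1).
have mr j : (j \in r) = (j <= c)%N by rewrite rE mem_iota add0n ltnS.
have ur : uniq r by rewrite rE iota_uniq.
have := @weight_trace l z [seq f j | j <- r] wl.
rewrite (map_inj_uniq fi) => /(_ ur) T.
have {}T : \sum_(j < c.+1) dual_form l (m + l *~ g j) = 0.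
  rewrite -[RHS]T.
  - rewrite big_map rE -[iota 0 _]/(index_iota 0 c.+1) big_mkord; apply: eq_bigr => j _ /=.
    have [->|mj] := eqVneq (m + l *~ g j) 0; first by rewrite dual_form0r mul0r.
    by rewrite wt_dim1 ?mulr1 // wti // gP // -ltnS.
  - move=> u /mapP[j]; rewrite mr => jc -> /=.
    rewrite addrCA -[X in _ + (X + _)](mulr1z l) -mulrzDr mulrCA -[X in _ * (X * _)](expr1z z) -expfzDr //.
    have -> : 1 + g j = g j.+1 by rewrite /g addrA -PoszD.
    have [jc'|] := leqP j.+1 c; first by move=> _; apply: (map_f f); rewrite mr.
    rewrite ltnS => cj; have -> : g j.+1 = b.+1%:Z.
      have -> : j = c by apply/eqP; rewrite eqn_leq jc.
      by rewrite /g /c -addnS PoszD addrAC subrr add0r.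
    by rewrite (negPf bN').
  - move=> u /mapP[j]; rewrite mr => jc -> /=.
    rewrite addrCA -[X in _ + (X + _)](mulrN1z l) -mulrzDr mulrCA -[X in _ * (X * _)](exprN1 z) -expfzDr //.
    case: j jc => [|j] jc.
      have -> : -1 + g 0 = - a.+1%:Z by rewrite /g sub0r -opprD -PoszD.
      by rewrite (negPf aN').
    have -> : -1 + g j.+1 = g j by rewrite /g -[j.+1]add1n PoszD !addrA addNr add0r.
    by move=> _; apply: (map_f f); rewrite mr ltnW.
have sumE n (p q : C) : 2 * (\sum_(j < n) (p + j%:R * q)) = n%:R * (2 * p + (n%:R - 1) * q).
  elim: n => [|n IH]; first by rewrite big_ord0 mul0r mulr0.
  by rewrite big_ord_recr mulrDr IH /= -natr1; ring.
have := sumE c.+1 (dual_form l m - a%:R * dual_form l l) (dual_form l l).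
have -> : \sum_(j < c.+1) (dual_form l m - a%:R * dual_form l l + j%:R * dual_form l l) = 0.
  rewrite -[RHS]T; apply: eq_bigr => j _.
  rewrite dual_formDr -scaler_int dual_formZr /g intrB.
  by ring.
rewrite mulr0 => /esym/eqP; rewrite mulf_eq0 pnatr_eq0 /= => /eqP E.
(* The arithmetic progression gives 2 (l, m) = (a - b) (l, l), and b - a lies between - a and b, so
   the reflected weight is on the string. *)
exists (a%:Z - b%:Z); split.
  apply/eqP; rewrite -subr_eq0 -[X in _ == X]E; apply/eqP.
  by rewrite /c -addn1 !natrD intrB; ring.
rewrite -mulrNz opprB; apply: wti.
by rewrite lerBrDr addNr lez_nat /= lerBlDr lerDl.
Qed.

End Roots.

(** * Reflections and extremal roots *)

Section Positivity.
Context (C : numClosedFieldType) (L : finLieAlgType C).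
Context (s : 'End(L)) (t : nat) (A : {vspace L}) (SP : split_pair s t A).
Implicit Types (x y : L) (l m a b : dual_space A) (z w : C) (U V : {vspace L}).
Implicit Types (u : (dual_space A * C)%type) (W : seq (dual_space A * C)).
Local Notation gw := (gen_weight s).
Local Notation TP := (sp_toral SP).
Local Notation WL := (weight_list TP).
Local Notation wt := (is_weight s).
Local Notation "''(' l , m )" := (dual_form l m) (format "''(' l ,  m )").

Lemma weight_norm_sum l z : wt l z -> l != 0 ->
  \sum_(u <- WL) (2 * '(l, u.1) / '(l, l)) ^+ 2 * (\dim (gw u.1 u.2))%:R = 4 / '(l, l).
Proof.
move=> wl l0; have c0 := weight_dual_neq0 SP wl l0.
have -> : 4 / '(l, l) = (2 / '(l, l)) ^+ 2 * '(l, l).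
  by rewrite expr2; field.
rewrite [X in _ = _ * X](killing_dual SP) mulr_sumr; apply: eq_bigr => u _.
by rewrite !expr2; field.
Qed.

Lemma wt_int l z m w : wt l z -> l != 0 -> wt m w -> exists n : int, 2 * '(l, m) / '(l, l) = n%:~R.
Proof.
move=> wl l0 wm; have [n [nE _]] := root_string SP wl l0 wm; exists n.
by rewrite nE mulfK // (weight_dual_neq0 SP wl).
Qed.

Lemma weight_norm_gt0 l z : wt l z -> l != 0 -> 0 < '(l, l).
Proof.
move=> wl l0; rewrite -invr_gt0 -(pmulr_rgt0 _ (_ : 0 < 4)) ?ltr0n //.
rewrite lt0r mulf_neq0 ?invr_neq0 ?(weight_dual_neq0 SP wl) ?pnatr_eq0 //=.
rewrite -(weight_norm_sum wl l0) big_seq sumr_ge0 // => u uW.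
apply: mulr_ge0; last exact: ler0n.
have wu : wt u.1 u.2 by rewrite -(mem_WL SP) -surjective_pairing.
have [n ->] := wt_int wl l0 wu.
by rewrite -rmorphXn /= ler0z sqr_ge0.
Qed.

Lemma wt_real l z m w : wt l z -> wt m w -> '(l, m) \is Num.real.
Proof.
move=> wl wm; have [->|l0] := eqVneq l 0; first by rewrite (dual_form0l SP) real0.
have [n [nE _]] := root_string SP wl l0 wm.
have -> : '(l, m) = n%:~R * '(l, l) / 2 by rewrite -nE; field.
by apply: realM; [apply: realM; [exact: realz|exact: gtr0_real (weight_norm_gt0 wl l0)]|rewrite realV realn].
Qed.

(** When all products with weights are real, [killing_dual] writes (v, v) as a sum of squares with
    positive multiplicities. *)
Lemma form_ge0 (v : dual_space A) : (forall m w, wt m w -> '(v, m) \is Num.real) ->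
  0 <= '(v, v) ?= iff (v == 0).
Proof.
move=> vR; have T u : u \in WL -> 0 <= '(v, u.1) * '(v, u.1) * (\dim (gw u.1 u.2))%:R.
  move=> uW; apply: mulr_ge0; last exact: ler0n.
  rewrite -expr2 real_exprn_even_ge0 //; apply: (vR _ u.2).
  by rewrite -(mem_WL SP) -surjective_pairing.
split; first by rewrite (killing_dual SP) big_seq sumr_ge0.
rewrite eq_sym; apply/eqP/eqP => [v0|->]; last exact: (dual_form0l SP).
apply: (dual_form_nondeg SP) => m; rewrite (killing_dual SP) big1_seq // => u /= uW.
move: v0; rewrite (killing_dual SP) (big_rem _ uW) /= => /eqP.
rewrite paddr_eq0 ?T //; last first.
  by rewrite big_seq sumr_ge0 // => u' /mem_rem; exact: T.
move=> /andP[+ _]; rewrite mulf_eq0 pnatr_eq0 dimv_eq0.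
move: uW; rewrite (surjective_pairing u) mem_WL /wt => /negPf ->.
by rewrite orbF mulf_eq0 orbb => /eqP ->; rewrite !mul0r.
Qed.

(** Strict positivity on differences of weights takes the place of the Cauchy-Schwarz inequality in
    the comparisons of lengths. *)
Lemma norm_sub_gt0 l z m w : wt l z -> wt m w -> l != m -> 0 < '(l - m, l - m).
Proof.
move=> wl wm lm; have [|ge0 eq0] := @form_ge0 (l - m).
  move=> m' w' wm'; rewrite (dual_formDl SP) (dual_formNl SP).
  by rewrite realB // ?(wt_real wl wm') ?(wt_real wm wm').
by rewrite lt_neqAle ge0 eq0 subr_eq0 lm.
Qed.

Definition root_refl a m : dual_space A := m - (2 * '(a, m) / '(a, a)) *: a.

Lemma root_reflE a m m' : '(a, a) != 0 -> '(root_refl a m, m') = '(m, root_refl a m').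
Proof.
move=> a0; rewrite /root_refl !(dual_formDl SP, dual_formDr, dual_formNl SP, dual_formNr).
rewrite (dual_formZl SP) dual_formZr (dual_formC SP m a).
by congr (_ - _); ring.
Qed.

Lemma root_reflK a : '(a, a) != 0 -> involutive (root_refl a).
Proof.
move=> a0 m; rewrite /root_refl dual_formDr dual_formNr dual_formZr.
rewrite -addrA -opprD -scalerDl [X in X *: _](_ : _ = 0) ?scale0r ?subr0 //.
by field.
Qed.

Lemma root_refl_iso a m m' : '(a, a) != 0 -> '(root_refl a m, root_refl a m') = '(m, m').
Proof. by move=> a0; rewrite root_reflE // root_reflK. Qed.

Lemma wt_refl a m w : wt a 1 -> a != 0 -> wt m w -> wt (root_refl a m) w.
Proof.
move=> wa a0 wm; have [n [nE]] := root_string SP wa a0 wm.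
rewrite exp1rz mulr1 /root_refl nE.
by rewrite (mulfK (weight_dual_neq0 SP wa a0)) scaler_int.
Qed.

Lemma root_refl_neq0 a m : '(a, a) != 0 -> m != 0 -> root_refl a m != 0.
Proof.
move=> a0; apply: contra => /eqP r0; rewrite -(root_reflK a0 m) r0.
by rewrite /root_refl dual_form0r mulr0 mul0r scale0r subr0.
Qed.

(* 2 (a, m) / (a, a) <= -2 only for m = -a: this holds for the roots whose root vector e
   satisfies [e, [e, L]] = C e. *)
Definition extremal_root a := forall m w, wt m w -> 2 * '(a, m) <= - (2 * '(a, a)) ->
  m = - a /\ w = 1.

Lemma extremal_root_refl a b : wt b 1 -> b != 0 -> '(a, a) != 0 ->
  extremal_root a -> extremal_root (root_refl b a).
Proof.
move=> wb b0 a0 Ea m w wm; have bb := weight_dual_neq0 SP wb b0.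
rewrite root_refl_iso // root_reflE // => /(Ea _ _ (wt_refl wb b0 wm))[E ->]; split=> //.
rewrite -[m](root_reflK bb) E /root_refl dual_formNr mulrN mulNr scaleNr.
by rewrite opprD.
Qed.

(** If [e, [e, v]] is nonzero for some [v] of weight [m], its weight 2 a + m must be [a]. Otherwise
    [e] and its dual vector preserve a sum of pieces on which the vector representing [a] has
    negative trace, although it is their bracket. *)
Lemma extremal_vector a e : wt a 1 -> a != 0 -> e \in gw a 1 -> e != 0 ->
  (forall y, lie e (lie e y) \in <[e]>%VS) -> extremal_root a.
Proof.
move=> wa a0 ea e0 ext m w wm le2.
have aa := weight_norm_gt0 wa a0.
have am : '(a, m) <= - '(a, a) by rewrite -(ler_pM2l (_ : 0 < 2)) ?ltr0n // mulrN.
have am0 : '(a, m) < 0 by apply: le_lt_trans am _; rewrite oppr_lt0.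
have [v [vm nz]] : exists v : L, v \in gw m w /\ lie e (lie e v) != 0; last first.
  have := gen_weight_lie TP ea (gen_weight_lie TP ea vm); rewrite !mul1r => H.
  have H' : lie e (lie e v) \in gw a 1.
    by apply: (subvP _ _ (ext v)); rewrite -memvE.
  have [E ->] := gen_weight_unique TP H' H nz; split=> //.
  move/eqP: E; rewrite -{1}[a]addr0 (inj_eq (addrI a)) eq_sym addrC addr_eq0.
  by move/eqP.
apply: contrapT => noV.
have kill v : v \in gw m w -> lie e (lie e v) = 0.
  by move=> vm; apply/eqP/negPn/negP => nz; apply: noV; exists v.
have [y ya ky] := weight_pairing SP ea e0.
have he h := wt_eigen SP h a0 ea.
have ey : lie e y = vsval (dual_vec a).
  by rewrite (weight_lie_opp SP (oner_neq0 C) ea ya he) ky scale1r.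
rewrite invr1 in ya.
pose Q u := `[< exists i : nat, u = (m - a *+ i, w) >].
pose W := [seq u <- WL | Q u].
have WP i : wt (m - a *+ i) w -> (m - a *+ i, w) \in W.
  by move=> wi; rewrite mem_filter (mem_WL SP) wi andbT; apply/asboolP; exists i.
have mW : (m, w) \in W by have := WP 0%N; rewrite subr0; exact.
have uW : uniq W by rewrite filter_uniq // weight_list_uniq.
have WE u : u \in W -> exists i : nat, u = (m - a *+ i, w).
  by rewrite mem_filter => /andP[/asboolP].
(* The subspace [e, L_m] + L_m + L_(m-a) + ... is stable under [y]; it is stable under [e] because
   the square of [ad e] kills L_m. *)
pose I := (ad e @: gw m w)%VS.
have Iam : (I <= gw (a + m)%R w)%VS.
  apply/subvP => _ /memv_imgP[v vm ->]; rewrite adE.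
  by have := gen_weight_lie TP ea vm; rewrite mul1r.
have cap : (I :&: sumW s W = 0)%VS.
  have nW : (a + m, w) \notin W.
    apply/negP => /WE[i [/eqP]]; rewrite addrC (inj_eq (addrI m)) -subr_eq0 opprK -mulrS.
    by rewrite (negPf (mulr2n_dual_neq0 i a0)).
  apply/eqP; rewrite -subv0 -(gen_weight_cap TP nW).
  exact: capvS.
have sW : (sumW s W <= I + sumW s W)%VS by exact: addvSr.
have eM v : v \in (I + sumW s W)%VS -> lie e v \in (I + sumW s W)%VS.
  move=> /memv_addP[_ /memv_imgP[v1 v1m ->] [v2 v2W ->]].
  rewrite linearD adE /= kill // add0r; move: v2 v2W; apply: sumW_ind.
  - by move=> v2 v2' H H'; rewrite linearD memvD.
  - by rewrite linear0 mem0v.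
  move=> u v2 /WE[[|i] ->] /= v2u.
    by rewrite -adE (subvP (addvSl _ _)) // memv_img //; move: v2u; rewrite subr0.
  have := gen_weight_lie TP ea v2u; rewrite mul1r mulrS opprD addrCA [a + (_ + _)]addrA subrr add0r.
  have [->|nz] := eqVneq (lie e v2) 0; first by rewrite !mem0v.
  move=> H; apply: (subvP sW); have wi : wt (m - a *+ i) w.
    by apply: contra nz => /eqP g0; rewrite -memv0 -g0.
  exact: (mem_sumW (WP i wi) H).
have yW v : v \in sumW s W -> lie y v \in sumW s W.
  move=> vW; apply: (sumW_lie SP ya _ vW) => u /WE[i ->] /=; rewrite mul1r.
  by rewrite addrCA -opprD -mulrS; exact: WP.
have yM v : v \in (I + sumW s W)%VS -> lie y v \in (I + sumW s W)%VS.
  move=> /memv_addP[_ /memv_imgP[v1 v1m ->] [v2 v2W ->]].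
  rewrite linearD adE /=; apply: memvD; last by apply: (subvP sW); exact: yW.
  apply: (subvP sW).
  rewrite lie_leibniz (lieC y e) ey lieNl addrC.
  apply: (mem_sumW mW) => /=; apply: memvB.
    have := gen_weight_lie TP ea (gen_weight_lie TP ya v1m).
    by rewrite !mul1r addrA subrr add0r.
  by rewrite -adE; exact: (gen_weight_ad TP).
have := trace_lie eM yM ey; rewrite vtrace_direct //; last 2 first.
- move=> _ /memv_imgP[v1 v1m ->]; rewrite !adE lie_leibniz he lieZl -linearZ -linearD /= -adE.
  by rewrite memv_img // memvD ?memvZ // -adE; exact: (gen_weight_ad TP).
- apply: sumW_ind => [v v' vW v'W||u v uW' vu].
  + by rewrite linearD memvD.
  + by rewrite linear0 mem0v.
  by apply: (mem_sumW uW'); exact: (gen_weight_ad TP).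
rewrite (vtrace_sumW SP) // (vtrace_ad (s := s) (l := a + m) (z := w)) //; last first.
  move=> _ /memv_imgP[v1 v1m ->]; rewrite adE lie_leibniz he lieZl -linearZ -linearD /= -adE.
  by rewrite memv_img // memvD ?memvZ // -adE; exact: (gen_weight_ad TP).
(* L_m contributes a negative number, since (a, m) < 0; all other pieces, including [I] with (a, a +
   m) <= 0, contribute at most zero. *)
rewrite -dual_formE (big_rem _ mW) /= => /eqP; apply/negP; rewrite lt_eqF //.
rewrite -dual_formE addrCA -[ltRHS]addr0 ltr_leD //.
  by rewrite pmulr_llt0 ?(dim_gt0 wm).
rewrite -[leRHS]addr0 lerD // -oppr_ge0.
  rewrite -mulNr mulr_ge0 ?ler0n // oppr_ge0 dual_formDr.
  by rewrite addrC -lerBrDr sub0r.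
rewrite big_seq -sumrN sumr_ge0 // => u /mem_rem/WE[i ->] /=.
rewrite -dual_formE -mulNr mulr_ge0 ?ler0n // oppr_ge0 dual_formDr dual_formNr -scaler_nat dual_formZr.
by rewrite -oppr_ge0 opprB subr_ge0 (le_trans (ltW am0)) // mulr_ge0 ?ler0n // ltW.
Qed.

End Positivity.

(** * Extremal elements and their components of maximal norm *)

Section Degeneration.
Context (C : numClosedFieldType) (L : finLieAlgType C).
Context (s : 'End(L)) (t : nat) (A : {vspace L}) (SP : split_pair s t A).
Implicit Types (x y : L) (l m a : dual_space A) (z w : C) (U V : {vspace L}).
Implicit Types (u v : (dual_space A * C)%type) (W : seq (dual_space A * C)).
Local Notation gw := (gen_weight s).
Local Notation TP := (sp_toral SP).
Local Notation WL := (weight_list TP).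
Local Notation wt := (is_weight s).
Local Notation "''(' l , m )" := (dual_form l m) (format "''(' l ,  m )").

Lemma seq_max (T : eqType) (f : T -> C) (r : seq T) (i0 : T) : i0 \in r ->
  (forall i, i \in r -> f i \is Num.real) ->
  exists2 i, i \in r & forall j, j \in r -> f j <= f i.
Proof.
elim: r i0 => // i r IH i0 _ fR.
have fiR : f i \is Num.real by apply: fR; exact: mem_head.
case: r IH fR => [_ _|i1 r IH fR].
  by exists i; rewrite ?mem_head // => j; rewrite inE => /eqP ->.
have [||j jr jmax] := IH i1; first exact: mem_head.
  by move=> j jr; apply: fR; rewrite inE jr orbT.
have fjR : f j \is Num.real by apply: fR; rewrite inE jr orbT.
case/orP: (real_leVge fiR fjR) => [ij|ji].
  exists j; first by rewrite inE jr orbT.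
  by move=> k; rewrite inE => /orP[/eqP ->|/jmax].
exists i; first exact: mem_head.
by move=> k; rewrite inE => /orP[/eqP -> //|/jmax kj]; exact: le_trans ji.
Qed.

Lemma lie_suml (I : Type) (r : seq I) (F : I -> L) y :
  lie (\sum_(i <- r) F i) y = \sum_(i <- r) lie (F i) y.
Proof.
have ll : linear (fun x : L => lie x y) by move=> k v v'; exact: lieDZl.
exact: (linear_fun_sum _ _ ll).
Qed.

Lemma lie_sumr (I : Type) (r : seq I) (F : I -> L) y :
  lie y (\sum_(i <- r) F i) = \sum_(i <- r) lie y (F i).
Proof. exact: linear_sum. Qed.

Lemma killing_sumr (I : Type) (r : seq I) (F : I -> L) y :
  killing y (\sum_(i <- r) F i) = \sum_(i <- r) killing y (F i).
Proof. exact: (linear_fun_sum _ _ (killing_linear y)). Qed.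

(** Strict convexity of the norm, by the parallelogram law. *)
Lemma norm_convex l m z1 z2 a : wt l z1 -> wt m z2 -> '(l, l) <= '(a, a) ->
  '(m, m) <= '(a, a) -> l + m = a *+ 2 -> l = a /\ m = a.
Proof.
move=> wl wm la ma lm.
have lmE : l = m.
  apply: contrapT => /eqP ne; have := norm_sub_gt0 SP wl wm ne.
  have -> : '(l - m, l - m) = 2 * '(l, l) + 2 * '(m, m) - '(l + m, l + m).
    rewrite !(dual_formDl SP, dual_formNl SP, dual_formDr, dual_formNr).
    by rewrite (dual_formC SP m l); ring.
  rewrite lm -scaler_nat (dual_formZl SP) dual_formZr => h.
  have : 2 * '(l, l) + 2 * '(m, m) <= 2 * (2 * '(a, a)).
    rewrite [leRHS](_ : _ = 2 * '(a, a) + 2 * '(a, a)); last by ring.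
    by rewrite lerD // ler_pM2l ?ltr0n.
  by rewrite -subr_le0 => /(lt_le_trans h); rewrite ltxx.
move: lm; rewrite lmE -mulr2n -!scaler_nat => /(scalerI _) ->; first by [].
by rewrite pnatr_eq0.
Qed.

Lemma weight_comp_aut u x : s x = x -> weight_comp TP u x != 0 -> u.2 = 1.
Proof.
move=> sx X0.
have : weight_comp TP u (s x) = u.2 *: weight_comp TP u x.
  rewrite {1}(weight_comp_sum TP x) [s _]linear_sum [weight_comp _ _ _]linear_sum.
  have E v : weight_comp TP u (s (weight_comp TP v x)) =
      if v == u then u.2 *: weight_comp TP u x else 0.
    rewrite (gen_weight_aut TP (weight_comp_mem TP v x)) linearZ /=.
    have [->|vu] := eqVneq v u; first by rewrite weight_comp_id // weight_comp_mem.
    by rewrite (weight_comp_ne TP (weight_comp_mem TP v x) vu) scaler0.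
  rewrite (eq_bigr _ (fun v _ => E v)).
  have uW : u \in WL.
    rewrite mem_weight_list; apply: contra X0 => /eqP g0.
    by have := weight_comp_mem TP u x; rewrite g0 memv0.
  rewrite (bigD1_seq u) ?weight_list_uniq //= eqxx big1 ?addr0 // => v /negPf.
  by move=> ->.
rewrite sx => /esym/eqP; rewrite -subr_eq0 -{2}[weight_comp _ _ _]scale1r -scalerBl.
by rewrite scaler_eq0 (negPf X0) orbF subr_eq0 => /eqP.
Qed.

(* The component of maximal norm of an extremal element is extremal: this replaces the conjugacy
   of Cartan subalgebras. *)
Lemma extremal_degeneration x c : s x = x -> x != 0 ->
  (forall y, lie x (lie x y) = (c * killing x y) *: x) ->
  exists l e, [/\ wt l 1, l != 0, e \in gw l 1, e != 0 &
    forall y, lie e (lie e y) = (c * killing e y) *: e].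
Proof.
move=> sx x0 ext; pose X u := weight_comp TP u x.
have XE : x = \sum_(u <- WL) X u by exact: weight_comp_sum.
have Xu u : X u \in gw u.1 u.2 by exact: weight_comp_mem.
have X2 u : X u != 0 -> u.2 = 1 by exact: weight_comp_aut.
have XW u : X u != 0 -> u \in WL.
  move=> X0; rewrite mem_weight_list; apply: contra X0 => /eqP g0.
  by have := Xu u; rewrite g0 memv0.
have Xwt u : X u != 0 -> wt u.1 1.
  by move=> X0; rewrite -(X2 _ X0) -(mem_WL SP) -surjective_pairing XW.
pose T := [seq u <- WL | X u != 0].
have TP' u : (u \in T) = (X u != 0).
  by rewrite mem_filter; case: (boolP (X u != 0)) => //= /XW ->.
have [u1 u1T] : exists u1, u1 \in T.
  apply: contrapT => noT; move/eqP: x0; apply; rewrite XE big1 // => u _.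
  by apply/eqP/negPn/negP => X0; apply: noT; exists u; rewrite TP'.
have [|u0 u0T umax] := @seq_max _ (fun u => '(u.1, u.1)) T u1 u1T.
  by move=> u; rewrite TP' => /Xwt wu; exact: (wt_real SP wu wu).
have e0 : X u0 != 0 by rewrite -TP'.
have w0 := Xwt _ e0; have z0 := X2 _ e0; have X0 := Xu u0.
move: u0 z0 u0T umax e0 w0 X0 => [l z] /= -> lT lmax e0 wl el.
set e := X (l, 1) in e0 el.
(* Since [l] has maximal norm among the weights occurring in [x], two of them add up to 2 l only if
   both equal [l]. *)
have convex u v : X u != 0 -> X v != 0 -> u.1 + v.1 = l *+ 2 -> u = (l, 1) /\ v = (l, 1).
  move=> X1 X3 uv; have [||E1 E2] := norm_convex (Xwt _ X1) (Xwt _ X3) _ _ uv.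
  - by apply: lmax; rewrite TP'.
  - by apply: lmax; rewrite TP'.
  by rewrite [u]surjective_pairing [v]surjective_pairing E1 E2 (X2 _ X1) (X2 _ X3).
have exte y m w : y \in gw m w -> lie e (lie e y) = (c * killing e y) *: e.
  (* Compare the components of weight 2 l + m in the identity for [x, [x, y]]: by [convex] only [e,
     [e, y]] is left on one side. *)
  move=> ym; pose p := weight_comp TP (l + (l + m), w).
  have lW : (l, 1) \in WL by rewrite mem_WL.
  have pS (F : _ -> L) : p (\sum_(u <- WL) F u) = \sum_(u <- WL) p (F u).
    exact: linear_sum.
  have pL : p (lie x (lie x y)) = lie e (lie e y).
    have -> : lie x (lie x y) = \sum_(u <- WL) \sum_(v <- WL) lie (X u) (lie (X v) y).
      rewrite [in LHS]XE lie_suml; apply: eq_bigr => u _.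
      by rewrite lie_suml lie_sumr.
    have Z u v : (u != (l, 1)) || (v != (l, 1)) -> p (lie (X u) (lie (X v) y)) = 0.
      have [->|Xu0] := eqVneq (X u) 0; first by rewrite lie0l linear0.
      have [->|Xv0] := eqVneq (X v) 0; first by rewrite lie0l !linear0.
      move=> uv; have := gen_weight_lie TP (Xu u) (gen_weight_lie TP (Xu v) ym).
      move=> /(@weight_comp_ne _ _ _ _ _ TP _ (_, _)); apply => /=.
      apply: contraL uv => /eqP[E _]; have [//|//||-> ->] := convex u v; last by rewrite eqxx.
      by move: E; rewrite !addrA => /addIr ->.
    rewrite pS (bigD1_seq (l, 1)) ?weight_list_uniq //= [X in _ + X]big1 => [|u ul]; last first.
      by rewrite pS big1 // => v _; rewrite Z // ul.
    rewrite addr0 pS (bigD1_seq (l, 1)) ?weight_list_uniq //= [X in _ + X]big1 => [|v vl]; last first.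
      by rewrite Z // vl orbT.
    rewrite addr0 /p weight_comp_id //=.
    by have := gen_weight_lie TP el (gen_weight_lie TP el ym); rewrite !mul1r.
  have kx : killing x y = \sum_(u <- WL) killing y (X u).
    by rewrite killingC [in LHS]XE killing_sumr.
  have kX u : killing y (X u) != 0 -> u = (- m, w^-1).
    rewrite killingC => /(killing_gen_weight TP (Xu u) ym)[-> ->].
    by rewrite opprK invrK -surjective_pairing.
  rewrite -pL ext linearZ /=.
  have [[mE wE]|ne] := pselect (m = - l /\ w = 1).
    have -> : p x = e by rewrite /p mE wE subrr addr0.
    congr (_ *: _); congr (_ * _); rewrite kx (bigD1_seq (l, 1)) ?weight_list_uniq //=.
    rewrite killingC big1 ?addr0 // => u ul; apply/eqP/negPn/negP => /kX uE.
    by move: ul; rewrite uE mE wE opprK invr1 eqxx.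
  have -> : killing e y = 0.
    apply/eqP/negPn/negP => /(killing_gen_weight TP el ym)[E1 E2]; apply: ne.
    by rewrite E1 E2 invr1.
  rewrite mulr0 scale0r; apply/eqP; rewrite scaler_eq0 mulf_eq0.
  have [k0|k0] := eqVneq (killing x y) 0; first by rewrite orbT.
  have [u ku] : exists u, killing y (X u) != 0.
    apply: contrapT => H; move/eqP: k0; apply; rewrite kx big1 // => u _.
    by apply/eqP/negPn/negP => ku; apply: H; exists u.
  have uE := kX _ ku; have Xu0 : X u != 0.
    by apply: contra ku => /eqP ->; rewrite killing0r.
  (* If (x, y) and this component of [x] were both nonzero, then - m and 2 l + m would be weights of
     [x] with sum 2 l, so that m = - l. *)
  apply/orP; right; apply/negPn/negP => p0.
  have := convex u (l + (l + m), w) Xu0 p0.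
  rewrite uE /= addrC -!addrA subrr addr0 -mulr2n => /(_ erefl)[[E1 E2] _].
  by apply: ne; rewrite -E1 opprK -[w]invrK E2 invr1.
have ext' y : lie e (lie e y) = (c * killing e y) *: e.
  rewrite (weight_comp_sum TP y) lie_sumr lie_sumr killing_sumr mulr_sumr scaler_suml.
  by apply: eq_bigr => u _; exact: (exte _ _ _ (weight_comp_mem TP u y)).
(* If l = 0, then [e] lies in [A]. A weight vector v with [e, v] = k v and k nonzero would be a
   multiple of [e] by extremality, hence in [A], and would commute with [e]. So every weight
   vanishes at [e]. *)
exists l, e; split=> //; apply: contra e0 => /eqP l0.
have eA : e \in A by apply/(sp_zero SP); rewrite -l0.
apply/eqP/(toral_nondeg SP) => // h; rewrite -[e](vsprojK eA) (killing_toral TP).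
rewrite big1_seq // => u /andP[_]; rewrite (surjective_pairing u) mem_WL => /(wt_pair SP) /=.
move=> [v [_ [vu v0 _ _ hv]]].
suff -> : u.1 (vsproj A e) = 0 by rewrite !mul0r.
have ev : lie e v = u.1 (vsproj A e) *: v by have := hv (vsproj A e); rewrite vsprojK.
have [//|k0] := eqVneq (u.1 (vsproj A e)) 0.
have := ext' v; rewrite ev linearZ /= ev scalerA => E.
have vA : v \in A.
  rewrite -[v](scalerK (mulf_neq0 k0 k0)) E scalerA.
  exact: memvZ.
move: ev; rewrite (tp_abelian TP) // => /esym/eqP.
by rewrite scaler_eq0 (negPf k0) (negPf v0).
Qed.

(** The identity is evaluated at a vector dual to [e]. As the degeneration keeps the constant [c],
    this transfers the square length of the roots for [H] to [H0]. *)
Lemma extremal_norm l e c : wt l 1 -> l != 0 -> e \in gw l 1 -> e != 0 ->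
  (forall y, lie e (lie e y) = (c * killing e y) *: e) -> '(l, l) = - c.
Proof.
move=> wl l0 el e0 ext; have [y yl ky] := weight_pairing SP el e0.
have he h := wt_eigen SP h l0 el.
have ey : lie e y = vsval (dual_vec l).
  by rewrite (weight_lie_opp SP (oner_neq0 C) el yl he) ky scale1r.
have := ext y; rewrite ey lieC he ky mulr1 -scaleNr -dual_formE => /eqP.
rewrite -subr_eq0 -scalerBl scaler_eq0 (negPf e0) orbF subr_eq0 => /eqP <-.
by rewrite opprK.
Qed.

End Degeneration.

(** * Simple roots and dominant weights *)

Section FromCartan.
Context (C : numClosedFieldType) (L : finLieAlgType C).
Context (s : 'End(L)) (t : nat) (G A : {vspace L}) (n : nat) (b : n.-tuple (dual_space A)).
Context (t_gt0 : (0 < t)%N) (sT : forall x, iter t s x = x).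
Context (sM : forall x y, s (lie x y) = lie (s x) (s y)).
Context (GE : forall x, (x \in G) = (s x == x)).
Context (simple : simple_lie_algebra L) (cartan : cartan_subalgebra G A).
Context (base : root_base G b).
Implicit Types (x y : L).

Lemma toral_separated (h : subvs_of A) : (forall l : dual_space A, l h = 0) -> h = 0.
Proof.
move=> H; rewrite (coord_vbasis (memvf h)) big1 // => i _.
have := H (linfun (coord (vbasis {:subvs_of A}) i : subvs_of A -> C^o)).
by rewrite lfunE /= => ->; rewrite scale0r.
Qed.

(** Each simple root is the eigenvalue of an actual root vector, so it vanishes on brackets of [A],
    and the simple roots span the dual space. *)
Lemma cartan_abelian x y : x \in A -> y \in A -> lie x y = 0.
Proof.
have [AG AA _ _] := cartan; have [bb broot _] := base.
move=> xA yA; have xyA := AA _ _ xA yA.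
suff : vsproj A (lie x y) = 0 by move=> E; rewrite -(vsprojK xyA) E linear0.
apply: toral_separated => l.
rewrite (coord_span (_ : l \in <<b>>%VS)); last first.
  by rewrite (eqP (proj1 (andP bb))) memvf.
rewrite sum_lfunE big1 // => i _; rewrite scale_lfunE.
suff -> : b`_i (vsproj A (lie x y)) = 0 by rewrite scaler0.
rewrite -tnth_nth; have [_ [v [_ v0 hv]]] := broot i.
have := hv (vsproj A (lie x y)); rewrite vsprojK //.
have hx := hv (vsproj A x); have hy := hv (vsproj A y); rewrite !vsprojK // in hx hy.
have -> : lie (lie x y) v = lie x (lie y v) - lie y (lie x v).
  by rewrite (lie_leibniz x y v) addrK.
rewrite hx hy !lieZr hx hy !scalerA [tnth b i (vsproj A y) * _]mulrC subrr => /esym/eqP.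
by rewrite scaler_eq0 (negPf v0) orbF => /eqP.
Qed.

Lemma cartan_toral : toral_pair s t A.
Proof.
have [AG _ _ _] := cartan.
by split=> //; [move=> x /(subvP AG); rewrite GE => /eqP | exact: cartan_abelian].
Qed.

Import VectorInternalTheory.

(** [dual_form] uses a generalized inverse; this value makes it vanish identically when the Killing
    form is zero on [A]. *)
Lemma inv_lfun0 (U V : vectType C) : ((0 : 'Hom(U, V))^-1)%VF = 0.
Proof.
have E (U' V' : vectType C) : f2mx (0 : 'Hom(U', V')) = 0.
  apply/row_matrixP => i; rewrite row0 rowE.
  have := zero_lfunE V' (r2v (delta_mx 0 i) : U').
  rewrite unlock /= r2vK => H.
  by apply: r2v_inj; rewrite H linear0.
by apply: val_inj; rewrite /= !E /pinvmx mxrank0 pid_mx_0 mulmx0 mul0mx.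
Qed.

(** The radical is an ideal. Were it all of [L], then [killing_flat] and with it [dual_form] would
    be zero, against the nonzero square length of [l]. *)
Lemma killing_nondeg (l : dual_space A) : dual_form l l != 0 ->
  forall x, (forall y, killing x y = 0) -> x = 0.
Proof.
move=> ll; pose I : {vspace L} := vspace_of (fun x => forall y, killing x y = 0).
have IP x : x \in I <-> forall y, killing x y = 0.
  apply: mem_vspace_of => [y|a x1 x2 H1 H2 y]; first exact: killing0l.
  by rewrite killingDl killingZl H1 H2 mulr0 addr0.
have [|I0 x xI|If] := simple.2 I.
- move=> x y /IP yI; apply/IP => v.
  by rewrite killing_ad yI oppr0.
- by apply/eqP; rewrite -memv0 -I0; apply/IP.
exfalso; move/negP: ll; apply; apply/eqP.
have -> : dual_form l l = l ((killing_flat A)^-1%VF l) by [].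
have -> : killing_flat A = 0.
  apply/lfunP => h; apply/lfunP => h'; rewrite killing_flatE !zero_lfunE.
  have hI : vsval h \in I by rewrite If memvf.
  by move/IP: hI => ->.
by rewrite inv_lfun0 zero_lfunE linear0.
Qed.

(** Let [U] be stable between [A] and the zero weight space. If [A, U] lies in [A],
    self-normalization gives the claim. Otherwise choose [h] with [h, U] not inside [A]: nilpotency
    of [ad h] on [U] makes [h, U] + A a proper stable subspace, and induction puts it inside [A], a
    contradiction. *)
Lemma cartan_zero x : x \in gen_weight s (0 : dual_space A) 1 <-> x \in A.
Proof.
have TP := cartan_toral; have [AG AA _ Anorm] := cartan.
split; last first.
  move=> xA; apply: weight_vector_mem => [|h].
    by rewrite (tp_fix TP) // scale1r.
  by rewrite zero_lfunE scale0r cartan_abelian // subvsP.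
pose Z := gen_weight s (0 : dual_space A) 1.
suff H k (U : {vspace L}) : (\dim U < k)%N -> (A <= U)%VS -> (U <= Z)%VS ->
    (forall h u, h \in A -> u \in U -> lie h u \in U) -> (U <= A)%VS.
  apply/subvP/(H (\dim Z).+1) => //.
    apply/subvP => y yA; apply: weight_vector_mem => [|h].
      by rewrite (tp_fix TP) // scale1r.
    by rewrite zero_lfunE scale0r cartan_abelian // subvsP.
  by move=> h u hA uZ; have := gen_weight_ad TP (vsproj A h) uZ; rewrite adE vsprojK.
elim: k U => // k IH U; rewrite ltnS => dU AU UZ hU.
have [norm|] := pselect (forall h u, h \in A -> u \in U -> lie h u \in A).
  apply/subvP => u uU; apply: Anorm.
    by rewrite GE (gen_weight_aut TP (subvP UZ _ uU)) scale1r.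
  by move=> h hA; rewrite lieC memvN norm.
move=> /existsNP[h /existsNP[u /not_implyP[hA /not_implyP[uU huA]]]].
pose U' := (ad h @: U + A)%VS.
have U'U : (U' <= U)%VS.
  rewrite subv_add AU andbT; apply/subvP => _ /memv_imgP[v vU ->].
  by rewrite adE hU.
have dU' : (\dim U' < \dim U)%N.
  rewrite ltnNge; apply/negP => dd; apply: huA.
  have /eqP U'E : U' == U by rewrite eqEdim U'U.
  have step j v : v \in U -> exists2 v', v' \in U & lie h v = iter j.+1 (ad h) v'.
    elim: j v => [|j IHj] v vU; first by exists v => //=; rewrite adE.
    move: (vU); rewrite -{1}U'E => /memv_addP[_ /memv_imgP[v1 v1U ->] [a aA ->]].
    rewrite linearD /= (cartan_abelian hA aA) addr0 adE.
    have [v' v'U E] := IHj _ v1U; exists v' => //.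
    by rewrite E -adE.
  have [N HN] : exists N, forall v, v \in U -> iter N (ad h - 0 *: \1)%VF v = 0.
    apply: nil_at_unif => v /(subvP UZ)/gen_weightP/(_ (Some (vsproj A h))).
    by rewrite /= vsprojK // zero_lfunE.
  rewrite scale0r subr0 in HN.
  have [v' v'U ->] := step N u uU.
  by rewrite iterS HN // linear0 mem0v.
exfalso; apply: huA; apply: (subvP (IH U' (leq_trans dU' dU) _ _ _)).
- exact: addvSr.
- exact: subv_trans U'U UZ.
- move=> h' v h'A /memv_addP[_ /memv_imgP[v1 v1U ->] [a aA ->]].
  rewrite linearD /= (cartan_abelian h'A aA) addr0 adE.
  rewrite lie_leibniz (cartan_abelian h'A hA) lie0l add0r.
  by apply: (subvP (addvSl _ _)); rewrite -adE memv_img // hU.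
by apply: (subvP (addvSl _ _)); rewrite -adE memv_img.
Qed.

Lemma cartan_split (l : dual_space A) : dual_form l l != 0 -> split_pair s t A.
Proof.
move=> ll; split; first exact: cartan_toral.
  exact: killing_nondeg ll.
exact: cartan_zero.
Qed.

Lemma lie_rootsP (SP : split_pair s t A) (a : dual_space A) :
  lie_roots G a <-> a != 0 /\ is_weight s a 1.
Proof.
split=> [[a0 [x [xG x0 ax]]]|[a0 wa]]; split=> //.
  apply/negP => /eqP g0; move/negP: x0; apply; rewrite -memv0 -g0.
  apply: weight_vector_mem => //.
  by move: xG; rewrite GE => /eqP ->; rewrite scale1r.
have [x [_ [xa x0 _ _ hx]]] := wt_pair SP wa; exists x; split=> //.
by rewrite GE (gen_weight_aut (sp_toral SP) xa) scale1r.
Qed.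

End FromCartan.

(** * Induction over the roots by simple reflections *)

Section RootBase.
Context (C : numClosedFieldType) (L : finLieAlgType C).
Context (s : 'End(L)) (t : nat) (G A : {vspace L}) (SP : split_pair s t A).
Context (GE : forall x, (x \in G) = (s x == x)).
Context (n : nat) (b : n.-tuple (dual_space A)) (base : root_base G b).
Implicit Types (l m a : dual_space A) (w : C) (i j : 'I_n).
Local Notation wt := (is_weight s).
Local Notation "''(' l , m )" := (dual_form l m) (format "''(' l ,  m )").

Lemma base_root i : tnth b i != 0 /\ wt (tnth b i) 1.
Proof. by have [_ H _] := base; exact/(lie_rootsP GE SP). Qed.

Lemma base_neq0 i : tnth b i != 0. Proof. exact: (base_root i).1. Qed.
Lemma base_wt i : wt (tnth b i) 1. Proof. exact: (base_root i).2. Qed.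
Lemma base_gt0 i : 0 < '(tnth b i, tnth b i).
Proof. exact: (weight_norm_gt0 SP (base_wt i) (base_neq0 i)). Qed.

Lemma base_span m : m = \sum_i coord b i m *: tnth b i.
Proof.
have [bb _ _] := base; rewrite {1}(coord_span (_ : m \in <<b>>%VS)).
  by apply: eq_bigr => i _; rewrite (tnth_nth 0).
by rewrite (eqP (proj1 (andP bb))) memvf.
Qed.

Lemma base_nondeg m m' : (forall i, '(tnth b i, m) = '(tnth b i, m')) -> m = m'.
Proof.
move=> H; apply/eqP; rewrite -subr_eq0; apply/eqP/(dual_form_nondeg SP) => l.
rewrite (base_span l) dual_form_sumr big1 // => i _.
rewrite dual_formZr (dual_formDl SP) (dual_formNl SP) ![dual_form _ (tnth b i)](dual_formC SP) H.
by rewrite subrr mulr0.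
Qed.

Lemma base_free (k : 'I_n -> C) : \sum_i k i *: tnth b i = 0 -> forall i, k i = 0.
Proof.
have [bb _ _] := base => E i.
have := coord_sum_free k i (basis_free bb).
under eq_bigr do rewrite -tnth_nth.
by rewrite E linear0.
Qed.

Lemma base_inj (k k' : 'I_n -> C) : \sum_i k i *: tnth b i = \sum_i k' i *: tnth b i -> k =1 k'.
Proof.
move=> E i; apply/eqP; rewrite -subr_eq0; apply/eqP; move: i; apply: base_free.
under eq_bigr do rewrite scalerBl.
by rewrite sumrB E subrr.
Qed.

(** Integrality makes [k] a divisor of 2, and [wt_double] excludes 2. *)
Lemma root_multiple i (k : nat) : wt (tnth b i *+ k) 1 -> tnth b i *+ k != 0 -> k = 1%N.
Proof.
move=> wk k0; have bi := base_gt0 i.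
have [c cE] := wt_int SP wk k0 (base_wt i).
have kn : k%:R != 0 :> C by apply: contra k0 => /eqP k0; rewrite -scaler_nat k0 scale0r.
have {}cE : c%:~R * k%:R = 2 :> C.
  rewrite -cE -scaler_nat !(dual_formZl SP) dual_formZr; field.
  by rewrite kn gt_eqF.
have : (c * k%:Z)%:~R = 2%:Z%:~R :> C by rewrite intrM cE.
move/intr_inj => {}cE.
have k2 : (k <= 2)%N.
  have : (k %| 2)%N by rewrite -[(k %| 2)%N]/((k%:Z %| 2%:Z)%Z) -cE dvdz_mull.
  exact: dvdn_leq.
case: k wk k0 kn cE k2 => [|[|[|]]] //.
by move=> _ + _; rewrite mulr0n eqxx.
by move=> wk; have := wt_double SP (base_wt i) (base_neq0 i); rewrite expr1n wk.
Qed.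

(** Induction on the height, for [a] and [- a] together. A positive root has a positive product with
    some simple root of its support, and that reflection lowers the height. The reflected root stays
    positive unless [a] is a multiple of the simple root, hence equal to it. *)
Lemma root_ind (Q : dual_space A -> Prop) : (forall i, Q (tnth b i)) ->
  (forall i a, wt a 1 -> a != 0 -> Q a -> Q (root_refl (tnth b i) a)) ->
  forall a, wt a 1 -> a != 0 -> Q a.
Proof.
move=> Qb Qs.
have bi0 i : '(tnth b i, tnth b i) != 0 by rewrite gt_eqF // base_gt0.
have reflN i a : root_refl (tnth b i) (- a) = - root_refl (tnth b i) a.
  by rewrite /root_refl dual_formNr mulrN mulNr scaleNr opprD.
have refl_self i : root_refl (tnth b i) (tnth b i) = - tnth b i.
  by rewrite /root_refl mulfK // scaler_nat mulr2n opprD addrA subrr add0r.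
have wtN a : wt a 1 -> wt (- a) 1 by move/(wt_neg SP); rewrite invr1.
suff H N (c : 'I_n -> nat) : (\sum_i c i <= N)%N -> let a := \sum_i tnth b i *+ c i in
    wt a 1 -> a != 0 -> Q a /\ Q (- a).
  move=> a wa a0; have [_ _ /(_ a)] := base.
  case=> [|c [E|E]]; first exact/(lie_rootsP GE SP).
    by have /= := H _ c (leqnn _); rewrite -E => /(_ wa a0)[].
  have aE : \sum_i tnth b i *+ c i = - a by rewrite E opprK.
  have /= := H _ c (leqnn _); rewrite aE oppr_eq0 opprK => /(_ (wtN _ wa) a0).
  by case.
elim: N c => [|N IH] c cN a wa a0.
  move: a0; rewrite /a big1 ?eqxx // => i _.
  by move: cN; rewrite leqn0 (bigD1 i) //= addn_eq0 => /andP[/eqP ->].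
have aE : a = \sum_i (c i)%:R *: tnth b i.
  by apply: eq_bigr => i _; rewrite scaler_nat.
have [i [ci ai]] : exists i, (0 < c i)%N /\ 0 < '(tnth b i, a).
  apply: contrapT => noi; have := weight_norm_gt0 SP wa a0.
  rewrite {2}aE dual_form_sumr => /lt_geF/negP; apply.
  rewrite -oppr_ge0 -sumrN sumr_ge0 // => i _.
  rewrite dual_formZr oppr_ge0; have [->|ci] := posnP (c i); first by rewrite mul0r.
  rewrite pmulr_rle0 ?ltr0n // (dual_formC SP) real_leNgt ?real0 //.
    by apply/negP => ai; apply: noi; exists i.
  exact: (wt_real SP (base_wt i) wa).
have [m mE] := wt_int SP (base_wt i) (base_neq0 i) wa.
have m0 : 0 < m by rewrite -(ltr0z C) -mE divr_gt0 ?mulr_gt0 ?ltr0n ?base_gt0.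
have raE : root_refl (tnth b i) a = a - m%:~R *: tnth b i by rewrite /root_refl mE.
have wr : wt (root_refl (tnth b i) a) 1 := wt_refl SP (base_wt i) (base_neq0 i) wa.
have r0 : root_refl (tnth b i) a != 0 := root_refl_neq0 (bi0 i) a0.
have rcoef : root_refl (tnth b i) a =
    \sum_j ((c j)%:R - (m * (j == i)%:R)%:~R) *: tnth b j.
  under eq_bigr do rewrite scalerBl.
  rewrite sumrB -aE raE; congr (_ - _).
  rewrite (bigD1 i) //= eqxx mulr1 big1 ?addr0 // => j /negPf ->.
  by rewrite mulr0 scale0r.
have back : Q (root_refl (tnth b i) a) /\ Q (- root_refl (tnth b i) a) -> Q a /\ Q (- a).
  move=> [Q1 Q2]; split.
    by rewrite -[a](root_reflK (bi0 i)); exact: Qs.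
  rewrite -[a](root_reflK (bi0 i)) -reflN; apply: Qs => //; first exact: wtN.
  by rewrite oppr_eq0.
have [_ _ /(_ (root_refl (tnth b i) a))] := base.
case=> [|d [dE|dE]]; first exact/(lie_rootsP GE SP).
  have dj j : (d j)%:Z = (c j)%:Z - m * (j == i)%:R.
    have E : (fun j => (d j)%:R : C) =1 (fun j => (c j)%:R - (m * (j == i)%:R)%:~R).
      by apply: base_inj; rewrite -rcoef dE; apply: eq_bigr => k _; rewrite scaler_nat.
    by apply: (@intr_inj C); rewrite rmorphB /= -[(c j)%:~R]/((c j)%:R) -(E j).
  apply: back; rewrite dE; apply: IH; rewrite -?dE // -ltnS.
  apply: leq_trans cN; rewrite (bigD1 i) //= [X in (_ < X)%N](bigD1 i) //= -addSn leq_add //.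
    by rewrite -ltz_nat dj eqxx mulr1 ltrBlDr ltrDl.
  by apply: leq_sum => j /negPf ji; rewrite -lez_nat dj ji mulr0 subr0.
(* The reflected root is negative although only its coordinate at [i] has changed, so all the other
   coordinates [c j] vanish. *)
have dj j : - (d j)%:Z = (c j)%:Z - m * (j == i)%:R.
  have E : (fun j => - (d j)%:R : C) =1 (fun j => (c j)%:R - (m * (j == i)%:R)%:~R).
    apply: base_inj; rewrite -rcoef dE -sumrN.
    by apply: eq_bigr => k _; rewrite scaleNr scaler_nat.
  by apply: (@intr_inj C); rewrite rmorphB rmorphN /= -[(c j)%:~R]/((c j)%:R) -(E j).
have cj j : j != i -> c j = 0%N.
  move=> /negPf ji; have := dj j; rewrite ji mulr0 subr0 => cd.
  by apply/eqP; rewrite -leqn0 -lez_nat -cd oppr_le0.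
have abi : a = tnth b i *+ c i.
  by rewrite /a (bigD1 i) //= big1 ?addr0 // => j /cj ->; rewrite mulr0n.
have ci1 : c i = 1%N by apply: (@root_multiple i); rewrite -abi.
rewrite abi ci1; split; first exact: Qb.
by rewrite mulr1n -refl_self; apply: Qs; rewrite ?base_neq0 ?base_wt.
Qed.

End RootBase.

(** * Extremality of root vectors when all roots have one length *)

Section SimplyLaced.
Context (C : numClosedFieldType) (L : finLieAlgType C).
Context (s : 'End(L)) (t : nat) (G A : {vspace L}) (SP : split_pair s t A).
Context (GE : forall x, (x \in G) = (s x == x)).
Context (n : nat) (b : n.-tuple (dual_space A)) (base : root_base G b).
Implicit Types (l m a : dual_space A) (w : C) (i j : 'I_n).
Local Notation wt := (is_weight s).
Local Notation gw := (gen_weight s).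
Local Notation TP := (sp_toral SP).
Local Notation "''(' l , m )" := (dual_form l m) (format "''(' l ,  m )").

Context (fixed : forall m w, wt m w -> w = 1) (N : C).
Context (lengths : forall i, '(tnth b i, tnth b i) = N).

Lemma root_length a : wt a 1 -> a != 0 -> '(a, a) = N.
Proof.
move: a; apply: (root_ind SP GE base) => // i a wa a0 <-.
by apply: (root_refl_iso SP); rewrite gt_eqF // (base_gt0 SP GE base).
Qed.

(** For [m] different from - a, a nonzero [e, [e, y]] would make 2 a + m a root. Equality of lengths
    then gives (a, m) = - N, so that a + m would have square length zero. The cases m = 0 and m = -
    2 a fall to [wt_double]. *)
Lemma simply_laced_extremal a e : wt a 1 -> a != 0 -> e \in gw a 1 ->
  forall y, lie e (lie e y) = (- N * killing e y) *: e.
Proof.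
move=> wa a0 ea.
have aa := root_length wa a0.
suff H y m w : y \in gw m w -> lie e (lie e y) = (- N * killing e y) *: e.
  move=> y; rewrite (weight_comp_sum TP y) !lie_sumr killing_sumr mulr_sumr scaler_suml.
  by apply: eq_bigr => u _; exact: (H _ _ _ (weight_comp_mem TP u y)).
move=> ym; have [->|y0] := eqVneq y 0; first by rewrite !linear0 killing0r mulr0 scale0r.
have wm : wt m w by apply/negP => /eqP g0; move: ym y0; rewrite g0 memv0 => ->.
have w1 := fixed wm; rewrite {}w1 {w} in ym wm.
have [mE|ma] := eqVneq m (- a).
  have he h := wt_eigen SP h a0 ea.
  have ya : y \in gw (- a) 1^-1 by rewrite -mE invr1.
  rewrite (weight_lie_opp SP (oner_neq0 C) ea ya he).
  by rewrite lieZr lieC he scalerN scalerA -scaleNr -dual_formE aa mulNr mulrC.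
have -> : killing e y = 0.
  apply/eqP/negPn/negP => /(killing_gen_weight TP ea ym)[E _].
  by rewrite E eqxx in ma.
rewrite mulr0 scale0r; apply/eqP/negPn/negP => H0.
have := gen_weight_lie TP ea (gen_weight_lie TP ea ym); rewrite !mul1r => H.
have wm' : wt (a + (a + m)) 1.
  by apply: contra H0 => /eqP g0; rewrite -memv0 -g0.
have double := wt_double SP wa a0; rewrite expr1n in double.
have [m0|m0] := eqVneq m 0.
  by move: wm'; rewrite m0 addr0 -mulr2n (negPf double).
have [m'0|m'0] := eqVneq (a + (a + m)) 0.
  move: wm; have -> : m = - (a *+ 2).
    by apply/eqP; rewrite -addr_eq0 addrC mulr2n -addrA m'0.
  by move/(wt_neg SP); rewrite opprK invr1 (negPf double).
have := root_length wm' m'0; rewrite !(dual_formDl SP, dual_formDr) aa (root_length wm m0).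
rewrite (dual_formC SP m a) => E.
have am : '(a, m) = - N.
  apply/eqP; rewrite -addr_eq0; apply/eqP/(@mulfI _ 4); first by rewrite pnatr_eq0.
  by move/eqP: E; rewrite -subr_eq0 mulr0 => /eqP <-; ring.
have := wt_neg SP wa; rewrite invr1 => wNa.
have := norm_sub_gt0 SP wm wNa ma; rewrite opprK !(dual_formDl SP, dual_formDr).
rewrite aa (root_length wm m0) (dual_formC SP m a) am.
by rewrite (_ : _ + _ = 0) ?ltxx //; ring.
Qed.

End SimplyLaced.

(** * Root systems with two lengths *)

Section TwoLengths.
Context (C : numClosedFieldType) (L : finLieAlgType C).
Context (s : 'End(L)) (t : nat) (G A : {vspace L}) (SP : split_pair s t A).
Context (GE : forall x, (x \in G) = (s x == x)).
Context (n : nat) (b : n.-tuple (dual_space A)) (base : root_base G b).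
Implicit Types (l m a : dual_space A) (w z : C) (i j : 'I_n).
Local Notation wt := (is_weight s).
Local Notation TP := (sp_toral SP).
Local Notation "''(' l , m )" := (dual_form l m) (format "''(' l ,  m )").

Let bi0 i : '(tnth b i, tnth b i) != 0.
Proof. by rewrite gt_eqF // (base_gt0 SP GE base). Qed.
Let bw := base_wt SP GE base.
Let b0 := base_neq0 SP GE base.

Definition linked i j := 2 * '(tnth b i, tnth b j) = - '(tnth b i, tnth b i) /\
  '(tnth b i, tnth b i) = '(tnth b j, tnth b j).

(** The ends of a simple bond are conjugate under the Weyl group, so Weyl-invariant properties
    spread along such bonds. *)
Lemma linked_refl i j : linked i j ->
  root_refl (tnth b i) (root_refl (tnth b j) (tnth b i)) = tnth b j.
Proof.
move=> [ij len]; have E : root_refl (tnth b j) (tnth b i) = root_refl (tnth b i) (tnth b j).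
  rewrite /root_refl (dual_formC SP (tnth b j)) ij -len.
  by rewrite mulNr divff // !scaleN1r !opprK addrC.
by rewrite E root_reflK.
Qed.

Lemma simple_conjugate (Q : dual_space A -> Prop) a :
  (forall i a, wt a 1 -> a != 0 -> Q (root_refl (tnth b i) a) -> Q a) ->
  wt a 1 -> a != 0 -> Q a -> exists i, Q (tnth b i) /\ '(tnth b i, tnth b i) = '(a, a).
Proof.
move=> Qs wa a0; move: a wa a0.
apply: (root_ind SP GE base) => [i Qi|i a wa a0 IH Qr]; first by exists i.
have [j [Qj jE]] := IH (Qs _ _ wa a0 Qr).
by exists j; split=> //; rewrite jE (root_refl_iso SP).
Qed.

Definition dominant l := forall i, 0 <= '(tnth b i, l).

(** Reflecting at a simple root with negative product raises the height by a positive integer; as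
    there are finitely many weights, the process ends at a dominant one. *)
Lemma dominant_ind z (Q : dual_space A -> Prop) :
  (forall i l, wt l z -> l != 0 -> Q (root_refl (tnth b i) l) -> Q l) ->
  (forall l, wt l z -> l != 0 -> dominant l -> Q l) ->
  forall l, wt l z -> l != 0 -> Q l.
Proof.
move=> Qs Qd; pose ht l : C := \sum_i coord b i l.
(* The measure counts the weights of larger height. Only differences of heights are compared, so
   heights may be arbitrary complex numbers. *)
pose above l := [seq u <- weight_list TP | 0 < ht u.1 - ht l].
have htD l m (k : C) : ht (l - k *: m) = ht l - k * ht m.
  rewrite /ht mulr_sumr -sumrB; apply: eq_bigr => i _.
  by rewrite linearB linearZ.
have htb i : ht (tnth b i) = 1.
  have [bb _ _] := base; rewrite /ht (bigD1 i) //= big1 ?addr0 => [|j ji].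
    by rewrite (tnth_nth 0) coord_free ?eqxx // (basis_free bb).
  by rewrite (tnth_nth 0) coord_free ?(basis_free bb) // eq_sym (negPf ji).
have H k l : (size (above l) < k)%N -> wt l z -> l != 0 -> Q l; last first.
  by move=> l; exact: (H _ l (leqnn _)).
elim: k l => // k IH l lk wl l0.
have [dom|] := pselect (dominant l); first exact: Qd.
move=> /existsNP[i il]; have wl' := wt_refl SP (bw i) (b0 i) wl.
have l'0 := root_refl_neq0 (bi0 i) l0.
apply: (Qs i) => //; apply: IH => //; rewrite ltnS in lk; apply: leq_trans lk.
have [m mE] := wt_int SP (bw i) (b0 i) wl.
have m0 : (m%:~R : C) < 0.
  rewrite -mE pmulr_llt0 ?invr_gt0 ?(base_gt0 SP GE base) // pmulr_rlt0 ?ltr0n //.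
  rewrite real_ltNge ?real0 ?(wt_real SP (bw i) wl) //; exact/negP.
have htl : ht (root_refl (tnth b i) l) = ht l - m%:~R.
  by rewrite /root_refl htD htb mE mulr1.
apply: (@uniq_leq_size _ ((root_refl (tnth b i) l, z) :: above _)).
  rewrite /= filter_uniq ?weight_list_uniq // andbT mem_filter.
  by rewrite /= subrr ltxx.
move=> u; rewrite inE => /orP[/eqP ->|].
  by rewrite mem_filter mem_WL wl' andbT htl addrAC subrr add0r oppr_gt0.
rewrite !mem_filter => /andP[+ ->]; rewrite andbT htl opprB => h.
by apply: lt_trans h _; rewrite ltrD2l -[ltRHS]add0r ltrD2r.
Qed.

(* sh marks the short simple roots. *)
Context (sh : pred 'I_n) (Ns Nl : C).
Context (lens : forall i, '(tnth b i, tnth b i) = if sh i then Ns else Nl).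
Context (Nlt : Ns < Nl).
Context (connected : forall Q : 'I_n -> Prop, (forall i j, linked i j -> Q i -> Q j) ->
  forall i j, sh i = sh j -> Q i -> Q j).
Context (double_edge : exists i j, [/\ sh i, ~~ sh j &
  2 * '(tnth b i, tnth b j) <= - (2 * '(tnth b i, tnth b i))]).

Lemma extremal_linked i j : linked i j ->
  extremal_root s (tnth b i) -> extremal_root s (tnth b j).
Proof.
move=> ij Ei; rewrite -(linked_refl ij).
apply: (extremal_root_refl SP (bw i) (b0 i)); first by rewrite (root_refl_iso SP).
exact: (extremal_root_refl SP (bw j) (b0 j)).
Qed.

(** An extremal root is conjugate to an extremal simple root. If that one were short, all short
    simple roots would be extremal, including the one at the multiple bond; its neighbour would then
    be its negative, in spite of the different length. *)
Lemma long_extremal l : wt l 1 -> l != 0 -> extremal_root s l ->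
  '(l, l) = Nl /\ forall j, ~~ sh j -> extremal_root s (tnth b j).
Proof.
move=> wl l0 El.
have [i a wa a0 Ea|i [Ei iE]] := @simple_conjugate (fun a => extremal_root s a) l _ wl l0 El.
  rewrite -(root_reflK (bi0 i) a); apply: (extremal_root_refl SP (bw i) (b0 i)) => //.
  by rewrite (root_refl_iso SP) // (weight_dual_neq0 SP wa).
have shi : ~~ sh i.
  apply/negP => shi; have [i1 [j1 [si1 sj1 le2]]] := double_edge.
  have E1 : extremal_root s (tnth b i1).
    by apply: (connected (Q := fun i => extremal_root s (tnth b i)) extremal_linked _ Ei); rewrite shi si1.
  have [E _] := E1 _ _ (bw j1) le2.
  have := lens j1; rewrite (negPf sj1) E dual_formNr (dual_formNl SP) opprK lens si1 => NsE.
  by move: Nlt; rewrite NsE ltxx.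
split; first by rewrite -iE lens (negPf shi).
move=> j shj; apply: (connected (Q := fun i => extremal_root s (tnth b i)) extremal_linked _ Ei).
by rewrite (negPf shi) (negPf shj).
Qed.

Lemma root_lengths a : wt a 1 -> a != 0 -> '(a, a) = Ns \/ '(a, a) = Nl.
Proof.
move: a; apply: (root_ind SP GE base) => [i|i a wa a0].
  by rewrite lens; case: ifP; [left|right].
by rewrite (root_refl_iso SP).
Qed.

Lemma weight_all_short z a : wt a z -> a != 0 -> wt a 1 -> '(a, a) = Ns ->
  forall a', wt a' 1 -> a' != 0 -> '(a', a') = Ns -> wt a' z.
Proof.
move=> wz a0 wa aN.
have [i a1 wa1 a10 w1|i [wi iE]] := @simple_conjugate (fun a => wt a z) a _ wa a0 wz.
  by rewrite -(root_reflK (bi0 i) a1); exact: (wt_refl SP (bw i) (b0 i) w1).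
have shi : sh i.
  apply/negPn/negP => shi; have := lens i; rewrite (negPf shi) iE aN => E.
  by move: Nlt; rewrite E ltxx.
have wj j : sh j -> wt (tnth b j) z.
  move=> shj; apply: (connected (Q := fun i => wt (tnth b i) z) _ _ wi); last by rewrite shi shj.
  move=> i1 j1 ij w1; rewrite -(linked_refl ij).
  apply: (wt_refl SP (bw i1) (b0 i1)); exact: (wt_refl SP (bw j1) (b0 j1) w1).
apply: (root_ind SP GE base) => [j|j a1 wa1 a10 IH].
  rewrite lens; case: ifP => [/wj //|_ E].
  by move: Nlt; rewrite E ltxx.
rewrite (root_refl_iso SP) // => /IH w1.
exact: (wt_refl SP (bw j) (b0 j) w1).
Qed.

End TwoLengths.

(** * Existence of nonzero weights outside the fixed algebra *)

Section NonzeroWeights.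
Context (C : numClosedFieldType) (L : finLieAlgType C).
Context (s : 'End(L)) (t : nat) (G A : {vspace L}) (SP : split_pair s t A).
Context (simple : simple_lie_algebra L).
Implicit Types (l m a : dual_space A) (w z : C) (x y : L).
Local Notation wt := (is_weight s).
Local Notation gw := (gen_weight s).
Local Notation TP := (sp_toral SP).
Local Notation WL := (weight_list TP).

(* If every weight of the eigenspaces L_w, w != 1, is zero, then the sum of these eigenspaces
   is an ideal. *)
Lemma nonzero_weight z a0 (x0 : L) : wt a0 1 -> a0 != 0 -> s x0 != x0 ->
  (forall w w', w ^+ t = 1 -> w' ^+ t = 1 -> w != 1 -> w' != 1 -> w' = w \/ w' = w^-1) ->
  z ^+ t = 1 -> z != 1 -> exists2 a : dual_space A, a != 0 & wt a z.
Proof.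
move=> wa0 a00 sx0 two zt z1; apply: contrapT => no.
have noz (m : dual_space A) : wt m z -> m = 0.
  by move=> wm; apply/eqP/negPn/negP => m0; apply: no; exists m.
(* The eigenvalues other than 1 are [z] and its inverse, and negation of weights exchanges the
   two. *)
have zero (m : dual_space A) w : wt m w -> w != 1 -> m = 0.
  move=> wm w1; have wt1 := gen_weight_order TP wm.
  have [E|E] := two _ _ zt wt1 z1 w1; first by rewrite E in wm; exact: noz.
  have := wt_neg SP wm; rewrite E invrK => /noz /eqP.
  by rewrite oppr_eq0 => /eqP.
pose W := [seq u <- WL | u.2 != 1]; pose N := sumW s W.
have WE (u : dual_space A * C) : (u \in W) = wt u.1 u.2 && (u.2 != 1).
  by rewrite mem_filter andbC (surjective_pairing u) mem_WL.
have ideal x y : y \in N -> lie x y \in N.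
  move: y; apply: sumW_ind => [y y' yN y'N||[m w] y].
  - by rewrite linearD memvD.
  - by rewrite linear0 mem0v.
  rewrite WE /= => /andP[wm w1] ym; have m0 := zero _ _ wm w1; rewrite {}m0 {m} in wm ym.
  rewrite (weight_comp_sum TP x) lie_suml big_seq; apply: memv_suml => -[m w'] _.
  set x' := weight_comp TP _ x; have x'm : x' \in gw m w' := weight_comp_mem TP (m, w') x.
  clearbody x'.
  have xy := gen_weight_lie TP x'm ym; rewrite addr0 in xy.
  have [->|xy0] := eqVneq (lie x' y) 0; first exact: mem0v.
  have wxy : wt m (w' * w).
    by apply/negP => /eqP g0; move: xy xy0; rewrite g0 memv0 => ->.
  (* Only a bracket whose eigenvalues multiply to 1 could leave [N]. It then lies in [A] and is
     shown to vanish. *)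
  have [ww|ww] := eqVneq (w' * w) 1; last first.
    by apply: (@mem_sumW _ _ _ _ _ (m, w' * w)) => //; rewrite WE wxy ww.
  have w'1 : w' != 1.
    by apply: contra w1 => /eqP w'1; rewrite -ww w'1 mul1r.
  have wm' : wt m w'.
    apply/negP => /eqP g0; move: x'm; rewrite g0 memv0 => /eqP x'0.
    by rewrite x'0 lie0l eqxx in xy0.
  have m0 := zero _ _ wm' w'1; rewrite {}m0 {m} in x'm xy wxy wm'.
  have hA : lie x' y \in A by apply/(sp_zero SP); rewrite -ww.
  suff hz : lie x' y = 0 by rewrite hz mem0v.
  (* A vector of weight 0 with eigenvalue other than 1 kills every fixed vector of nonzero weight,
     since the bracket would have a nonzero weight outside the fixed algebra. Applied to x' and y,
     this shows that every weight vanishes at their bracket. *)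
  have kill (m : dual_space A) (v : L) w2 : m != 0 -> w2 != 1 -> v \in gw (0 : dual_space A) w2 ->
      forall v' : L, v' \in gw m 1 -> lie v v' = 0.
    move=> m0 w21 v0 v' v'm; have := gen_weight_lie TP v0 v'm; rewrite add0r mulr1 => H.
    have [//|nz] := eqVneq (lie v v') 0.
    have wmw : wt m w2 by apply/negP => /eqP g0; move: H nz; rewrite g0 memv0 => ->.
    by move: m0; rewrite (zero _ _ wmw w21) eqxx.
  apply: (toral_nondeg SP) => // h; rewrite -[lie x' y](vsprojK hA) (killing_toral TP).
  rewrite big1_seq // => -[m w2] /andP[_]; rewrite mem_WL => wmw /=.
  suff -> : m (vsproj A (lie x' y)) = 0 by rewrite !mul0r.
  have [->|m0] := eqVneq m 0; first by rewrite zero_lfunE.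
  have w21 : w2 = 1 by apply/eqP/negPn/negP => w21; move: m0; rewrite (zero _ _ wmw w21) eqxx.
  rewrite w21 in wmw.
  have [v [_ [vm v0 _ _ hv]]] := wt_pair SP wmw.
  have := hv (vsproj A (lie x' y)); rewrite vsprojK // => E.
  have : lie (lie x' y) v = 0.
    have k1 : lie x' v = 0 by exact: (kill m x' w').
    have k2 : lie y v = 0 by exact: (kill m y w).
    have lie0 x1 : lie x1 0 = 0 :> L by exact: linear0.
    by have := lie_leibniz x' y v; rewrite k1 k2 !lie0 addr0 => <-.
  by rewrite E => /eqP; rewrite scaler_eq0 (negPf v0) orbF => /eqP.
have [N0|Nf] := simple.2 N ideal.
  have all1 u : u \in WL -> u.2 = 1.
    move=> uW; apply/eqP/negPn/negP => u1.
    have uW' : u \in W by rewrite mem_filter u1 uW.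
    have : (gw u.1 u.2 <= N)%VS.
      exact: (sumv_sup_seq (fun u => gw u.1 u.2) uW' isT).
    by rewrite N0 subv0; move: uW; rewrite mem_weight_list => /negPf ->.
  move/eqP: sx0; apply; rewrite [in LHS](weight_comp_sum TP x0) [in RHS](weight_comp_sum TP x0).
  rewrite linear_sum; apply: eq_big_seq => u uW.
  by rewrite /= (gen_weight_aut TP (weight_comp_mem TP u x0)) all1 // scale1r.
have nW : (a0, 1) \notin W by rewrite WE /= eqxx andbF.
move/negP: wa0; apply; have := gen_weight_cap TP nW.
by rewrite -/(sumW s W) -/N Nf capvf => ->.
Qed.

End NonzeroWeights.

(** * Integer coordinates of weights and Weyl orbits *)

Definition weyl_step (cm : nat -> nat -> int) (n i : nat) (c : seq int) : seq int :=
  [seq nth 0 c j - nth 0 c i * cm j i | j <- iota 0 n].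

Arguments weyl_step : simpl never.

Definition simple_coords (cm : nat -> nat -> int) (n i : nat) : seq int :=
  [seq cm j i | j <- iota 0 n].

(** The number [k] of rounds is a cut-off: where completeness matters it is certified by
    [weyl_closed], and a lower bound holds for any part of an orbit. *)
Definition weyl_orbit (cm : nat -> nat -> int) (n k : nat) (S : seq (seq int)) :=
  iter k (fun S => undup (S ++ flatten [seq [seq weyl_step cm n i c | i <- iota 0 n] | c <- S])) S.

Section Coordinates.
Context (C : numClosedFieldType) (L : finLieAlgType C).
Context (s : 'End(L)) (t : nat) (G A : {vspace L}) (SP : split_pair s t A).
Context (GE : forall x, (x \in G) = (s x == x)).
Context (n : nat) (b : n.-tuple (dual_space A)) (base : root_base G b).
Implicit Types (l m a : dual_space A) (w z : C) (i j : 'I_n) (c : seq int).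
Local Notation wt := (is_weight s).
Local Notation gw := (gen_weight s).
Local Notation TP := (sp_toral SP).
Local Notation WL := (weight_list TP).
Local Notation "''(' l , m )" := (dual_form l m) (format "''(' l ,  m )").

Let bgt0 i : 0 < '(tnth b i, tnth b i) := base_gt0 SP GE base i.
Let bi0 i : '(tnth b i, tnth b i) != 0.
Proof. by rewrite gt_eqF // bgt0. Qed.
Let bw := base_wt SP GE base.
Let b0 := base_neq0 SP GE base.

Context (cm : nat -> nat -> int).
Context (cartan : forall i j, 2 * '(tnth b i, tnth b j) = (cm i j)%:~R * '(tnth b i, tnth b i)).

(** The coordinates of [l] in fundamental weights; as lists of integers they can be reflected and
    compared by computation. *)
Definition coords l c :=
  size c = n /\ forall i, 2 * '(tnth b i, l) = (nth 0 c i)%:~R * '(tnth b i, tnth b i).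

Lemma coords_exist l w : wt l w -> exists c, coords l c.
Proof.
move=> wl; have [k kE] := @choice _ _ (fun i (k : int) =>
  2 * '(tnth b i, l) / '(tnth b i, tnth b i) = k%:~R) (fun i => wt_int SP (bw i) (b0 i) wl).
exists [seq k i | i <- enum 'I_n]; split; first by rewrite size_map size_enum_ord.
move=> i; rewrite (nth_map i) ?size_enum_ord // nth_ord_enum -kE divfK //.
Qed.

Lemma coords_inj l m c : coords l c -> coords m c -> l = m.
Proof.
move=> [_ lc] [_ mc]; apply: (base_nondeg SP base) => i.
by apply: (@mulfI _ 2); rewrite ?pnatr_eq0 // lc mc.
Qed.

Lemma coords_uniq l c c' : coords l c -> coords l c' -> c = c'.
Proof.
move=> [sc lc] [sc' lc']; apply: (@eq_from_nth _ 0); first by rewrite sc sc'.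
rewrite sc => k kn; have := lc (Ordinal kn); rewrite lc' /= => /(mulIf (bi0 _)).
by move/intr_inj.
Qed.

Lemma coords_simple i : coords (tnth b i) (simple_coords cm n i).
Proof.
split=> [|j]; first by rewrite size_map size_iota.
by rewrite cartan (nth_map 0%N) ?size_iota // nth_iota.
Qed.

Lemma coords_refl i l c : coords l c ->
  coords (root_refl (tnth b i) l) (weyl_step cm n i c).
Proof.
move=> [sc lc]; split=> [|j]; first by rewrite size_map size_iota.
rewrite (nth_map 0%N) ?size_iota // nth_iota //= add0n.
rewrite /root_refl dual_formDr dual_formNr dual_formZr mulrBr (lc i) (lc j).
rewrite mulfK // intrB mulrBl; congr (_ - _).
by rewrite mulrCA cartan intrM mulrA.
Qed.

Lemma weyl_step_wt i l c w : wt l w -> coords l c ->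
  wt (root_refl (tnth b i) l) w /\ coords (root_refl (tnth b i) l) (weyl_step cm n i c).
Proof. by move=> wl lc; split; [exact: (wt_refl SP (bw i) (b0 i) wl)|exact: coords_refl]. Qed.

Lemma weyl_orbit_wt k S w : (forall c, c \in S -> exists2 l, wt l w & coords l c) ->
  forall c, c \in weyl_orbit cm n k S -> exists2 l, wt l w & coords l c.
Proof.
move=> HS; elim: k => //= k IH c; rewrite mem_undup mem_cat => /orP[/IH //|].
move=> /flatten_mapP[c' /IH[l wl lc'] cE]; have /mapP[k' + ->] := cE.
rewrite mem_iota add0n => /= ilt.
have [wr rc] := weyl_step_wt (Ordinal ilt) wl lc'.
by exists (root_refl (tnth b (Ordinal ilt)) l).
Qed.

(** A decidable certificate that [S] contains the coordinates of all roots, by [root_ind]. *)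
Definition weyl_closed (S : seq (seq int)) :=
  all (fun k => simple_coords cm n k \in S) (iota 0 n) &&
  all (fun c => all (fun k => weyl_step cm n k c \in S) (iota 0 n)) S.

Lemma weyl_closed_roots S a : weyl_closed S -> wt a 1 -> a != 0 ->
  exists2 c, c \in S & coords a c.
Proof.
move=> /andP[/allP S1 /allP S2]; move: a.
apply: (root_ind SP GE base) => [i|i a wa a0 [c cS ac]].
  exists (simple_coords cm n i); last exact: coords_simple.
  by apply: S1; rewrite mem_iota /= add0n.
exists (weyl_step cm n i c); last exact: coords_refl.
by apply: (allP (S2 _ cS)); rewrite mem_iota /= add0n.
Qed.

Lemma ler_sum_subset (T : eqType) (F : T -> C) (U V : seq T) : uniq U -> uniq V ->
  {subset U <= V} -> (forall x, x \in V -> 0 <= F x) ->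
  \sum_(x <- U) F x <= \sum_(x <- V) F x.
Proof.
move=> uU uV UV F0.
have E : \sum_(x <- V | x \in U) F x = \sum_(x <- U) F x.
  rewrite -big_filter; apply: perm_big; apply: uniq_perm => //; first exact: filter_uniq.
  by move=> x; rewrite mem_filter; case: (boolP (x \in U)) => // /UV ->.
rewrite [leRHS](bigID (mem U)) /= E.
by rewrite lerDl big_seq_cond sumr_ge0 // => x /andP[/F0].
Qed.

Lemma norm_sum_term i l w c : wt l w -> coords l c ->
  2 * '(tnth b i, l) / '(tnth b i, tnth b i) = (nth 0 c i)%:~R.
Proof. by move=> wl [_ lc]; rewrite lc mulfK. Qed.

(** In [weight_norm_sum] the zero weight contributes nothing, and the roots have multiplicity one
    and distinct coordinate lists in [S]. *)
Lemma norm_sum_upper i S : (forall m w, wt m w -> w = 1) -> weyl_closed S -> uniq S ->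
  4 / '(tnth b i, tnth b i) <= (\sum_(c <- S) nth 0 c i ^+ 2)%:~R.
Proof.
move=> one Sc uS; rewrite -(weight_norm_sum SP (bw i) (b0 i)).
rewrite (bigID (fun u => u.1 == 0)) /= big1 ?add0r; last first.
  by move=> u /eqP ->; rewrite dual_form0r mulr0 mul0r expr0n mul0r.
rewrite -big_filter; set W := [seq u <- WL | _].
have WP u : u \in W -> [/\ wt u.1 1, u.1 != 0 & u.2 = 1].
  rewrite mem_filter (surjective_pairing u) mem_WL => /andP[u1 wu].
  by have u2 := one _ _ wu; rewrite -{1}u2.
have [k kP] : exists k : dual_space A * C -> seq int,
    forall u, u \in W -> k u \in S /\ coords u.1 (k u).
  have [|k kP] := @choice _ _ (fun u c => u \in W -> c \in S /\ coords u.1 c).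
    move=> u; have [uW|] := boolP (u \in W); last by exists [::].
    have [wu u0 _] := WP _ uW.
    by have [c cS uc] := weyl_closed_roots Sc wu u0; exists c.
  by exists k.
have kinj : {in W &, injective k}.
  move=> u v uW vW E; have [_ _ u2] := WP _ uW; have [_ _ v2] := WP _ vW.
  rewrite (surjective_pairing u) (surjective_pairing v) u2 v2; congr pair.
  have [_ uc] := kP _ uW; have [_ vc] := kP _ vW.
  by apply: coords_inj uc _; rewrite E.
have -> : (\sum_(c <- S) nth 0 c i ^+ 2)%:~R = \sum_(c <- S) ((nth 0 c i)%:~R : C) ^+ 2.
  by rewrite rmorph_sum /=; apply: eq_bigr => c _; rewrite rmorphXn.
have -> : \sum_(u <- W) (2 * '(tnth b i, u.1) / '(tnth b i, tnth b i)) ^+ 2 *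
    (\dim (gw u.1 u.2))%:R = \sum_(c <- map k W) ((nth 0 c i)%:~R : C) ^+ 2.
  rewrite big_map; apply: eq_big_seq => u uW; have [wu u0 u2] := WP _ uW.
  by rewrite u2 (wt_dim1 SP wu u0) mulr1 (norm_sum_term i wu (kP _ uW).2).
apply: ler_sum_subset => //.
- by rewrite map_inj_in_uniq // filter_uniq // weight_list_uniq.
- by move=> _ /mapP[u uW ->]; have [] := kP _ uW.
by move=> c _; rewrite -rmorphXn /= ler0z sqr_ge0.
Qed.

(** The eigenvalue separates the weights that realize [S] from those that realize [T], even where
    the lists agree, so both families count in [weight_norm_sum]. *)
Lemma norm_sum_lower i z S T : z != 1 -> uniq S -> uniq T ->
  (forall c, c \in S -> exists2 l, wt l 1 & coords l c) ->
  (forall c, c \in T -> exists2 l, wt l z & coords l c) ->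
  (\sum_(c <- S) nth 0 c i ^+ 2 + \sum_(c <- T) nth 0 c i ^+ 2)%:~R <= 4 / '(tnth b i, tnth b i).
Proof.
move=> z1 uS uT HS HT.
have real (R : seq (seq int)) w : (forall c, c \in R -> exists2 l, wt l w & coords l c) ->
    exists k : seq int -> dual_space A * C, forall c, c \in R ->
      [/\ wt (k c).1 w, coords (k c).1 c & (k c).2 = w].
  move=> HR; have [|k kP] := @choice _ _ (fun c (u : dual_space A * C) => c \in R ->
      [/\ wt u.1 w, coords u.1 c & u.2 = w]).
    move=> c; have [cR|] := boolP (c \in R); last by exists (0, 1).
    by have [l wl lc] := HR _ cR; exists (l, w).
  by exists k.
have [k1 k1P] := real _ _ HS; have [k2 k2P] := real _ _ HT.
have inj (R : seq (seq int)) w k : (forall c, c \in R ->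
    [/\ wt (k c).1 w, coords (k c).1 c & (k c).2 = w]) -> {in R &, injective k}.
  move=> kP c c' cR c'R E; have [_ H1 _] := kP _ cR; have [_ H2 _] := kP _ c'R.
  by apply: coords_uniq H1 _; rewrite E.
pose F (u : dual_space A * C) := (2 * '(tnth b i, u.1) / '(tnth b i, tnth b i)) ^+ 2 *
  (\dim (gw u.1 u.2))%:R.
have F0 u : u \in WL -> 0 <= F u.
  rewrite (surjective_pairing u) mem_WL => wu; rewrite /F.
  have [k ->] := wt_int SP (bw i) (b0 i) wu.
  by rewrite mulr_ge0 ?ler0n // -rmorphXn /= ler0z sqr_ge0.
rewrite -(weight_norm_sum SP (bw i) (b0 i)) -/(F _).
have le (R : seq (seq int)) w k : (forall c, c \in R ->
    [/\ wt (k c).1 w, coords (k c).1 c & (k c).2 = w]) ->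
    (\sum_(c <- R) nth 0 c i ^+ 2)%:~R <= \sum_(u <- map k R) F u.
  move=> kP; rewrite big_map rmorph_sum /= big_seq [leRHS]big_seq.
  apply: ler_sum => c cR; have [w1 c1 k2E] := kP _ cR.
  rewrite /F (norm_sum_term i w1 c1) rmorphXn /= k2E ler_peMr //.
    by rewrite -rmorphXn /= ler0z sqr_ge0.
  by rewrite ler1n lt0n dimv_eq0.
rewrite intrD; apply: le_trans (lerD (le _ _ _ k1P) (le _ _ _ k2P)) _.
rewrite -big_cat /=; apply: ler_sum_subset => //; last first.
- move=> u; rewrite mem_cat => /orP[] /mapP[c cR ->].
    by have [w1 _ E] := k1P _ cR; rewrite (surjective_pairing (k1 c)) mem_WL E.
  by have [w1 _ E] := k2P _ cR; rewrite (surjective_pairing (k2 c)) mem_WL E.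
- exact: weight_list_uniq.
rewrite cat_uniq !map_inj_in_uniq ?uS ?uT ?andbT /=; [|exact: inj k2P|exact: inj k1P].
apply/hasPn => _ /mapP[c cT ->]; apply/negP => /mapP[c' c'S E].
have [_ _ E1] := k1P _ c'S; have [_ _ E2] := k2P _ cT.
by move/eqP: z1; apply; rewrite -E1 -E2 E.
Qed.

End Coordinates.

Section WeylWords.
Context (C : numClosedFieldType) (L : finLieAlgType C).
Context (s : 'End(L)) (t : nat) (G A : {vspace L}) (SP : split_pair s t A).
Context (GE : forall x, (x \in G) = (s x == x)).
Context (n : nat) (b : n.-tuple (dual_space A)) (base : root_base G b).
Implicit Types (l m a : dual_space A) (w z : C) (i j : 'I_n) (c : seq int).
Local Notation wt := (is_weight s).
Local Notation "''(' l , m )" := (dual_form l m) (format "''(' l ,  m )").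

Let bi0 i : '(tnth b i, tnth b i) != 0.
Proof. by rewrite gt_eqF // (base_gt0 SP GE base). Qed.
Let bw := base_wt SP GE base.
Let b0 := base_neq0 SP GE base.

Context (cm : nat -> nat -> int).
Context (cartan : forall i j, 2 * '(tnth b i, tnth b j) = (cm i j)%:~R * '(tnth b i, tnth b i)).
Local Notation coords := (coords b).

Definition weyl_word (r : seq nat) c := foldl (fun c k => weyl_step cm n k c) c r.

(** The last clause pulls a property of the weight reached by the word back to the weight it started
    from. *)
Lemma weyl_word_wt r l c w : all (fun k => k < n)%N r -> wt l w -> coords l c -> exists l',
  [/\ wt l' w, coords l' (weyl_word r c) &
  forall Q : dual_space A -> Prop,
    (forall i l, wt l w -> Q (root_refl (tnth b i) l) -> Q l) -> Q l' -> Q l].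
Proof.
elim: r l c => [|k r IH] l c /= => [_ wl lc|/andP[kn rn] wl lc].
  by exists l; split.
have [wl' lc'] := weyl_step_wt SP GE base cartan (Ordinal kn) wl lc.
have [l' [wl'' lc'' HQ]] := IH _ _ rn wl' lc'.
exists l'; split=> // Q HQ' Ql'; apply: (HQ' (Ordinal kn)) => //.
exact: HQ.
Qed.

Definition root_of_norm (N : C) l := wt l 1 /\ '(l, l) = N.

Lemma root_of_norm_refl N i l : root_of_norm N (root_refl (tnth b i) l) -> root_of_norm N l.
Proof.
move=> [wl lN]; split; last by rewrite -lN (root_refl_iso SP).
by rewrite -[l](root_reflK (bi0 i)); apply: (wt_refl SP (bw i) (b0 i)).
Qed.

(** With a coordinate of at least 2, the reflected weight would meet the inequality in
    [extremal_root] and so have eigenvalue 1. *)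
Lemma extremal_coord l c z i : z != 1 -> extremal_root s (tnth b i) -> wt l z -> coords l c ->
  nth 0 c i <= 1.
Proof.
move=> z1 Ei wl [sc lc]; rewrite leNgt; apply/negP => c2.
have [_ z1'] : root_refl (tnth b i) l = - tnth b i /\ z = 1; last by rewrite z1' eqxx in z1.
apply: Ei; first exact: (wt_refl SP (bw i) (b0 i) wl).
have self : root_refl (tnth b i) (tnth b i) = - tnth b i.
  by rewrite /root_refl mulfK // scaler_nat mulr2n opprD addrA subrr add0r.
rewrite -(root_reflE SP) // self (dual_formNl SP) mulrN lc lerN2.
by rewrite ler_pM2r ?(base_gt0 SP GE base) // -[2]/(2%:Z%:~R) ler_int.
Qed.

Lemma dominant_coords l c : dominant b l -> coords l c -> forall k, 0 <= nth 0 c k.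
Proof.
move=> dl [sc lc] k; have [kn|kn] := ltnP k n; last by rewrite nth_default // sc.
rewrite -(ler_int C) -(pmulr_lge0 _ (base_gt0 SP GE base (Ordinal kn))).
by rewrite -(lc (Ordinal kn)) mulr_ge0 ?ler0n.
Qed.

End WeylWords.

(** * Dominant weights in types G_2 and F_4 *)

Section G2F4.
Context (C : numClosedFieldType) (L : finLieAlgType C).
Context (s : 'End(L)) (t : nat) (G A : {vspace L}) (SP : split_pair s t A).
Context (GE : forall x, (x \in G) = (s x == x)).
Implicit Types (l m a : dual_space A) (w z : C) (c : seq int).
Local Notation wt := (is_weight s).
Local Notation "''(' l , m )" := (dual_form l m) (format "''(' l ,  m )").

Lemma coords0 n (b : n.-tuple (dual_space A)) (base : root_base G b) l :
  coords b l (nseq n 0) -> l = 0.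
Proof.
move=> lc; apply: (coords_inj SP base lc); split; first by rewrite size_nseq.
by move=> i; rewrite dual_form0r mulr0 nth_nseq if_same mul0r.
Qed.

Lemma G2_short (b : 2.-tuple (dual_space A)) z : root_base G b ->
  (forall i j, 2 * '(tnth b i, tnth b j) =
     (cartan_entry TypeG2 i j)%:~R * '(tnth b i, tnth b i)) ->
  z != 1 -> extremal_root s (tnth b (inord 1)) ->
  forall l, wt l z -> l != 0 -> root_of_norm s '(tnth b ord0, tnth b ord0) l.
Proof.
move=> base cartan z1 E1; apply: (dominant_ind SP GE base) => [i l _ _|l wl l0 dl].
  exact: (root_of_norm_refl SP GE base).
have [c lc] := coords_exist SP GE base wl.
have cpos := dominant_coords SP GE base dl lc.
have [] := lc; case: c lc cpos => [|x [|y [|? ?]]] //= lc cpos _ _.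
have x0 := cpos 0%N; have y0 := cpos 1%N; rewrite /= in x0 y0.
(* The word turns coordinate 1 into x + 2 y, the value of [l] on the coroot of the highest root,
   which leaves only the first fundamental weight. *)
have [l1 [wl1 lc1 _]] := weyl_word_wt SP GE base cartan (isT : all (fun k => k < 2)%N [:: 1; 0]%N) wl lc.
have := extremal_coord SP GE base z1 E1 wl1 lc1; rewrite inordK // => le1.
rewrite /weyl_word /weyl_step /cartan_entry /= in le1.
have [xE yE] : x = 1 /\ y = 0.
  have xy0 : ~ (x = 0 /\ y = 0).
    move=> [x00 y00]; rewrite x00 y00 in lc.
    by move/eqP: l0; apply; exact: (coords0 base lc).
  by clear -x0 y0 le1 xy0; lia.
rewrite {}xE {}yE in lc.
(* The first fundamental weight is the highest short root; this word takes it to the short simple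
   root. *)
have [l2 [wl2 lc2 HQ]] := weyl_word_wt SP GE base cartan (isT : all (fun k => k < 2)%N [:: 0; 1]%N) wl lc.
apply: HQ => [i l' _|]; first exact: (root_of_norm_refl SP GE base).
have -> : l2 = tnth b ord0.
  by apply: (coords_inj SP base lc2); have := coords_simple cartan ord0.
by split=> //; exact: (base_wt SP GE base).
Qed.

Lemma F4_short (b : 4.-tuple (dual_space A)) z : root_base G b ->
  (forall i j, 2 * '(tnth b i, tnth b j) =
     (cartan_entry TypeF4 i j)%:~R * '(tnth b i, tnth b i)) ->
  z != 1 -> extremal_root s (tnth b (inord 1)) ->
  forall l, wt l z -> l != 0 -> root_of_norm s '(tnth b (inord 3), tnth b (inord 3)) l.
Proof.
move=> base cartan z1 E1; apply: (dominant_ind SP GE base) => [i l _ _|l wl l0 dl].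
  exact: (root_of_norm_refl SP GE base).
have [c lc] := coords_exist SP GE base wl.
have cpos := dominant_coords SP GE base dl lc.
have [] := lc; case: c lc cpos => [|x [|y [|u [|v [|? ?]]]]] //= lc cpos _ _.
have x0 := cpos 0%N; have y0 := cpos 1%N; have u0 := cpos 2%N; have v0 := cpos 3%N.
rewrite /= in x0 y0 u0 v0.
(* Coordinate 1 becomes 2 x + 3 y + 2 u + v, the value on the coroot of the highest root, which
   leaves only the last fundamental weight. *)
have [l1 [wl1 lc1 _]] := weyl_word_wt SP GE base cartan
  (isT : all (fun k => k < 4)%N [:: 0; 1; 2; 1; 0; 3; 2]%N) wl lc.
have := extremal_coord SP GE base z1 E1 wl1 lc1; rewrite inordK // => le1.
rewrite /weyl_word /weyl_step /cartan_entry /= in le1.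
have [[xE yE] [uE vE]] : (x = 0 /\ y = 0) /\ (u = 0 /\ v = 1).
  have nz : ~ ((x = 0 /\ y = 0) /\ (u = 0 /\ v = 0)).
    move=> [[x00 y00] [u00 v00]]; rewrite x00 y00 u00 v00 in lc.
    by move/eqP: l0; apply; exact: (coords0 base lc).
  by clear -x0 y0 u0 v0 le1 nz; lia.
rewrite {}xE {}yE {}uE {}vE in lc.
have [l2 [wl2 lc2 HQ]] := weyl_word_wt SP GE base cartan
  (isT : all (fun k => k < 4)%N [:: 3; 2; 1; 0; 2; 1; 2]%N) wl lc.
apply: HQ => [i l' _|]; first exact: (root_of_norm_refl SP GE base).
have -> : l2 = tnth b (inord 3).
  apply: (coords_inj SP base lc2); have := coords_simple cartan (inord 3).
  by rewrite inordK.
by split=> //; exact: (base_wt SP GE base).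
Qed.

End G2F4.

(** * Orthogonal frames for types B and C *)

Lemma frame_ind n' (P : nat -> Prop) : P n' ->
  (forall k, (k < n')%N -> P k.+1 -> P k) -> forall k, (k <= n')%N -> P k.
Proof.
move=> P0 PS k kn; rewrite -(subKn kn); move: (leq_subr k n').
elim: (n' - k)%N => [|d IH] dn; first by rewrite subn0.
have -> : (n' - d.+1)%N = (n' - d).-1 by lia.
by apply: PS; [lia|rewrite prednK; [apply: IH; lia|lia]].
Qed.

(** The order of the moves is that of [frame_conj2]: the first index descends while the second is
    last, then the second descends. *)
Lemma frame_ind2 n' (P : nat -> nat -> Prop) : (0 < n')%N -> P n'.-1 n' ->
  (forall k, (k.+1 < n')%N -> P k.+1 n' -> P k n') ->
  (forall k k', (k < k')%N -> (k' < n')%N -> P k k'.+1 -> P k k') ->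
  forall k k', (k < k')%N -> (k' <= n')%N -> P k k'.
Proof.
move=> n0 P0 P1 P2.
have H k : (k < n')%N -> P k n'.
  move=> kn; rewrite -(subKn (ltnW kn)); move: (leq_subr k n') (kn); rewrite -subn_gt0.
  elim: (n' - k)%N => [//|[|d] IH] dn _; first by rewrite subn1.
  have -> : (n' - d.+2)%N = (n' - d.+1).-1 by lia.
  by apply: P1; [lia|rewrite prednK; [apply: IH; lia|lia]].
move=> k k' + k'n; move: k' k'n; apply: (@frame_ind _ (fun k' => (k < k')%N -> P k k')); first exact: H.
by move=> k' k'n IH kk'; apply: P2 => //; apply: IH; exact: ltnW.
Qed.

Section OrthogonalFrame.
Context (C : numClosedFieldType) (L : finLieAlgType C).
Context (s : 'End(L)) (t : nat) (G A : {vspace L}) (SP : split_pair s t A).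
Context (GE : forall x, (x \in G) = (s x == x)).
Context (n' : nat) (b : (n'.+1).-tuple (dual_space A)) (base : root_base G b).
Local Notation n := n'.+1.
Implicit Types (l m a : dual_space A) (w z : C) (i j : 'I_n) (k : nat).
Local Notation "''(' l , m )" := (dual_form l m) (format "''(' l ,  m )").

Let bgt0 i : 0 < '(tnth b i, tnth b i) := base_gt0 SP GE base i.
Let bi0 i : '(tnth b i, tnth b i) != 0.
Proof. by rewrite gt_eqF // bgt0. Qed.

(* The frame eps_k = sum_(j >= k) c_j b_j of types B (all c_j = 1) and C (c_j = 1/2 for the last
   root): the c_j b_j are eps_k - eps_(k+1) and the last eps. *)
Context (cf : 'I_n -> C) (K : C) (K0 : 0 < K) (cf0 : forall i, cf i != 0).
Context (gram : forall i j, cf i * cf j * '(tnth b i, tnth b j) =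
  K * ((i == j)%:R * (if i == ord_max then 1 else 2) - (i == j.+1 :> nat)%:R - (j == i.+1 :> nat)%:R)).

Definition frame k : dual_space A := \sum_(j < n | (k <= j)%N) cf j *: tnth b j.
Local Notation E := frame.

Lemma frame_end k : (n <= k)%N -> E k = 0.
Proof. by move=> nk; rewrite /E big1 // => j kj; have := leq_trans nk kj; rewrite leqNgt ltn_ord. Qed.

Lemma frame_step i : E i = cf i *: tnth b i + E i.+1.
Proof.
rewrite /E (bigD1 i) //=; congr (_ + _); apply: eq_bigl => j.
by rewrite ltn_neqAle eq_sym andbC.
Qed.

Lemma frame_simple k j : (k < n)%N ->
  cf j * '(E k, tnth b j) = K * ((k == j)%:R - (k == j.+1)%:R).
Proof.
move=> kn; have [d dE] : exists d, (n' - k)%N = d by exists (n' - k)%N.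
elim: d k kn dE => [|d IH] k kn dE.
  have kE : k = n' by lia.
  have -> : E k = cf ord_max *: tnth b ord_max.
    by rewrite kE -[n']/(ord_max : nat) frame_step frame_end // addr0.
  rewrite (dual_formZl SP) mulrA (mulrC (cf j)) gram eqxx kE mulr1.
  have jn : (j == n'.+1 :> nat) = false by rewrite ltn_eqF.
  by rewrite -!val_eqE /= jn subr0.
have kn1 : (k.+1 < n)%N by lia.
have -> : E k = cf (Ordinal kn) *: tnth b (Ordinal kn) + E k.+1 by exact: (frame_step (Ordinal kn)).
rewrite (dual_formDl SP) mulrDr IH //; last by lia.
rewrite (dual_formZl SP) mulrA (mulrC (cf j)) gram -mulrDr; congr (_ * _).
have -> : (Ordinal kn == ord_max) = false by apply/eqP => /(congr1 val) /=; lia.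
have -> : (Ordinal kn == j) = (k == j :> nat) by [].
rewrite /= eqSS (eq_sym k.+1); ring.
Qed.

Lemma frame_orth i k : '(E i, E k) = K * (i == k :> nat)%:R.
Proof.
have [nk|kn] := leqP n k.
  by rewrite (frame_end nk) dual_form0r (_ : (i == k :> nat) = false) ?mulr0 // ltn_eqF // (leq_trans _ nk).
have [d dE] : exists d, (n' - k)%N = d by exists (n' - k)%N.
elim: d k kn dE => [|d IH] k kn dE.
  have kE : k = n' by lia.
  have -> : E k = cf ord_max *: tnth b ord_max.
    by rewrite kE -[n']/(ord_max : nat) frame_step frame_end // addr0.
  rewrite dual_formZr frame_simple // kE /=.
  have jn : (i == n'.+1 :> nat) = false by rewrite ltn_eqF.
  by rewrite jn subr0.
have kn1 : (k.+1 < n)%N by lia.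
have -> : E k = cf (Ordinal kn) *: tnth b (Ordinal kn) + E k.+1 by exact: (frame_step (Ordinal kn)).
by rewrite dual_formDr dual_formZr frame_simple // IH //; [rewrite /=; ring|lia].
Qed.

Lemma frame_inj l m : (forall i, '(E i, l) = '(E i, m)) -> l = m.
Proof.
move=> lm; apply: (base_nondeg SP base) => i; apply: (mulfI (cf0 i)).
rewrite -!(dual_formZl SP).
have -> : cf i *: tnth b i = E i - E i.+1 by rewrite frame_step addrK.
rewrite !(dual_formDl SP, dual_formNl SP) lm; congr (_ - _).
have [i1|i1] := ltnP i.+1 n; first exact: (lm (Ordinal i1)).
by rewrite frame_end // !(dual_form0l SP).
Qed.

Lemma refl_scale i l : root_refl (tnth b i) l = root_refl (cf i *: tnth b i) l.
Proof.
rewrite /root_refl !(dual_formZl SP (tnth b i) (cf i)) dual_formZr scalerA.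
suff -> : 2 * '(tnth b i, l) / '(tnth b i, tnth b i) =
  2 * (cf i * '(tnth b i, l)) / (cf i * (cf i * '(tnth b i, tnth b i))) * cf i by [].
by field; rewrite cf0 bi0.
Qed.

Lemma simple_frame i : i != ord_max -> cf i *: tnth b i = E i - E i.+1 /\
  '(E i - E i.+1, E i - E i.+1) = 2 * K.
Proof.
move=> im; have i1 : (i.+1 < n)%N by move: im (ltn_ord i); rewrite -val_eqE /=; lia.
split; first by rewrite frame_step addrK.
rewrite !(dual_formDl SP, dual_formNl SP, dual_formDr, dual_formNr).
have e1 : '(E i, E i) = K by rewrite (frame_orth i) eqxx mulr1.
have e2 : '(E i, E i.+1) = 0 by rewrite (frame_orth i) ltn_eqF ?mulr0.
have e3 : '(E i.+1, E i.+1) = K by rewrite (frame_orth (Ordinal i1)) eqxx mulr1.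
by rewrite (dual_formC SP (E i.+1) (E i)) e1 e2 e3; ring.
Qed.

(** The Weyl group acts by signed permutations of the frame: these reflections exchange neighbours,
    and the last one changes a sign. *)
Lemma frame_refl i k : i != ord_max -> (k < n)%N -> root_refl (tnth b i) (E k) =
  if k == i :> nat then E i.+1 else if k == i.+1 then E i else E k.
Proof.
move=> im kn; have [bE bb] := simple_frame im.
have i1 : (i.+1 < n)%N by move: im (ltn_ord i); rewrite -val_eqE /=; lia.
rewrite refl_scale bE /root_refl bb.
have -> : '(E i - E i.+1, E k) = K * ((i == k :> nat)%:R - (i.+1 == k)%:R).
  rewrite (dual_formDl SP) (dual_formNl SP) (frame_orth i) (frame_orth (Ordinal i1)) /=.
  by ring.
have -> x : 2 * (K * x) / (2 * K) = x.
  by rewrite mulrA mulrAC divff ?mul1r // mulf_neq0 ?pnatr_eq0 ?(gt_eqF K0).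
rewrite (eq_sym k i) (eq_sym k i.+1).
have [<-|ik] := eqVneq (i : nat) k.
  by rewrite gtn_eqF // subr0 scale1r opprB addrC subrK.
have [<-|ik'] := eqVneq i.+1 k; last by rewrite subrr scale0r subr0.
by rewrite sub0r scaleN1r opprK addrC subrK.
Qed.

Lemma frame_refl_max k : (k < n)%N -> root_refl (tnth b ord_max) (E k) =
  if k == n' then - E k else E k.
Proof.
move=> kn; have bE : cf ord_max *: tnth b ord_max = E n'.
  by rewrite (frame_step ord_max) frame_end // addr0.
rewrite refl_scale bE /root_refl (frame_orth ord_max) (frame_orth ord_max) /= eqxx mulr1.
rewrite (eq_sym n' k).
have [->|kn'] := eqVneq k n'; last by rewrite mulr0 mulr0 mul0r scale0r subr0.
by rewrite mulr1 mulfK ?gt_eqF // scaler_nat mulr2n opprD addrA subrr add0r.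
Qed.

Lemma root_reflD a l m : root_refl a (l + m) = root_refl a l + root_refl a m.
Proof. by rewrite /root_refl dual_formDr mulrDr mulrDl scalerDl opprD addrACA. Qed.

Lemma frame_conj (Q : dual_space A -> Prop) : (forall i l, Q l -> Q (root_refl (tnth b i) l)) ->
  Q (E n') -> forall k, (k <= n')%N -> Q (E k).
Proof.
move=> Qs Q0; apply: (@frame_ind n' (fun k => Q (E k))) => // k kn Qk.
have im : Ordinal (ltnW kn : (k < n)%N) != ord_max by rewrite -val_eqE /= ltn_eqF.
have := Qs (Ordinal (ltnW kn : (k < n)%N)) _ Qk; rewrite frame_refl //=.
by rewrite (gtn_eqF (ltnSn k)) eqxx.
Qed.

(** The last reflection turns the difference of the last two frame vectors into their sum, and
    exchanges of neighbours then move the two indices. *)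
Lemma frame_conj2 (Q : dual_space A -> Prop) : (forall i l, Q l -> Q (root_refl (tnth b i) l)) ->
  (0 < n')%N -> Q (E n'.-1 - E n') -> forall k k', (k < k')%N -> (k' <= n')%N -> Q (E k + E k').
Proof.
move=> Qs n0 Q0.
have step k l : (k.+1 < n)%N -> Q l ->
    exists2 i : 'I_n, i = k :> nat & i != ord_max /\ Q (root_refl (tnth b i) l).
  move=> k1 Ql; exists (Ordinal (ltnW k1)) => //; split; last exact: Qs.
  by rewrite -val_eqE /= ltn_eqF.
apply: (@frame_ind2 n' (fun k k' => Q (E k + E k')) n0) => [|k kn Qk|k k' kk' k'n Qk].
- have := Qs ord_max _ Q0; rewrite root_reflD -scaleN1r.
  have -> : root_refl (tnth b ord_max) (-1 *: E n') = - root_refl (tnth b ord_max) (E n').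
    by rewrite scaleN1r /root_refl dual_formNr mulrN mulNr scaleNr opprK opprD opprK.
  rewrite !frame_refl_max ?ltnS ?leq_pred // eqxx opprK.
  by rewrite ltn_eqF // prednK.
- have [//|i iE [im]] := step k _ _ Qk; first by lia.
  rewrite root_reflD !frame_refl ?iE //; try lia.
  rewrite (gtn_eqF (ltnSn k)) eqxx [n' == k]gtn_eqF ?[n' == k.+1]gtn_eqF //; lia.
have [//|i iE [im]] := step k' _ _ Qk.
rewrite root_reflD !frame_refl ?iE //; last by lia.
by rewrite (gtn_eqF (ltnSn k')) eqxx [k == k']ltn_eqF ?[k == k'.+1]ltn_eqF //; lia.
Qed.

End OrthogonalFrame.

Section TypesBC.
Context (C : numClosedFieldType) (L : finLieAlgType C).
Context (s : 'End(L)) (t : nat) (G A : {vspace L}) (SP : split_pair s t A).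
Context (GE : forall x, (x \in G) = (s x == x)).
Context (n' : nat) (b : (n'.+1).-tuple (dual_space A)) (base : root_base G b).
Local Notation n := n'.+1.
Implicit Types (l m a : dual_space A) (w z : C) (i j : 'I_n) (k : nat).
Local Notation "''(' l , m )" := (dual_form l m) (format "''(' l ,  m )").
Local Notation bmax := (tnth b ord_max).

Let bgt0 i : 0 < '(tnth b i, tnth b i) := base_gt0 SP GE base i.
Let two0 : (2 : C) != 0. Proof. by rewrite pnatr_eq0. Qed.

Definition has_cartan (cm : nat -> nat -> int) :=
  forall i j, 2 * '(tnth b i, tnth b j) = (cm i j)%:~R * '(tnth b i, tnth b i).

Lemma B_entry i j : cartan_entry (TypeB n) i j =
  (i == j)%:R * 2 - (i == j.+1 :> nat)%:R * (if i == ord_max then 2 else 1) - (j == i.+1 :> nat)%:R.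
Proof.
have -> : (i == ord_max) = (i.+1 == n) by [].
rewrite /cartan_entry -[i == j]/(i == j :> nat).
have [->|ij] := eqVneq (i : nat) j; first by rewrite (ltn_eqF (leqnn j.+1)) /= mul0r !subr0 mul1r.
have [->|ij'] := eqVneq (i : nat) j.+1; last by rewrite andbF /= !mul0r; case: (j == i.+1 :> nat).
by rewrite andbT [j == _ :> nat]ltn_eqF ?leqnSn //= !mul0r !mul1r; case: (_ == n).
Qed.

Lemma C_entry i j : cartan_entry (TypeC n) i j =
  (i == j)%:R * 2 - (i == j.+1 :> nat)%:R - (j == i.+1 :> nat)%:R * (if j == ord_max then 2 else 1).
Proof.
have -> : (j == ord_max) = (j.+1 == n) by [].
rewrite /cartan_entry -[i == j]/(i == j :> nat).
have [->|ij] := eqVneq (i : nat) j; first by rewrite (ltn_eqF (leqnn j.+1)) /= mul0r !subr0 mul1r.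
have [->|ij'] := eqVneq (j : nat) i.+1; last by rewrite andbF orbF /= !mul0r; case: (i == j.+1 :> nat).
by rewrite andbT orbT [i == _ :> nat]ltn_eqF ?leqnSn //= !mul0r !mul1r; case: (_ == n).
Qed.

Lemma B_length : has_cartan (cartan_entry (TypeB n)) -> forall i,
  '(tnth b i, tnth b i) = (if i == ord_max then 1 else 2) * '(bmax, bmax).
Proof.
move=> cartan i.
have H k : (k <= n')%N -> forall kn : (k < n)%N,
    '(tnth b (Ordinal kn), tnth b (Ordinal kn)) = (if k == n' then 1 else 2) * '(bmax, bmax).
  move: k; apply: frame_ind => [kn|k kn IH kn1].
    by rewrite eqxx mul1r; have -> : Ordinal kn = ord_max by exact: val_inj.
  have kn2 : (k.+1 < n)%N by [].
  rewrite [k == n']ltn_eqF //; move: (IH kn2).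
  have := cartan (Ordinal kn1) (Ordinal kn2); have := cartan (Ordinal kn2) (Ordinal kn1).
  rewrite (dual_formC SP) => -> /eqP; rewrite !B_entry /= -!val_eqE /= !eqxx.
  rewrite [k == k.+1]ltn_eqF // [k == k.+2]ltn_eqF; last by lia.
  rewrite [k.+1 == k]gtn_eqF // [k == n']ltn_eqF //.
  rewrite !mul0r !mul1r !subr0 !sub0r !mulN1r !mulrNz !mulNr eqr_opp.
  by case: (k.+1 == n') => /eqP E1 E2; move: E1; rewrite E2 !mul1r => <-.
by case: i => i ilt; exact: H.
Qed.

Lemma C_length : has_cartan (cartan_entry (TypeC n)) -> (0 < n')%N -> forall i,
  '(tnth b i, tnth b i) = (if i == ord_max then 1 else 2^-1) * '(bmax, bmax).
Proof.
move=> cartan n0 i.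
have H k : (k <= n')%N -> forall kn : (k < n)%N,
    '(tnth b (Ordinal kn), tnth b (Ordinal kn)) = (if k == n' then 1 else 2^-1) * '(bmax, bmax).
  move: k; apply: frame_ind => [kn|k kn IH kn1].
    by rewrite eqxx mul1r; have -> : Ordinal kn = ord_max by exact: val_inj.
  have kn2 : (k.+1 < n)%N by [].
  rewrite [k == n']ltn_eqF //; move: (IH kn2).
  have := cartan (Ordinal kn1) (Ordinal kn2); have := cartan (Ordinal kn2) (Ordinal kn1).
  rewrite (dual_formC SP) => -> /eqP; rewrite !C_entry /= -!val_eqE /= !eqxx.
  rewrite [k == k.+1]ltn_eqF // [k == k.+2]ltn_eqF; last by lia.
  rewrite [k.+1 == k]gtn_eqF //.
  rewrite !mul0r !mul1r !subr0 !sub0r !mulrNz !mulNr eqr_opp.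
  by case: (k.+1 == n') => /eqP E1 E2; move: E1; rewrite E2 !mul1r // => ->; field.
by case: i => i ilt; exact: H.
Qed.

Lemma B_gram : has_cartan (cartan_entry (TypeB n)) -> forall i j,
  (1 : C) * 1 * '(tnth b i, tnth b j) = '(bmax, bmax) *
  ((i == j)%:R * (if i == ord_max then 1 else 2) - (i == j.+1 :> nat)%:R - (j == i.+1 :> nat)%:R).
Proof.
move=> cartan i j; apply: (mulfI two0); rewrite !mul1r cartan B_entry B_length //.
have [->|im] := eqVneq i ord_max.
  have -> : (j == (ord_max : 'I_n).+1 :> nat) = false by rewrite ltn_eqF //= ltnS -ltnS.
  rewrite !subr0; case: (ord_max == j); case: (_ == j.+1); rewrite ?mul1r ?mul0r ?subr0 ?sub0r /=; ring.
by do 3!case: eqP => _; rewrite ?mul1r ?mul0r ?subr0 ?sub0r /=; ring.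
Qed.

Let cC i : C := if i == ord_max then 2^-1 else 1.

Lemma C_gram : has_cartan (cartan_entry (TypeC n)) -> (0 < n')%N -> forall i j,
  cC i * cC j * '(tnth b i, tnth b j) = ('(bmax, bmax) / 4) *
  ((i == j)%:R * (if i == ord_max then 1 else 2) - (i == j.+1 :> nat)%:R - (j == i.+1 :> nat)%:R).
Proof.
move=> cartan n0 i j; apply: (mulfI two0); rewrite mulrCA cartan C_entry C_length // /cC.
have [->|im] := eqVneq i ord_max.
  have -> : (j == (ord_max : 'I_n).+1 :> nat) = false by rewrite ltn_eqF //= ltnS -ltnS.
  rewrite (eq_sym ord_max j); have [->|jm] := eqVneq j ord_max.
    by rewrite [_ == _.+1]ltn_eqF //=; field.
  by case: (_ == j.+1); rewrite ?mul1r ?mul0r ?subr0 ?sub0r /=; field.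
have [->|jm] := eqVneq j ord_max.
  rewrite (negPf im) (ltn_eqF (ltn_ord i : (i < (ord_max : 'I_n).+1)%N)).
  by case: (_ == i.+1); rewrite ?mul1r ?mul0r ?subr0 ?sub0r /=; field.
by do 3!case: eqP => _; rewrite ?mul1r ?mul0r ?subr0 ?sub0r /=; field.
Qed.

End TypesBC.

Lemma int_quotient (C : numClosedFieldType) (k n : nat) (r : int) :
  (0 < n)%N -> k%:R / n%:R = r%:~R :> C -> (n %| k)%N.
Proof.
move=> n0 E; have : k%:Z = r * n%:Z.
  by apply: (@intr_inj C); rewrite intrM -E -!pmulrn divfK // pnatr_eq0 -lt0n.
case: r {E} => r; last by rewrite NegzE => E; exfalso; nia.
by rewrite -PoszM => -[->]; exact: dvdn_mull.
Qed.

(** * Dominant weights in type B *)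

Section ShortB.
Context (C : numClosedFieldType) (L : finLieAlgType C).
Context (s : 'End(L)) (t : nat) (G A : {vspace L}) (SP : split_pair s t A).
Context (GE : forall x, (x \in G) = (s x == x)).
Context (n' : nat) (b : (n'.+1).-tuple (dual_space A)) (base : root_base G b).
Local Notation n := n'.+1.
Implicit Types (l m a : dual_space A) (w z : C) (i j : 'I_n) (k : nat).
Local Notation wt := (is_weight s).
Local Notation "''(' l , m )" := (dual_form l m) (format "''(' l ,  m )").
Local Notation bmax := (tnth b ord_max).
Local Notation K := '(bmax, bmax).

Let bgt0 i : 0 < '(tnth b i, tnth b i) := base_gt0 SP GE base i.
Let bi0 i : '(tnth b i, tnth b i) != 0.
Proof. by rewrite gt_eqF // bgt0. Qed.
Let bw := base_wt SP GE base.
Let b0 := base_neq0 SP GE base.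

Context (n0 : (0 < n')%N) (cartan : has_cartan b (cartan_entry (TypeB n))).
Context (z : C) (z1 : z != 1) (z2 : z ^+ 2 = 1).
Context (Eb : forall i, i != ord_max -> extremal_root s (tnth b i)).
Context (special : n = 4 -> forall l, wt l z -> ~ coords b l [:: 0; 0; 0; 1]).

Let gram := B_gram SP cartan.
Let one0 (i : 'I_n) : (1 : C) != 0. Proof. exact: oner_neq0. Qed.
Let E := frame b (fun=> 1).
Let K0 : 0 < K := bgt0 ord_max.
Let two0 : (2 : C) != 0. Proof. by rewrite pnatr_eq0. Qed.

Let Estep i : E i = tnth b i + E i.+1.
Proof. by rewrite /E frame_step scale1r. Qed.

Let Emax : E n' = bmax.
Proof. by rewrite (Estep ord_max) /E frame_end // addr0. Qed.

Let E_root k : (k <= n')%N -> wt (E k) 1 /\ '(E k, E k) = K.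
Proof.
move=> kn; split; last first.
  by rewrite (frame_orth SP K0 gram (Ordinal (kn : (k < n)%N))) eqxx mulr1.
apply: (frame_conj SP GE base K0 one0 gram (Q := fun l => wt l 1)) => // [i l|].
  exact: (wt_refl SP (bw i) (b0 i)).
by rewrite -/E Emax; exact: bw.
Qed.

Let pen : 'I_n := inord n'.-1.
Let penE : pen = n'.-1 :> nat. Proof. by rewrite inordK //; lia. Qed.
Let pen_max : pen != ord_max. Proof. by rewrite -val_eqE /= penE; lia. Qed.
Let penb : E n'.-1 - E n' = tnth b pen.
Proof. by rewrite -penE Estep penE prednK // addrK. Qed.

Let E_pair k k' : (k < k')%N -> (k' <= n')%N -> wt (E k + E k') 1.
Proof.
apply: (frame_conj2 SP GE base K0 one0 gram (Q := fun l => wt l 1)) => // [i l|].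
  exact: (wt_refl SP (bw i) (b0 i)).
by rewrite -/E penb; exact: bw.
Qed.

(** The sum of two frame vectors is conjugate to the long simple root [tnth b pen], where
    [extremal_coord] applies. *)
Let pair_bound k k' l : wt l z -> (k < k')%N -> (k' <= n')%N -> '(E k, l) + '(E k', l) <= K.
Proof.
move=> wl kk' k'n; rewrite -(dual_formDl SP); move: l wl.
apply: (frame_conj2 SP GE base K0 one0 gram (Q := fun x => forall l, wt l z -> '(x, l) <= K)) => //.
  move=> i x IH l wl; rewrite (root_reflE SP) //; apply: IH.
  exact: (wt_refl SP (bw i) (b0 i)).
move=> l wl; rewrite -/E penb; have [c lc] := coords_exist SP GE base wl.
have := extremal_coord SP GE base z1 (Eb pen_max) wl lc; rewrite -(ler_int C) => c1.
have := lc.2 pen; rewrite (B_length SP cartan) (negPf pen_max) => /eqP.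
rewrite mulrCA -subr_eq0 -mulrBr mulf_eq0 pnatr_eq0 /= subr_eq0 => /eqP ->.
by rewrite ger_pMl.
Qed.

(** [Y] doubles the orthogonal coordinates, so that it is integral on spin weights as well. *)
Let frame_coords l c : coords b l c -> exists Y : nat -> int,
  [/\ forall k, (k <= n')%N -> 2 * '(E k, l) = (Y k)%:~R * K,
      forall k, (k < n')%N -> Y k = 2 * nth 0 c k + Y k.+1 & Y n' = nth 0 c n'].
Proof.
move=> lc; pose Y k := \sum_(k <= j < n') 2 * nth 0 c j + nth 0 c n'.
have YS k : (k < n')%N -> Y k = 2 * nth 0 c k + Y k.+1.
  by move=> kn; rewrite /Y big_ltn // addrA.
have Yn : Y n' = nth 0 c n' by rewrite /Y big_geq // add0r.
clearbody Y; exists Y; split=> //; apply: frame_ind => [|k kn IH].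
  by rewrite Emax Yn (lc.2 ord_max).
have kn1 : (k < n)%N by apply: ltnW.
have km : Ordinal kn1 != ord_max by rewrite -val_eqE /= ltn_eqF.
rewrite -[k]/(Ordinal kn1 : nat) Estep (dual_formDl SP) mulrDr IH (lc.2 (Ordinal kn1)) /=.
rewrite (B_length SP cartan) (negPf km) (YS k kn) intrD intrM; ring.
Qed.

(** The [Y k] are nonnegative, weakly decreasing, congruent modulo 2, and the first two add up to at
    most 2. They are therefore 2, 0, ..., 0, which is a short root, or all 1, which is the spin
    weight. *)
Lemma B_short l : wt l z -> l != 0 -> root_of_norm s K l.
Proof.
move: l; apply: (dominant_ind SP GE base) => [i l _ _|l wl l0 dl].
  exact: (root_of_norm_refl SP GE base).
have [c lc] := coords_exist SP GE base wl.
have cpos := dominant_coords SP GE base dl lc.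
have [Y [YE YS Yn]] := frame_coords lc.
have Y0 : forall k, (k <= n')%N -> 0 <= Y k /\ exists e, Y k = Y n' + 2 * e.
  apply: frame_ind => [|k kn [Y1 [e Ye]]].
    by rewrite Yn; split; [exact: cpos|exists 0; rewrite mulr0 addr0].
  rewrite YS //; split; first by rewrite addr_ge0 // mulr_ge0 // cpos.
  by exists (e + nth 0 c k); rewrite Ye; ring.
have Yle k : (k < n')%N -> Y k.+1 <= Y k.
  by move=> kn; rewrite (YS k kn) lerDr; apply: mulr_ge0 => //; exact: cpos.
have Y1 k : (1 <= k <= n')%N -> Y k <= Y 1%N.
  elim: k => // -[|k] IH /andP[_ kn] //; exact: le_trans (Yle _ kn) (IH (ltnW kn)).
have Y01 := Yle _ n0.
have Y2 : Y 0%N + Y 1%N <= 2.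
  have := pair_bound wl (ltn0Sn 0) n0.
  rewrite -(ler_pM2l (_ : 0 < 2)) ?ltr0n // mulrDr !YE // -mulrDl ler_pM2r // -intrD.
  by rewrite -[2]/((2 : int)%:~R) ler_int.
have Z (v : dual_space A) : (forall k, (k <= n')%N -> '(E k, v) = (Y k)%:~R * K / 2) -> v = l.
  move=> H; apply: (frame_inj SP base one0) => i.
  have ilt : (i <= n')%N by rewrite -ltnS.
  by rewrite (H i ilt) -(YE i ilt) mulrC mulKf.
have [Yp|Yz] : 0 < Y 1%N \/ Y 1%N = 0.
- have := (Y0 _ n0).1; rewrite le_eqVlt => /orP[/eqP <-|->]; by [right|left].
- have Yall k : (k <= n')%N -> Y k = 1.
    move=> kn; have [k0|k0] := posnP k; first by subst k; clear - Yp Y01 Y2; lia.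
    have [Yk [e Ye]] := Y0 k kn; have [_ [e1 Ye1]] := Y0 _ n0.
    have := Y1 k; rewrite k0 kn => /(_ isT) Yk1.
    by clear - Yp Y01 Y2 Yk Ye Yk1 Ye1; lia.
  have lE : l = 2^-1 *: \sum_(j < n) E j.
    apply/esym/Z => k kn; rewrite dual_formZr dual_form_sumr (bigD1 (Ordinal (kn : (k < n)%N))) //=.
    rewrite Yall // mul1r mulrC big1 ?addr0.
      by rewrite (E_root kn).2.
    move=> j jk; rewrite -[k]/(Ordinal (kn : (k < n)%N) : nat) (frame_orth SP K0 gram) /=.
    by rewrite eq_sym -val_eqE /= in jk; rewrite (negPf jk) mulr0.
  have lE0 : '(l, E 0%N) = K / 2.
    by rewrite (dual_formC SP) -[LHS](mulKf two0) YE // Yall // mul1r mulrC.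
  have ll : '(l, l) = n%:R * K / 4.
    rewrite {2}lE dual_formZr dual_form_sumr (eq_bigr (fun=> K / 2)) => [|j _].
      by rewrite sumr_const card_ord -mulr_natl; field.
    have jn : (j <= n')%N by rewrite -ltnS.
    by rewrite (dual_formC SP) -[LHS](mulKf two0) (YE j jn) (Yall j jn) mul1r mulrC.
  (* The spin weight has square length n K / 4, and its pairing with [E 0] is 4 / n, so n is 2 or 4.
     For n = 2 twice the weight would be a root with eigenvalue 1, against [wt_double]. *)
  have [r rE] := wt_int SP wl l0 (E_root (leq0n n')).1.
  have n4 : (n %| 4)%N.
    apply: (@int_quotient C 4 n r) => //; rewrite -rE lE0 ll.
    have N0 : (n%:R : C) != 0 by rewrite pnatr_eq0.
    by move: (n%:R : C) N0 => N N0; field; rewrite bi0 N0.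
  have [nE|nE] : n = 2 \/ n = 4.
    by move: n4 n0; rewrite dvdn_divisors // !inE => /or3P[] /eqP [->]; [|left|right].
  + case/negP: (wt_double SP wl l0); rewrite z2.
    have -> : l *+ 2 = E 0%N + E 1%N.
      rewrite lE -scaler_nat scalerA mulfV // scale1r; move: nE => [n1].
      rewrite (bigD1 (Ordinal (isT : (0 < n)%N))) //=; congr (_ + _).
      rewrite (bigD1 (Ordinal (n0 : (1 < n)%N))) //= big1 ?addr0 // => j /andP[].
      rewrite -!val_eqE /=; move: (ltn_ord j); clear -n1; move: (j : nat) => k; lia.
    exact: E_pair.
  + case: (special nE wl); move: nE (lc) => [n3] [sc _].
    suff -> : [:: 0; 0; 0; 1] = c by [].
    apply: (@eq_from_nth _ 0); first by rewrite sc n3.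
    have c0 k : (k < n')%N -> nth 0 c k = 0.
      move=> kn; have := YS k kn; rewrite !Yall //; last exact: ltnW.
      by clear; lia.
    have cn : nth 0 c n' = 1 by rewrite -Yn Yall.
    by rewrite n3 in c0 cn; case=> [|[|[|[|]]]] //= _; rewrite ?c0 ?cn.
have Yn0 : Y n' = 0.
  by apply/eqP; rewrite eq_le (Y0 n' _).1 // andbT -Yz; apply: Y1; rewrite n0 leqnn.
have Ynz k : (0 < k)%N -> (k <= n')%N -> Y k = 0.
  move=> k0 kn; apply/eqP; rewrite eq_le (Y0 k kn).1 // andbT -Yz; apply: Y1.
  by rewrite k0.
have Y02 : Y 0%N = 2.
  have [Y00 [e Ye]] := Y0 0%N (leq0n _).
  have Ynz0 : Y 0%N != 0.
    apply: contra l0 => /eqP Y00'; rewrite -(Z 0) // => k kn; rewrite dual_form0r.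
    by have [->|k0] := posnP k; rewrite ?Y00' ?Ynz // !mul0r.
  by clear -Y00 Ye Ynz0 Y2 Yn0 Yz; lia.
have <- : E 0%N = l.
  apply: Z => k kn; rewrite (dual_formC SP) (frame_orth SP K0 gram ord0) /=.
  have [->|k0] := posnP k; first by rewrite Y02 mulr1 -[_%:~R]/(2 : C) [RHS]mulrC mulKf.
  by rewrite Ynz // ltn_eqF // mulr0 !mul0r.
exact: (E_root (leq0n n')).
Qed.

End ShortB.

(** * Dominant weights in type C *)

Section ShortC.
Context (C : numClosedFieldType) (L : finLieAlgType C).
Context (s : 'End(L)) (t : nat) (G A : {vspace L}) (SP : split_pair s t A).
Context (GE : forall x, (x \in G) = (s x == x)).
Context (n' : nat) (b : (n'.+1).-tuple (dual_space A)) (base : root_base G b).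
Local Notation n := n'.+1.
Implicit Types (l m a : dual_space A) (w z : C) (i j : 'I_n) (k : nat).
Local Notation wt := (is_weight s).
Local Notation "''(' l , m )" := (dual_form l m) (format "''(' l ,  m )").
Local Notation bmax := (tnth b ord_max).
Local Notation K := ('(bmax, bmax) / 4).

Let bgt0 i : 0 < '(tnth b i, tnth b i) := base_gt0 SP GE base i.
Let bi0 i : '(tnth b i, tnth b i) != 0.
Proof. by rewrite gt_eqF // bgt0. Qed.
Let bw := base_wt SP GE base.
Let b0 := base_neq0 SP GE base.

Context (n0 : (0 < n')%N) (cartan : has_cartan b (cartan_entry (TypeC n))).
Context (z : C) (z1 : z != 1) (z2 : z ^+ 2 = 1) (Eb : extremal_root s bmax).
Context (special : n = 4 -> forall l, wt l z -> ~ coords b l [:: 0; 0; 0; 1]).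

Let two0 : (2 : C) != 0. Proof. by rewrite pnatr_eq0. Qed.
Let cC i : C := if i == ord_max then 2^-1 else 1.
Let gram := C_gram SP cartan n0.
Let cC0 (i : 'I_n) : cC i != 0.
Proof. by rewrite /cC; case: ifP; rewrite ?invr_eq0 ?oner_neq0 ?two0. Qed.
Let E := frame b cC.
Let K0 : 0 < K. Proof. by rewrite divr_gt0 ?ltr0n // bgt0. Qed.

Let Estep i : i != ord_max -> E i = tnth b i + E i.+1.
Proof. by move=> im; rewrite /E frame_step /cC (negPf im) scale1r. Qed.

Let Emax : E n' = 2^-1 *: bmax.
Proof. by rewrite /E -[n']/(ord_max : nat) frame_step frame_end // addr0 /cC eqxx. Qed.

Let E_norm k : (k <= n')%N -> '(E k, E k) = K.
Proof. by move=> kn; rewrite (frame_orth SP K0 gram (Ordinal (kn : (k < n)%N))) eqxx mulr1. Qed.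

Let reflZ i (c : C) (l : dual_space A) : root_refl (tnth b i) (c *: l) = c *: root_refl (tnth b i) l.
Proof. by rewrite /root_refl dual_formZr scalerBr scalerA (mulrCA 2 c) -(mulrA c). Qed.

Let E_double k : (k <= n')%N -> wt (2 *: E k) 1.
Proof.
apply: (frame_conj SP GE base K0 cC0 gram (Q := fun l => wt (2 *: l) 1)) => // [i l|].
  by rewrite -reflZ; exact: (wt_refl SP (bw i) (b0 i)).
by rewrite -/E Emax scalerA mulfV // scale1r; exact: bw.
Qed.

Let pen : 'I_n := inord n'.-1.
Let penE : pen = n'.-1 :> nat. Proof. by rewrite inordK //; lia. Qed.
Let pen_max : pen != ord_max. Proof. by rewrite -val_eqE /= penE; lia. Qed.
Let penb : E n'.-1 - E n' = tnth b pen.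
Proof. by rewrite -penE (Estep pen_max) penE prednK // addrK. Qed.

Let E_pair k k' : (k < k')%N -> (k' <= n')%N -> wt (E k + E k') 1.
Proof.
apply: (frame_conj2 SP GE base K0 cC0 gram (Q := fun l => wt l 1)) => // [i l|].
  exact: (wt_refl SP (bw i) (b0 i)).
by rewrite -/E penb; exact: bw.
Qed.

(** The vector 2 E_k is conjugate to the long simple root, where [extremal_coord] applies. *)
Let E_bound k l : wt l z -> (k <= n')%N -> '(E k, l) <= K.
Proof.
move=> wl kn; move: l wl.
apply: (frame_conj SP GE base K0 cC0 gram (Q := fun x => forall l, wt l z -> '(x, l) <= K)) kn => //.
  move=> i x IH l wl; rewrite (root_reflE SP) //; apply: IH.
  exact: (wt_refl SP (bw i) (b0 i)).
move=> l wl; rewrite -/E Emax; have [c lc] := coords_exist SP GE base wl.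
have := extremal_coord SP GE base z1 Eb wl lc; rewrite -(ler_int C) => c1.
rewrite (dual_formZl SP bmax (2^-1)) -(ler_pM2l (_ : 0 < 4)) ?ltr0n //.
have -> : 4 * (2^-1 * '(bmax, l)) = 2 * '(bmax, l) by field.
have -> : 4 * ('(bmax, bmax) / 4) = '(bmax, bmax) by field.
by rewrite (lc.2 ord_max) ger_pMl.
Qed.

Let frame_coords l c : coords b l c -> exists Y : nat -> int,
  [/\ forall k, (k <= n')%N -> '(E k, l) = (Y k)%:~R * K,
      forall k, (k < n')%N -> Y k = nth 0 c k + Y k.+1 & Y n' = nth 0 c n'].
Proof.
move=> lc; pose Y k := \sum_(k <= j < n') nth 0 c j + nth 0 c n'.
have YS k : (k < n')%N -> Y k = nth 0 c k + Y k.+1.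
  by move=> kn; rewrite /Y big_ltn // addrA.
have Yn : Y n' = nth 0 c n' by rewrite /Y big_geq // add0r.
clearbody Y; exists Y; split=> //; apply: frame_ind => [|k kn IH].
  rewrite Emax (dual_formZl SP bmax (2^-1)) Yn; apply: (mulfI two0).
  by rewrite mulrCA (lc.2 ord_max) /=; field.
have kn1 : (k < n)%N by apply: ltnW.
have km : Ordinal kn1 != ord_max by rewrite -val_eqE /= ltn_eqF.
rewrite -[k]/(Ordinal kn1 : nat) (Estep km) (dual_formDl SP) IH; apply: (mulfI two0).
rewrite mulrDr (lc.2 (Ordinal kn1)) /=.
by rewrite (C_length SP cartan) // (negPf km) (YS k kn) intrD; field.
Qed.

(** The coordinates are 0 or 1 and weakly decreasing, so [l] is the sum of the first [k0] frame
    vectors. For k0 = 1 twice [l] would be a root, and k0 = 2 is a short root. Beyond that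
    integrality decides: the pairing is 2 / k0 with E_0 + E_n' when k0 < n, and 4 / k0 with 2 E_0
    when k0 = n, which leaves n = 4. *)
Lemma C_short l : wt l z -> l != 0 -> root_of_norm s (2 * K) l.
Proof.
move: l; apply: (dominant_ind SP GE base) => [i l _ _|l wl l0 dl].
  exact: (root_of_norm_refl SP GE base).
have [c lc] := coords_exist SP GE base wl.
have cpos := dominant_coords SP GE base dl lc.
have [Y [YE YS Yn]] := frame_coords lc.
have Y0 : forall k, (k <= n')%N -> 0 <= Y k.
  apply: frame_ind => [|k kn Y1]; first by rewrite Yn; exact: cpos.
  by rewrite (YS k kn) addr_ge0.
have Y1 k : (k <= n')%N -> Y k <= 1.
  by move=> kn; have := E_bound wl kn; rewrite YE // ger_pMl // -[1]/((1 : int)%:~R) ler_int.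
have Yle k : (k < n')%N -> Y k.+1 <= Y k.
  by move=> kn; rewrite (YS k kn) lerDr; exact: cpos.
have [k0 k0n Yk] : exists2 k0, (k0 <= n)%N & forall k, (k <= n')%N -> Y k = (k < k0)%N%:Z.
  have [k0 k0n H] : exists2 k0, (k0 <= n)%N & forall k, (k <= n')%N -> (Y k == 1) = (k < k0)%N.
    have : exists k, (k == n) || (Y k != 1) by exists n; rewrite eqxx.
    move/ex_minnP => [k0 k0P kmin]; exists k0; first by apply: kmin; rewrite eqxx.
    move=> k kn; have [kk0|k0k] := ltnP k k0.
      by apply/negPn/negP => Yk; have := kmin k; rewrite Yk orbT => /(_ isT); rewrite leqNgt kk0.
    have k0n' : (k0 <= n')%N := leq_trans k0k kn.
    move: k0P; rewrite (ltn_eqF (k0n' : (k0 < n)%N)) /= => Yk0.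
    have Ym : Y k <= Y k0.
      elim: k k0k kn => [|k IH] k0k kn; first by move: k0k; rewrite leqn0 => /eqP ->.
      move: k0k; rewrite leq_eqVlt => /orP[/eqP -> //|k0k].
      exact: le_trans (Yle _ kn) (IH k0k (ltnW kn)).
    by have := Y1 _ k0n'; clear -Ym Yk0; lia.
  exists k0 => // k kn; rewrite -H //; have := Y0 _ kn; have := Y1 _ kn.
  by case: eqP => [->//|]; clear; lia.
have Z (v : dual_space A) : (forall k, (k <= n')%N -> '(E k, v) = (k < k0)%N%:R * K) -> v = l.
  move=> H; apply: (frame_inj SP base cC0) => i.
  have ilt : (i <= n')%N by rewrite -ltnS.
  by rewrite (H i ilt) (YE i ilt) Yk.
have Esum k1 : (k1 <= n)%N -> forall k, (k <= n')%N ->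
    '(E k, \sum_(j < n | (j < k1)%N) E j) = (k < k1)%N%:R * K.
  move=> k1n k kn; rewrite -big_filter dual_form_sumr big_filter.
  under eq_bigr do rewrite (frame_orth SP K0 gram (Ordinal (kn : (k < n)%N))) /=.
  have [kk1|k1k] := ltnP k k1; last first.
    rewrite mul0r big1 // => j jk1; rewrite gtn_eqF ?mulr0 //.
    exact: leq_trans k1k.
  rewrite (bigD1 (Ordinal (kn : (k < n)%N))) //= eqxx mulr1 mul1r big1 ?addr0 // => j /andP[_ jk].
  by rewrite -val_eqE /= eq_sym in jk; rewrite (negPf jk) mulr0.
have lE : l = \sum_(j < n | (j < k0)%N) E j by apply/esym/Z; exact: Esum.
have lE0 k : (k <= n')%N -> '(l, E k) = (k < k0)%N%:R * K.
  by move=> kn; rewrite (dual_formC SP) YE // Yk.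
have ll : '(l, l) = k0%:R * K.
  rewrite {2}lE -big_filter dual_form_sumr big_filter (eq_bigr (fun=> K)) => [|j jk0].
    by rewrite -(big_ord_widen _ (fun=> K) k0n) sumr_const card_ord mulr_natl.
  have jn : (j <= n')%N by rewrite -ltnS.
  by rewrite (lE0 j jn) jk0 mul1r.
have integral a : wt a 1 -> exists r : int, 2 * '(l, a) / '(l, l) = r%:~R.
  by move=> wa; exact: (wt_int SP wl l0 wa).
have k00 : (0 < k0)%N.
  by rewrite lt0n; apply: contra l0 => /eqP k00; rewrite lE big1 // => j; rewrite k00.
have [k1|k1] := ltnP 1 k0; last first.
  have k0E : k0 = 1%N by lia.
  case/negP: (wt_double SP wl l0); rewrite z2 lE k0E (bigD1 ord0) //= big1 ?addr0.
    by rewrite -scaler_nat; exact: E_double.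
  by move=> j /andP[]; rewrite -val_eqE /=; move: (j : nat) => m; clear; lia.
have [k2|k2] := eqVneq k0 2%N.
  have n1 : (1 < n)%N := n0.
  have -> : l = E 0%N + E 1%N.
    rewrite lE k2 (bigD1 ord0) //= (bigD1 (Ordinal n1)) //= big1 ?addr0 // => j.
    by rewrite -!val_eqE /=; move: (j : nat) => m; clear; lia.
  have wE : wt (E 0%N + E 1%N) 1 by exact: E_pair.
  split=> //; rewrite !(dual_formDl SP) !dual_formDr !E_norm //.
  have e0 : '(E 0%N, E 1%N) = 0 by rewrite (frame_orth SP K0 gram ord0) mulr0.
  by rewrite (dual_formC SP (E 1%N)) e0; ring.
have k0nz : (k0%:R : C) != 0 by rewrite pnatr_eq0 -lt0n.
have [k0n'|nk0] := leqP k0 n'.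
  have [r rE] := integral _ (E_pair n0 (leqnn n')).
  have : (k0 %| 2)%N.
    apply: (@int_quotient C 2 k0 r) => //; rewrite -rE dual_formDr !lE0 // k00 ltnNge k0n' ll.
    by rewrite mul1r mul0r addr0; move: (k0%:R : C) k0nz => N N0; field; rewrite bi0 N0.
  by rewrite dvdn_divisors // !inE => /orP[] /eqP; clear -k1 k2; lia.
have k0E : k0 = n by apply/eqP; rewrite eqn_leq k0n nk0.
have [r rE] := integral _ (E_double (leq0n n')).
have n4 : (k0 %| 4)%N.
  apply: (@int_quotient C 4 k0 r) => //; rewrite -rE dual_formZr !lE0 // k00 ll.
  by rewrite mul1r; move: (k0%:R : C) k0nz => N N0; field; rewrite bi0 N0.
have nE : n = 4.
  by rewrite -k0E; move: n4 k1 k2; rewrite dvdn_divisors // !inE => /or3P[] /eqP ->.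
case: (special nE wl); move: (lc) => [sc _].
have Yall k : (k <= n')%N -> Y k = 1 by move=> kn; rewrite Yk // k0E ltnS kn.
suff -> : [:: 0; 0; 0; 1] = c by [].
apply: (@eq_from_nth _ 0); first by rewrite sc nE.
have c0 k : (k < n')%N -> nth 0 c k = 0.
  move=> kn; have := YS k kn; rewrite !Yall //; last exact: ltnW.
  by clear; lia.
have cn : nth 0 c n' = 1 by rewrite -Yn Yall.
move: nE => [n3]; rewrite n3 in c0 cn.
by case=> [|[|[|[|]]]] //= _; rewrite ?c0 ?cn.
Qed.

End ShortC.

(** * Root lengths and the weights outside the fixed algebra *)

Section RootLengths.
Context (C : numClosedFieldType) (L : finLieAlgType C).
Context (s : 'End(L)) (t : nat) (G A : {vspace L}) (SP : split_pair s t A).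
Context (GE : forall x, (x \in G) = (s x == x)).
Implicit Types (l m a : dual_space A) (w z : C).
Local Notation wt := (is_weight s).
Local Notation "''(' l , m )" := (dual_form l m) (format "''(' l ,  m )").

(** The last clause has two halves so that one nonzero weight for [z], supplied separately by
    [nonzero_weight], is a short root and brings all the others with it. *)
Definition two_lengths (Ns Nl : C) : Prop :=
  [/\ 0 < Ns < Nl, exists a : dual_space A, root_of_norm s Ns a,
      exists a : dual_space A, root_of_norm s Nl a,
      forall a, wt a 1 -> a != 0 -> '(a, a) = Ns \/ '(a, a) = Nl &
      forall z, z ^+ t = 1 -> z != 1 -> (forall l, wt l z -> l != 0 -> root_of_norm s Ns l) /\
        forall a, root_of_norm s Ns a -> wt a z -> forall a', root_of_norm s Ns a' -> wt a' z].

Section Base.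
Context (n : nat) (b : n.-tuple (dual_space A)) (base : root_base G b).
Implicit Types (i j : 'I_n).

Lemma two_lengthsP (sh : pred 'I_n) (Ns Nl : C) a0 :
  (forall i, '(tnth b i, tnth b i) = if sh i then Ns else Nl) -> Ns < Nl ->
  (forall Q : 'I_n -> Prop, (forall i j, linked b i j -> Q i -> Q j) ->
    forall i j, sh i = sh j -> Q i -> Q j) ->
  (exists i j, [/\ sh i, ~~ sh j &
    2 * '(tnth b i, tnth b j) <= - (2 * '(tnth b i, tnth b i))]) ->
  wt a0 1 -> a0 != 0 -> extremal_root s a0 ->
  ('(a0, a0) = Nl -> (forall j, ~~ sh j -> extremal_root s (tnth b j)) ->
    forall z, z ^+ t = 1 -> z != 1 -> forall l, wt l z -> l != 0 -> root_of_norm s Ns l) ->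
  two_lengths Ns '(a0, a0).
Proof.
move=> lens Nlt conn edge wa a00 Ea short.
have [aE Eb] := long_extremal SP GE base lens Nlt conn edge wa a00 Ea.
have [i [j [shi shj _]]] := edge; rewrite aE.
have lensP k (k0 : sh k) : '(tnth b k, tnth b k) = Ns by rewrite lens k0.
have Ns0 : 0 < Ns by rewrite -(lensP i shi); exact: (base_gt0 SP GE base).
split.
- by rewrite Ns0.
- by exists (tnth b i); split; [exact: (base_wt SP GE base) | exact: lensP].
- by exists (tnth b j); split; [exact: (base_wt SP GE base) | rewrite lens (negPf shj)].
- exact: (root_lengths SP GE base lens).
move=> z zt z1; split; first exact: (short aE Eb z zt z1).
have nz a : root_of_norm s Ns a -> a != 0.
  by move=> [_ aN]; apply: contraTneq Ns0 => a0E; rewrite -aN a0E dual_form0r ltxx.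
move=> a sa wz a' sa'; have [wa1 aN] := sa; have [wa1' aN'] := sa'.
by apply: (weight_all_short SP GE base lens Nlt conn wz (nz _ sa) wa1 aN wa1' (nz _ sa') aN').
Qed.

Lemma linked_entry (cm : nat -> nat -> int) i j :
  (forall i j, 2 * '(tnth b i, tnth b j) = (cm i j)%:~R * '(tnth b i, tnth b i)) ->
  cm i j = -1 -> '(tnth b i, tnth b i) = '(tnth b j, tnth b j) -> linked b i j.
Proof. by move=> cartan ij len; split=> //; rewrite cartan ij mulN1r. Qed.

End Base.

Lemma int_sumE (I : Type) (r : seq I) (F : I -> int) :
  \sum_(i <- r) F i = foldr (fun i x => F i + x) 0 r.
Proof. by elim: r => [|i r IH]; rewrite ?big_nil ?big_cons ?IH. Qed.

(** The two orbits contribute 28 + 8 for B_4 and 20 + 16 for C_4; in both cases [k] is the index of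
    a long simple root. *)
Lemma orbit_sums4 X k : (X, k) = (TypeB 4, 0%N) \/ (X, k) = (TypeC 4, 3) ->
  ~~ (\sum_(c <- weyl_orbit (cartan_entry X) 4 8
          [seq simple_coords (cartan_entry X) 4 j | j <- iota 0 4]) nth 0 c k ^+ 2 +
      \sum_(c <- weyl_orbit (cartan_entry X) 4 12 [:: [:: 0; 0; 0; 1]]) nth 0 c k ^+ 2 <= 32).
Proof. by move=> Xk; rewrite !int_sumE; case: Xk => -[-> ->]; vm_compute. Qed.

(* The Weyl orbits of the simple roots and of the last fundamental weight would contribute
   36 to the sum of squares 4 / (b_i, b_i). *)
Lemma special4 X (b : 4.-tuple (dual_space A)) (i : 'I_4) z l : root_base G b ->
  has_cartan b (cartan_entry X) -> (X, val i) = (TypeB 4, 0%N) \/ (X, val i) = (TypeC 4, 3) ->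
  4 / '(tnth b i, tnth b i) <= 32 -> z != 1 -> wt l z -> ~ coords b l [:: 0; 0; 0; 1].
Proof.
move=> base cartan Xi le32 z1 wl lc; set cm := cartan_entry X in cartan.
pose S := weyl_orbit cm 4 8 [seq simple_coords cm 4 k | k <- iota 0 4].
pose T := weyl_orbit cm 4 12 [:: [:: 0; 0; 0; 1]].
have HS c : c \in S -> exists2 l, wt l 1 & coords b l c.
  apply: (weyl_orbit_wt SP GE base cartan) => c' /mapP[k +->].
  rewrite mem_iota add0n => k4; exists (tnth b (Ordinal (k4 : (k < 4)%N))).
    exact: (base_wt SP GE base).
  exact: (coords_simple cartan (Ordinal (k4 : (k < 4)%N))).
have HT c : c \in T -> exists2 l, wt l z & coords b l c.
  by apply: (weyl_orbit_wt SP GE base cartan) => c' /[!inE] /eqP ->; exists l.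
have := norm_sum_lower SP GE base i z1 (undup_uniq _ : uniq S) (undup_uniq _ : uniq T) HS HT.
move=> /le_trans/(_ le32); rewrite -[32]/((32 : int)%:~R) ler_int.
by apply/negP; exact: orbit_sums4.
Qed.

End RootLengths.

(** * The four types of fixed algebras *)

Section FoldedTypes.
Context (C : numClosedFieldType) (L : finLieAlgType C).
Context (s : 'End(L)) (t : nat) (G A : {vspace L}) (SP : split_pair s t A).
Context (GE : forall x, (x \in G) = (s x == x)).
Implicit Types (l m a : dual_space A) (w z : C).
Local Notation wt := (is_weight s).
Local Notation "''(' l , m )" := (dual_form l m) (format "''(' l ,  m )").

Lemma has_cartan_matrixP X (b : (dynkin_rank X).-tuple (dual_space A)) : root_base G b ->
  has_cartan_matrix (cartan_matrix X) b ->
  forall i j, 2 * '(tnth b i, tnth b j) = (cartan_entry X i j)%:~R * '(tnth b i, tnth b i).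
Proof.
move=> base cartan i j; have := cartan i j; rewrite mxE => <-.
by rewrite divfK // gt_eqF // (base_gt0 SP GE base).
Qed.

Lemma edge_lengths n (b : n.-tuple (dual_space A)) (cm : nat -> nat -> int) :
  (forall i j, 2 * '(tnth b i, tnth b j) = (cm i j)%:~R * '(tnth b i, tnth b i)) ->
  forall i j : 'I_n, (cm i j)%:~R * '(tnth b i, tnth b i) = (cm j i)%:~R * '(tnth b j, tnth b j).
Proof. by move=> cartan i j; rewrite -!cartan (dual_formC SP). Qed.

Lemma chain_connected n' (b : n'.+1.-tuple (dual_space A)) (Q : 'I_n'.+1 -> Prop) :
  (forall i j, i != ord_max -> j != ord_max -> j = i.+1 :> nat -> linked b i j /\ linked b j i) ->
  (forall i j, linked b i j -> Q i -> Q j) ->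
  forall i j, (i == ord_max) = (j == ord_max) -> Q i -> Q j.
Proof.
move=> chain Qs i j; have [->|im] := eqVneq i ord_max.
  by move/esym/eqP ->.
move/esym/negbT => jm.
have H k (k1 : (k < n'.+1)%N) : Ordinal k1 != ord_max -> Q (Ordinal k1) <-> Q ord0.
  elim: k k1 => [|k IH] k1 km; first by rewrite (_ : Ordinal k1 = ord0) //; exact: val_inj.
  have km' : Ordinal (ltnW k1) != ord_max by rewrite -val_eqE /= ltn_eqF.
  have [l1 l2] := chain (Ordinal (ltnW k1)) (Ordinal k1) km' km erefl.
  by rewrite -(IH (ltnW k1) km'); split; exact: Qs.
by case: i j im jm => [i ilt] [j jlt] im jm; rewrite (H _ ilt im) (H _ jlt jm).
Qed.

Context (a0 : dual_space A) (wa : wt a0 1) (a00 : a0 != 0) (Ea : extremal_root s a0).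

Lemma TypeB_two_lengths n' (b : n'.+1.-tuple (dual_space A)) : (0 < n')%N -> root_base G b ->
  has_cartan b (cartan_entry (TypeB n'.+1)) -> t = 2 -> (n'.+1 = 4 -> 4 / '(a0, a0) <= 32) ->
  exists Ns, two_lengths s t A Ns '(a0, a0).
Proof.
move=> n0 base cartan tE le32; pose K := '(tnth b ord_max, tnth b ord_max).
have K0 : 0 < K by exact: (base_gt0 SP GE base).
have len := B_length SP cartan.
exists K; apply: (two_lengthsP SP GE base (sh := fun i => i == ord_max) (Nl := 2 * K)) => //.
- by move=> i; rewrite len; case: ifP; rewrite ?mul1r.
- by rewrite ltr_pMl // ltr1n.
- move=> Q; apply: chain_connected => i j im jm ji;
  have ij : (i == j) = false by rewrite -val_eqE /= ji ltn_eqF.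
  have ij2 : (i == j.+1 :> nat) = false by rewrite ji ltn_eqF // ltnW.
  have ji2 : (j == i.+1 :> nat) by rewrite ji.
  have lenE : '(tnth b i, tnth b i) = '(tnth b j, tnth b j) by rewrite (len i) (len j) (negPf im) (negPf jm).
  split; first by apply: (linked_entry cartan _ lenE); rewrite B_entry (negPf im) ij ij2 ji2.
  by apply: (linked_entry cartan _ (esym lenE)); rewrite B_entry (negPf jm) eq_sym ij ij2 ji2.
- have penE : (inord n'.-1 : 'I_n'.+1) = n'.-1 :> nat by rewrite inordK // ltnS leq_pred.
  exists ord_max, (inord n'.-1); rewrite eqxx -!val_eqE /= penE; split=> //; first by lia.
  rewrite cartan B_entry -!val_eqE /= penE eqxx prednK // eqxx.
  rewrite [n' == n'.-1]gtn_eqF ?[n'.-1 == n'.+1]ltn_eqF; try lia.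
  by rewrite mul0r mul1r sub0r subr0 mulrNz mulNr.
move=> aE Eb z; rewrite {1}tE => z2 z1 l; apply: (B_short SP GE base n0 cartan z1 z2 Eb).
move=> n4 l' wl'; have n3 : n' = 3 by case: n4.
(* The root b_0 is long, so its square length is that of [a0], for which [le32] is available. *)
subst n'; apply: (special4 SP GE (i := ord0) base cartan _ _ z1 wl'); first by left.
by rewrite len /= -[tnth b ord_max]/(tnth b ord_max) -aE; exact: le32.
Qed.

Lemma TypeC_two_lengths n' (b : n'.+1.-tuple (dual_space A)) : (0 < n')%N -> root_base G b ->
  has_cartan b (cartan_entry (TypeC n'.+1)) -> t = 2 -> (n'.+1 = 4 -> 4 / '(a0, a0) <= 32) ->
  exists Ns, two_lengths s t A Ns '(a0, a0).
Proof.
move=> n0 base cartan tE le32; pose K := '(tnth b ord_max, tnth b ord_max).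
have K0 : 0 < K by exact: (base_gt0 SP GE base).
have len := C_length SP cartan n0.
have penE : (inord n'.-1 : 'I_n'.+1) = n'.-1 :> nat by rewrite inordK // ltnS leq_pred.
exists (2^-1 * K); apply: (two_lengthsP SP GE base (sh := fun i => i != ord_max) (Nl := K)) => //.
- by move=> i; rewrite len; case: eqP; rewrite ?mul1r.
- by rewrite gtr_pMl // invf_lt1 ?ltr1n // ltr0n.
- move=> Q Qs i j ij; apply: (chain_connected _ Qs); last exact: (can_inj negbK).
  move: i j {ij} => _ _ i j im jm ji;
  have ij : (i == j) = false by rewrite -val_eqE /= ji ltn_eqF.
  have ij2 : (i == j.+1 :> nat) = false by rewrite ji ltn_eqF // ltnW.
  have ji2 : (j == i.+1 :> nat) by rewrite ji.
  have lenE : '(tnth b i, tnth b i) = '(tnth b j, tnth b j) by rewrite (len i) (len j) (negPf im) (negPf jm).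
  split; first by apply: (linked_entry cartan _ lenE); rewrite C_entry (negPf jm) ij ij2 ji2.
  by apply: (linked_entry cartan _ (esym lenE)); rewrite C_entry (negPf im) eq_sym ij ij2 ji2.
- exists (inord n'.-1), ord_max; rewrite eqxx -!val_eqE /= penE; split=> //; first by lia.
  rewrite cartan C_entry -!val_eqE /= penE eqxx prednK // eqxx.
  rewrite [n'.-1 == n']ltn_eqF ?[n'.-1 == n'.+1]ltn_eqF; try lia.
  by rewrite !mul0r mul1r !subr0 !sub0r mulrNz mulNr.
move=> aE Eb z; rewrite {1}tE => z2 z1 l wl l0; have -> : 2^-1 * K = 2 * (K / 4) by field.
have Em : extremal_root s (tnth b ord_max) by apply: Eb; rewrite eqxx.
apply: (C_short SP GE base n0 cartan z1 z2 Em) => //.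
move=> n4 l' wl'; have n3 : n' = 3 by case: n4.
subst n'; apply: (special4 SP GE (i := ord_max) base cartan _ _ z1 wl'); first by right.
by rewrite -/K -aE; exact: le32.
Qed.

Lemma F4_two_lengths (b : 4.-tuple (dual_space A)) : root_base G b ->
  has_cartan b (cartan_entry TypeF4) -> exists Ns, two_lengths s t A Ns '(a0, a0).
Proof.
move=> base cartan; pose K i := '(tnth b (inord i), tnth b (inord i)).
have K0 i : 0 < K i by exact: (base_gt0 SP GE base).
have E (i : 'I_4) : i = inord i by rewrite inord_val.
have edge i j : (i < 4)%N -> (j < 4)%N ->
    (cartan_entry TypeF4 i j)%:~R * K i = (cartan_entry TypeF4 j i)%:~R * K j.
  by move=> i4 j4; have := edge_lengths cartan (inord i) (inord j); rewrite !inordK.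
have e01 : K 0%N = K 1%N by have := edge 0%N 1%N isT isT; rewrite !mulN1r => /oppr_inj.
have e12 : K 1%N = 2 * K 2.
  by have := edge 1%N 2 isT isT; rewrite !mulN1r mulrNz mulNr => /oppr_inj.
have e23 : K 2 = K 3 by have := edge 2 3 isT isT; rewrite !mulN1r => /oppr_inj.
exists (K 3); apply: (two_lengthsP SP GE base (sh := fun i : 'I_4 => (2 <= i)%N) (Nl := K 1%N)) => //.
- move=> i; rewrite (E i) -/(K i) inord_val; move: (i : nat) (ltn_ord i) => {}i.
  by case: i => [|[|[|[|]]]].
- by rewrite e12 e23 ltr_pMl // ltr1n.
- move=> Q Qs.
  have link i j : (i < 4)%N -> (j < 4)%N -> cartan_entry TypeF4 i j = -1 -> K i = K j ->
      Q (inord i) -> Q (inord j).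
    by move=> i4 j4 ij KE; apply: Qs; apply: (linked_entry cartan) => //; rewrite !inordK.
  have H (i j : nat) : (i < 4)%N -> (j < 4)%N -> (2 <= i)%N = (2 <= j)%N -> Q (inord i) -> Q (inord j).
    by case: i j => [|[|[|[|//]]]] [|[|[|[|//]]]] //= _ _ _; apply: link.
  by move=> i j ij; rewrite [in Q i](E i) [in Q j](E j); apply: H.
- exists (inord 2), (inord 1); rewrite !inordK //; split=> //.
  by rewrite cartan !inordK // mulrNz mulNr.
move=> aE Eb z zt z1; apply: (F4_short SP GE base cartan z1).
by apply: Eb; rewrite inordK.
Qed.

Lemma G2_two_lengths (b : 2.-tuple (dual_space A)) : root_base G b ->
  has_cartan b (cartan_entry TypeG2) -> exists Ns, two_lengths s t A Ns '(a0, a0).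
Proof.
move=> base cartan; pose K i := '(tnth b (inord i), tnth b (inord i)).
have K0 i : 0 < K i by exact: (base_gt0 SP GE base).
have E (i : 'I_2) : i = inord i by rewrite inord_val.
have e01 : K 1%N = 3 * K 0%N.
  have := edge_lengths cartan (inord 0) (inord 1); rewrite !inordK //.
  by rewrite mulN1r mulrNz mulNr => /oppr_inj.
exists (K 0%N); apply: (two_lengthsP SP GE base (sh := fun i : 'I_2 => i == 0%N :> nat) (Nl := K 1%N)) => //.
- move=> i; rewrite (E i) -/(K i) inord_val; move: (i : nat) (ltn_ord i) => {}i.
  by case: i => [|[|]].
- by rewrite e01 ltr_pMl // ltr1n.
- move=> Q Qs i j ij; suff -> : i = j by [].
  by apply: val_inj; move: ij (ltn_ord i) (ltn_ord j) => /=; move: (i : nat) (j : nat); lia.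
- exists (inord 0), (inord 1); rewrite !inordK //; split=> //.
  rewrite cartan !inordK // mulrNz mulNr lerN2 ler_pM2r //; last exact: (K0 0%N).
  by rewrite ler_nat.
move=> aE Eb z zt z1 l; have -> : K 0%N = '(tnth b ord0, tnth b ord0).
  by rewrite /K (_ : inord 0 = ord0) //; apply: val_inj; rewrite /= inordK.
by apply: (G2_short SP GE base cartan z1); apply: Eb; rewrite inordK.
Qed.

End FoldedTypes.

(** * Diagram foldings *)

Lemma A_edge n k : cartan_entry (TypeA n) k k.+1 = -1 /\ cartan_entry (TypeA n) k.+1 k = -1.
Proof. by rewrite /cartan_entry !eqxx (ltn_eqF (ltnSn k)) (gtn_eqF (ltnSn k)) orbT. Qed.

Lemma D_entry n x y : cartan_entry (TypeD n) x y = -1 ->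
  (x.+1 <> n /\ y.+1 <> n /\ (x = y.+1 \/ y = x.+1)) \/
  (x.+1 = n /\ y.+3 = n) \/ (y.+1 = n /\ x.+3 = n).
Proof.
rewrite /cartan_entry; case: ifP => // /eqP xy.
case: ifP => [/orP xn|/norP[/eqP xn /eqP yn]]; case: ifP => // /orP H _.
  by right; move: xn H => [] /eqP xn [] /eqP yn; lia.
by left; split=> //; split=> //; move: H => [] /eqP; [left|right].
Qed.

Lemma D_edge n k : (k.+2 < n)%N ->
  cartan_entry (TypeD n) k k.+1 = -1 /\ cartan_entry (TypeD n) k.+1 k = -1.
Proof.
move=> kn; rewrite /cartan_entry !eqxx (ltn_eqF (ltnSn k)) (gtn_eqF (ltnSn k)) orbT /=.
by rewrite (ltn_eqF (ltnW kn : (k.+1 < n)%N)) (ltn_eqF kn).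
Qed.

Lemma D_fork n : cartan_entry (TypeD n.+3) n n.+2 = -1 /\ cartan_entry (TypeD n.+3) n.+2 n = -1.
Proof.
rewrite /cartan_entry !eqxx (ltn_eqF (leqnSn _ : (n < n.+2)%N)) orbT.
by rewrite (gtn_eqF (leqnSn _ : (n < n.+2)%N)) !orTb ?orbT.
Qed.

(** A unique branch node must be fixed. In type A a 2-group acts on an odd number of nodes, and the
    number of fixed points has the same parity. *)
Lemma folding_fixed_node X Y t (p : 'S_(dynkin_rank Y)) : folding X Y t ->
  diagram_automorphism p -> #[p]%g = t -> exists i, p i = i.
Proof.
move=> XY; case: XY p => [l l2|l l2||] p auto po.
- have edge i j : cartan_entry (TypeD l.+1) (p i) (p j) = cartan_entry (TypeD l.+1) i j.
    by have := auto i j; rewrite !mxE.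
  have [m mE] : exists m, l = m.+2 by exists (l - 2)%N; lia.
  subst l; pose x : 'I_m.+3 := inord m; pose y1 : 'I_m.+3 := inord m.+1.
  pose y2 : 'I_m.+3 := inord m.+2; pose y3 : 'I_m.+3 := inord m.-1.
  have xE : x = m :> nat by rewrite inordK //; lia.
  have y1E : y1 = m.+1 :> nat by rewrite inordK.
  have y2E : y2 = m.+2 :> nat by rewrite inordK.
  have y3E : y3 = m.-1 :> nat by rewrite inordK //; lia.
  have e1 := edge x y1; have e2 := edge x y2; have e3 := edge x y3.
  rewrite xE y1E (D_edge (ltnSn _)).1 in e1; rewrite xE y2E (D_fork _).1 in e2.
  have {}e1 := D_entry e1; have {}e2 := D_entry e2.
  have ne u v : u != v -> (p u : nat) <> p v by move=> /eqP uv /val_inj /perm_inj.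
  have n12 := ne y1 y2; rewrite -val_eqE /= y1E y2E in n12; have {}n12 := n12 (negbT (ltn_eqF (ltnSn _))).
  exists x; apply: val_inj; rewrite /= xE.
  have lt u : (p u < m.+3)%N := ltn_ord (p u).
  (* For m = 0 the diagram D_3 is a chain with middle node 0, determined by its two neighbours;
     otherwise node [m] is the only one with three neighbours. *)
  have [m0|m0] := posnP m.
    subst m; move: (lt x) e1 e2 n12; clear.
    by move: (p x : nat) (p y1 : nat) (p y2 : nat); lia.
  have edge3 : cartan_entry (TypeD m.+3) m m.-1 = -1.
    by have [|_] := @D_edge m.+3 m.-1; [lia | rewrite prednK].
  rewrite xE y3E edge3 in e3.
  have {}e3 := D_entry e3.
  have n13 : (p y1 : nat) <> p y3 by apply: ne; rewrite -val_eqE /= y1E y3E; lia.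
  have n23 : (p y2 : nat) <> p y3 by apply: ne; rewrite -val_eqE /= y2E y3E; lia.
  move: (lt x) (lt y1) (lt y2) (lt y3) e1 e2 e3 n12 n13 n23; clear.
  by move: (p x : nat) (p y1 : nat) (p y2 : nat) (p y3 : nat); lia.
- have gp : (2.-group <[p]>)%g by rewrite /pgroup -orderE po.
  have act : [acts <[p]>, on [set: 'I_(2 * l).-1] | 'P]%g.
    by apply/actsP => a _ i; rewrite !inE.
  have := pgroup_fix_mod gp act; rewrite cardsT card_ord modn2.
  have -> : odd (2 * l).-1.
    by rewrite mul2n; case: l l2 {p auto po gp act} => // l _; rewrite doubleS /= odd_double.
  have [->|[i +]] := set_0Vmem ('Fix_([set: 'I_(2 * l).-1] | 'P)(<[p]>))%g.
    by rewrite cards0.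
  rewrite inE => /andP[_ /afixP/(_ p (cycle_id p))]; rewrite /= apermE => pi _.
  by exists i.
- have edge i j : cartan_entry TypeE6 (p i) (p j) = cartan_entry TypeE6 i j.
    by have := auto i j; rewrite !mxE.
  pose o k : 'I_6 := inord k; have oE k : (k < 6)%N -> o k = k :> nat by move=> ?; rewrite inordK.
  have H (x y1 y2 y3 : nat) : (x < 6)%N -> (y1 < 6)%N -> (y2 < 6)%N -> (y3 < 6)%N ->
      cartan_entry TypeE6 x y1 = -1 -> cartan_entry TypeE6 x y2 = -1 ->
      cartan_entry TypeE6 x y3 = -1 -> y1 != y2 -> y1 != y3 -> y2 != y3 -> x = 3.
    move=> x6 y16 y26 y36 /eqP e1 /eqP e2 /eqP e3 n12 n13 n23; apply/eqP.
    have : all (fun x => all (fun y1 => all (fun y2 => all (fun y3 =>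
      [&& cartan_entry TypeE6 x y1 == -1, cartan_entry TypeE6 x y2 == -1,
        cartan_entry TypeE6 x y3 == -1, y1 != y2, y1 != y3 & y2 != y3] ==> (x == 3))
      (iota 0 6)) (iota 0 6)) (iota 0 6)) (iota 0 6) by vm_compute.
    move/allP/(_ x); rewrite mem_iota => /(_ x6)/allP/(_ y1); rewrite mem_iota => /(_ y16).
    move/allP/(_ y2); rewrite mem_iota => /(_ y26)/allP/(_ y3); rewrite mem_iota => /(_ y36).
    by rewrite e1 e2 e3 n12 n13 n23.
  exists (o 3); apply: val_inj; rewrite /= [RHS]oE //.
  have ne u v : (u < 6)%N -> (v < 6)%N -> u != v -> p (o u) != p (o v) :> nat.
    by move=> u6 v6 uv; rewrite val_eqE (inj_eq perm_inj) -val_eqE /= !oE.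
  by apply: (H _ (p (o 1%N)) (p (o 2)) (p (o 4))); rewrite ?edge ?oE ?ne.
have edge i j : cartan_entry (TypeD 4) (p i) (p j) = cartan_entry (TypeD 4) i j.
  by have := auto i j; rewrite !mxE.
pose o k : 'I_4 := inord k; have oE k : (k < 4)%N -> o k = k :> nat by move=> ?; rewrite inordK.
exists (o 1%N); apply: val_inj; rewrite /= [RHS]oE //.
have e0 := edge (o 1%N) (o 0%N); have e2 := edge (o 1%N) (o 2); have e3 := edge (o 1%N) (o 3).
rewrite !oE // in e0 e2 e3.
have {}e0 := D_entry e0; have {}e2 := D_entry e2; have {}e3 := D_entry e3.
have ne u v : (u < 4)%N -> (v < 4)%N -> u != v -> p (o u) <> p (o v) :> nat.
  by move=> u6 v6 uv; apply/eqP; rewrite val_eqE (inj_eq perm_inj) -val_eqE /= !oE.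
have n02 := ne 0%N 2 isT isT isT; have n03 := ne 0%N 3 isT isT isT; have n23 := ne 2 3 isT isT isT.
move: (ltn_ord (p (o 1%N)) : (p (o 1%N) < 4)%N) e0 e2 e3 n02 n03 n23; clear.
by move: (p (o 1%N) : nat) (p (o 0%N) : nat) (p (o 2) : nat) (p (o 3) : nat); lia.
Qed.

Section SimplyLacedTypes.
Context (C : numClosedFieldType) (L : finLieAlgType C).
Context (s : 'End(L)) (t : nat) (G A : {vspace L}) (SP : split_pair s t A).
Context (GE : forall x, (x \in G) = (s x == x)).
Local Notation "''(' l , m )" := (dual_form l m) (format "''(' l ,  m )").

Lemma folding_two_lengths X Y r (b : (dynkin_rank X).-tuple (dual_space A)) (a0 : dual_space A) :
  folding X Y r -> r = t -> root_base G b -> has_cartan_matrix (cartan_matrix X) b ->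
  is_weight s a0 1 -> a0 != 0 -> extremal_root s a0 ->
  (Y = TypeD 5 \/ Y = TypeA 7 -> 4 / '(a0, a0) <= 32) ->
  exists Ns, two_lengths s t A Ns '(a0, a0).
Proof.
move=> XY; case: XY b => [l l2|l l2||] b rt base cartan wa a00 Ea le32.
- case: l l2 b base cartan le32 => // n' l2 b base cartan le32.
  apply: (TypeB_two_lengths SP GE wa a00 Ea (b := b)) => //.
    exact: (has_cartan_matrixP SP GE base cartan).
  by move=> n4; apply: le32; left; rewrite n4.
- case: l l2 b base cartan le32 => // n' l2 b base cartan le32.
  apply: (TypeC_two_lengths SP GE wa a00 Ea (b := b)) => //.
    exact: (has_cartan_matrixP SP GE base cartan).
  by move=> n4; apply: le32; right; rewrite n4.
- by apply: (F4_two_lengths SP GE wa a00 Ea base); exact: (has_cartan_matrixP SP GE base cartan).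
by apply: (G2_two_lengths SP GE wa a00 Ea base); exact: (has_cartan_matrixP SP GE base cartan).
Qed.

(** A bond with both entries - 1 joins roots of equal length, and such bonds connect the diagram. *)
Lemma simply_laced_lengths X Y r (b : (dynkin_rank Y).-tuple (dual_space A)) : folding X Y r ->
  root_base G b -> has_cartan_matrix (cartan_matrix Y) b ->
  forall i j, '(tnth b i, tnth b i) = '(tnth b j, tnth b j).
Proof.
move=> XY base cartan i j.
(* Indexing by natural numbers, with default 0 outside the diagram, keeps ordinals out of the
   inductions. *)
pose len (k : nat) : C := if insub k is Some i then '(tnth b i, tnth b i) else 0.
have lenE (i' : 'I_(dynkin_rank Y)) : len i' = '(tnth b i', tnth b i') by rewrite /len valK.
have edge k m : (k < dynkin_rank Y)%N -> (m < dynkin_rank Y)%N ->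
    cartan_entry Y k m = -1 /\ cartan_entry Y m k = -1 -> len k = len m.
  move=> kn mn [km mk]; rewrite (lenE (Ordinal kn)) (lenE (Ordinal mn)).
  have := edge_lengths SP (has_cartan_matrixP SP GE base cartan) (Ordinal kn) (Ordinal mn).
  by rewrite /= km mk !mulN1r => /oppr_inj.
suff H k : (k < dynkin_rank Y)%N -> len k = len 0%N by rewrite -!lenE !H.
case: XY edge => [l l2|l l2||] /= edge.
- have chain m : (m < l)%N -> len m = len 0%N.
    elim: m => // m IH ml; rewrite -IH; last exact: ltnW.
    apply/esym/edge; [lia|lia|exact: D_edge].
  rewrite ltnS leq_eqVlt => /orP[/eqP ->|]; last exact: chain.
  rewrite -(chain (l - 2)%N); last by lia.
  have lE : l = (l - 2).+2 by lia.
  by apply/esym/edge; [lia|lia|have := D_fork (l - 2); rewrite -lE].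
- elim: k => // k IH kn; rewrite -IH; last exact: ltnW.
  by apply/esym/edge => //; [exact: ltnW|exact: A_edge].
- have e02 := edge 0%N 2 isT isT (conj erefl erefl).
  have e23 := edge 2 3 isT isT (conj erefl erefl).
  have e34 := edge 3 4 isT isT (conj erefl erefl).
  have e45 := edge 4 5 isT isT (conj erefl erefl).
  have e13 := edge 1%N 3 isT isT (conj erefl erefl).
  by case: k => [|[|[|[|[|[|]]]]]] // _; rewrite ?e13 -?e45 -?e34 -?e23 e02.
have e01 := edge 0%N 1%N isT isT (conj erefl erefl).
have e12 := edge 1%N 2 isT isT (conj erefl erefl).
have e13 := edge 1%N 3 isT isT (conj erefl erefl).
by case: k => [|[|[|[|]]]] // _; rewrite -?e12 -?e13 e01.
Qed.

(** The bound is four times the Coxeter number, which is 8 for both D_5 and A_7. *)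
Lemma simply_laced_norm Y (b : (dynkin_rank Y).-tuple (dual_space A)) (i0 : 'I_(dynkin_rank Y)) :
  root_base G b -> has_cartan_matrix (cartan_matrix Y) b ->
  (forall (m : dual_space A) w, is_weight s m w -> w = 1) ->
  i0 = 0%N :> nat -> Y = TypeD 5 \/ Y = TypeA 7 -> 4 / '(tnth b i0, tnth b i0) <= 32.
Proof.
move=> base cartan one i00 YE.
have cE := has_cartan_matrixP SP GE base cartan.
pose S := weyl_orbit (cartan_entry Y) (dynkin_rank Y) 8
  [seq simple_coords (cartan_entry Y) (dynkin_rank Y) j | j <- iota 0 (dynkin_rank Y)].
have Sc : weyl_closed (dynkin_rank Y) (cartan_entry Y) S.
  by rewrite /S; case: YE => ->; vm_compute.
have := norm_sum_upper SP GE base cE i0 one Sc (undup_uniq _).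
rewrite int_sumE i00 => /le_trans; apply; rewrite -[32]/((32 : int)%:~R) ler_int /S.
by case: YE => ->; vm_compute.
Qed.

End SimplyLacedTypes.

(** * From the diagram automorphism to the weights of the fixed algebra *)

Section Folding.
Context (C : numClosedFieldType) (L : finLieAlgType C) (simple : simple_lie_algebra L).

(** Division by zero gives 0, so the diagonal entry 2 can only come from a nonzero square length. *)
Lemma cartan_matrix_norm (H : {vspace L}) Y (b : (dynkin_rank Y).-tuple (dual_space H)) i :
  has_cartan_matrix (cartan_matrix Y) b -> dual_form (tnth b i) (tnth b i) != 0.
Proof.
move=> cartan; apply/negP => /eqP bb; have := cartan i i.
rewrite bb mulr0 mul0r mxE /cartan_entry eqxx => /eqP.
by rewrite eq_sym pnatr_eq0.
Qed.

(** The theory is applied to [H] with the identity as automorphism of order 1; the generator at a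
    fixed node of the diagram is a root vector fixed by [s]. *)
Lemma folding_extremal X Y t (H : {vspace L}) (b : (dynkin_rank Y).-tuple (dual_space H))
    (e f : 'I_(dynkin_rank Y) -> L) (p : 'S_(dynkin_rank Y)) (s : 'End(L)) :
  folding X Y t -> cartan_subalgebra fullv H -> root_base fullv b ->
  has_cartan_matrix (cartan_matrix Y) b -> chevalley_generators b e f ->
  diagram_automorphism p -> #[p]%g = t -> (forall i, s (e i) = e (p i)) ->
  exists x N, [/\ s x = x, x != 0, forall y, lie x (lie x y) = (- N * killing x y) *: x &
    Y = TypeD 5 \/ Y = TypeA 7 -> 4 / N <= 32].
Proof.
move=> XY carH base cartan gens auto po se.
have [i pi] := folding_fixed_node XY auto po.
have GE (x : L) : (x \in fullv) = ((\1%VF : 'End(L)) x == x) by rewrite memvf lfunE eqxx.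
have SP : split_pair (\1%VF : 'End(L)) 1 H.
  apply: (cartan_split (ltn0Sn 0) _ _ GE simple carH base (cartan_matrix_norm i cartan)).
    by move=> x; rewrite /= lfunE.
  by move=> x y; rewrite !lfunE.
have one (m : dual_space H) w : is_weight (\1%VF : 'End(L)) m w -> w = 1.
  by move=> /(gen_weight_order (sp_toral SP)); rewrite expr1.
have len := simply_laced_lengths SP GE XY base cartan.
have [ei _ [h hE bh]] := gens i.
have ei0 : e i != 0.
  apply/negP => /eqP e0; move: bh; rewrite (_ : h = 0) ?linear0.
    by move/eqP; rewrite eq_sym pnatr_eq0.
  by apply: val_inj; rewrite /= hE e0 lie0l.
exists (e i), (dual_form (tnth b i) (tnth b i)); split=> //.
- by rewrite se pi.
- apply: (simply_laced_extremal SP GE base one (fun j => len j i)) => //.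
  + exact: (base_wt SP GE base).
  + exact: (base_neq0 SP GE base).
  by apply: weight_vector_mem => //; rewrite lfunE scale1r.
move=> YE; have n0 : (0 < dynkin_rank Y)%N := leq_ltn_trans (leq0n _) (ltn_ord i).
rewrite (len i (Ordinal n0)).
exact: (simply_laced_norm SP GE base cartan one (erefl : Ordinal n0 = 0%N :> nat) YE).
Qed.

Context (s : 'End(L)) (t : nat) (G A : {vspace L}) (SP : split_pair s t A).
Context (GE : forall x, (x \in G) = (s x == x)).

Lemma folding_weights X Y x (N : C) (b : (dynkin_rank X).-tuple (dual_space A)) (x0 : L) :
  folding X Y t -> root_base G b -> has_cartan_matrix (cartan_matrix X) b ->
  s x = x -> x != 0 -> (forall y, lie x (lie x y) = (- N * killing x y) *: x) ->
  (Y = TypeD 5 \/ Y = TypeA 7 -> 4 / N <= 32) -> s x0 != x0 ->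
  (forall w w' : C, w ^+ t = 1 -> w' ^+ t = 1 -> w != 1 -> w' != 1 -> w' = w \/ w' = w^-1) ->
  exists Ns Nl, [/\ 0 < Ns < Nl, exists a : dual_space A, root_of_norm s Ns a,
    exists a : dual_space A, root_of_norm s Nl a &
    forall (a : dual_space A) z, a != 0 -> z ^+ t = 1 -> is_weight s a z <->
      root_of_norm s Ns a \/ root_of_norm s Nl a /\ z = 1].
Proof.
move=> XY base cartan sx xn0 ext le32 sx0 two.
have [a0 [e [wa a00 ea e0 eext]]] := extremal_degeneration SP sx xn0 ext.
have aN : dual_form a0 a0 = N by rewrite (extremal_norm SP wa a00 ea e0 eext) opprK.
have Ea : extremal_root s a0.
  apply: (extremal_vector SP wa a00 ea e0) => y.
  by rewrite eext memvZ // memv_line.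
rewrite -aN in le32.
have [Ns [Nlt exs exl lens H]] := folding_two_lengths SP GE XY erefl base cartan wa a00 Ea le32.
exists Ns, (dual_form a0 a0); split=> // a z an0 zt.
have [->|z1] := eqVneq z 1.
  split=> [wa1|[[]|[[]]] //]; have [aE|aE] := lens a wa1 an0; first by left.
  by right.
have [Hs Hall] := H z zt z1; split=> [wz|[sa|[_ z1']]]; first by left; exact: Hs.
  (* One nonzero weight for [z] exists; it is a short root, and the Weyl group yields all short
     roots. *)
  have [a1 a10 wz] := nonzero_weight SP simple wa a00 sx0 two zt z1.
  exact: (Hall _ (Hs _ wz a10) wz).
by rewrite z1' eqxx in z1.
Qed.

End Folding.

(** * Roots of unity of order 2 and 3 *)

Lemma quadratic_inverse (F : fieldType) (t : nat) (w w' : F) : t = 2%N \/ t = 3%N ->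
  w ^+ t = 1 -> w' ^+ t = 1 -> w != 1 -> w' != 1 -> w' = w \/ w' = w^-1.
Proof.
have sq u : u ^+ 2 = 1 -> u != 1 -> u = -1 :> F.
  by move=> /eqP; rewrite sqrf_eq1 => /orP[/eqP ->|/eqP //]; rewrite eqxx.
case=> -> wt w't w1 w'1; first by left; rewrite (sq _ wt w1) (sq _ w't w'1).
have cub u : u ^+ 3 = 1 -> u != 1 -> u ^+ 2 + u + 1 = 0 :> F.
  move=> u3 u1; apply: (mulfI (_ : u - 1 != 0)); first by rewrite subr_eq0.
  have -> : (u - 1) * (u ^+ 2 + u + 1) = u ^+ 3 - 1 by ring.
  by rewrite u3 subrr mulr0.
have cw := cub _ wt w1; have cw' := cub _ w't w'1.
have /eqP : (w' - w) * (w' + w + 1) = 0.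
  have -> : (w' - w) * (w' + w + 1) = (w' ^+ 2 + w' + 1) - (w ^+ 2 + w + 1) by ring.
  by rewrite cw cw' subrr.
rewrite mulf_eq0 subr_eq0 => /orP[/eqP ->|/eqP E]; [by left|right].
have w0 : w != 0 by apply: contraTneq isT => w0; move/eqP: wt; rewrite w0 expr0n /= eq_sym oner_eq0.
apply: (mulfI w0); rewrite mulfV // -wt.
have -> : w' = w ^+ 2 by apply: (addIr (w + 1)); rewrite !addrA cw E.
by rewrite -exprS.
Qed.

Section RootOfUnity.
Context (R : realType).
Local Notation om := (@Defs.root_of_unity R).

Lemma root_of_unityX n k : om n ^+ k =
  (cos (2 * trigo.pi / n%:R * k%:R) +i* sin (2 * trigo.pi / n%:R * k%:R))%C.
Proof.
elim: k => [|k IH]; first by rewrite mulr0 cos0 sin0.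
rewrite exprSr IH /Defs.root_of_unity; move: (2 * _ / _) => x.
rewrite -[k.+1%:R]natr1 mulrDr mulr1 cosD sinD.
by apply/eqP; rewrite eq_complex /=; apply/andP; split; apply/eqP; ring.
Qed.

Lemma root_of_unity_order n : (0 < n)%N -> om n ^+ n = 1.
Proof.
move=> n0; rewrite root_of_unityX divfK ?pnatr_eq0 -?lt0n //.
by rewrite mulr_natl cos2pi sin2pi.
Qed.

Lemma root_of_unity1 : om 1 = 1.
Proof. by rewrite -[LHS]expr1 root_of_unity_order. Qed.

Lemma root_of_unity_neq1 (t : nat) : t = 2%N \/ t = 3%N -> om t != 1.
Proof.
case=> ->; rewrite eq_complex /= negb_and.
  have -> : 2 * trigo.pi / 2 = trigo.pi :> R by rewrite mulrAC divff ?mul1r ?pnatr_eq0.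
  by rewrite cospi lt_eqF // (lt_trans (ltrN10 _) ltr01).
apply/orP; right; rewrite gt_eqF // sin_gt0_pi //.
have pi0 := pi_gt0 R; rewrite divr_gt0 ?mulr_gt0 ?ltr0n //=.
by rewrite ltr_pdivrMr ?ltr0n // mulrC ltr_pM2l // ltr_nat.
Qed.

Lemma root_of_unity_dvd (t : nat) (k : int) : t = 2%N \/ t = 3%N -> (om t ^ k == 1) = (t %| k)%Z.
Proof.
move=> tE; have t0 : (0 < t)%N by case: tE => ->.
have oN : om t ^+ t = 1 by exact: root_of_unity_order.
have o0 : om t != 0.
  apply: contraTneq isT => o0; move/eqP: oN.
  by rewrite o0 expr0n gtn_eqF // eq_sym oner_eq0.
have o1 := root_of_unity_neq1 tE.
have kE : om t ^ k = om t ^ (k %% t)%Z.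
  by rewrite {1}(divz_eq k t) expfzDr // [X in _ ^ X]mulrC -exprz_exp -exprnP oN exp1rz mul1r.
have r0 : 0 <= (k %% t)%Z by rewrite modz_ge0 // eqz_nat -lt0n.
have rt : (k %% t)%Z < t by rewrite ltz_pmod.
rewrite kE; apply/eqP/dvdz_mod0P => [|->]; last by rewrite expr0z.
case: (k %% t)%Z r0 rt => // r _ rt; rewrite -exprnP => oR.
case: r oR rt => [|[|[|r]]] // oR rt.
- by rewrite -[om t]expr1 oR eqxx in o1.
- have t3 : t = 3 by case: tE rt => ->.
  by rewrite t3 exprS -{2}t3 oR mulr1 in oN; rewrite -t3 in oN; rewrite oN eqxx in o1.
by case: tE rt => ->.
Qed.

End RootOfUnity.

Lemma mem_eigenspaces (K : fieldType) (V : vectType K) (s : 'End(V)) (z : K) (v : V) :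
  (v \in (passmx.leigenspace \1 1 :&: passmx.leigenspace s z)%VS) = (s v == z *: v).
Proof.
have E (f : 'End(V)) a : (v \in passmx.leigenspace f a) = (f v == a *: v).
  by rewrite memv_ker add_lfunE opp_lfunE scale_lfunE id_lfunE subr_eq0.
by rewrite memv_cap !E scale1r id_lfunE eqxx.
Qed.

(** * Weights of the toroidal Lie algebra *)

Section ConstantLoops.
Context (K : numFieldType) (L : finLieAlgType K).

Lemma degree_der_const (V : lmodType K) (d : K^o * K^o) (y : V) :
  degree_der d (monomial y 0) = 0.
Proof.
by rewrite degree_derU !mulr0 addr0 scale0r (linear_fun0 (@monomial_linear _ _ _)).
Qed.

Lemma lcoef_loop_const (y : L) u m :
  lcoef (loop_bracket (monomial y 0) u) m = lie y (lcoef u m).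
Proof.
have lin (k : int * int) : linear (fun v : L => lie y v) by move=> a v w; rewrite lieDZr.
rewrite (_ : loop_bracket _ _ = lmap (fun _ v => lie y v) u).
  by rewrite lcoef_lmap // linear0.
move: u; apply: laurent_ext => [||v k].
- exact: loop_bracket_r.
- exact: lmap_linear.
by rewrite loop_bracketU lmapU // add0r.
Qed.

(** The cocycle differentiates its first argument, which is constant here. *)
Lemma cocycle_const (y : L) u : cocycle (monomial y 0) u = 0.
Proof.
move: u; apply: laurent_ext (fun=> 0) _ _ _ => [|a v w|v k].
- exact: cocycle_r.
- by rewrite scaler0 addr0.
rewrite cocycleU !mulr0.
rewrite (linear_fun0 (@monomial_linear _ _ _)); exact: raddf0.
Qed.

Lemma kahler_der_const (d c c' : K^o * K^o) (z z' : K) :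
  kahler_der d (z *: kahler_class (monomial c 0) + z' *: kahler_class (monomial c' 0)) = 0.
Proof.
have E (c0 : K^o * K^o) : kahler_der d (kahler_class (monomial c0 0)) = 0.
  by rewrite kahler_derE degree_der_const; exact: raddf0.
rewrite kahler_derr E scaler0 add0r -[z' *: _]addr0 kahler_derr E scaler0 add0r.
exact: (linear_fun0 (kahler_derr d)).
Qed.

End ConstantLoops.

Local Open Scope complex_scope.
Local Open Scope classical_set_scope.
Section ToroidalWeights.
Context (R : realType) (L : finLieAlgType R[i]).
Context (s : 'End(L)) (t : nat) (G A : {vspace L}) (SP : split_pair s t A).

Lemma mem_graded_part (n : nat) (p q : int) (v : L) :
  (v \in graded_part (\1%VF : 'End(L)) s 1 n p q) = (s v == @Defs.root_of_unity R n ^ q *: v).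
Proof.
by rewrite /graded_part root_of_unity1 exp1rz mem_eigenspaces.
Qed.

Lemma toral_bracket (h : toral A) (x : toroidal L) :
  [/\ forall m, lcoef (loop_part (lie (toral_val h) x)) m =
        lie (vsval h.1.1) (lcoef (loop_part x) m) +
        (h.1.2.1 * m.1%:~R + h.1.2.2 * m.2%:~R) *: lcoef (loop_part x) m,
      central_part (lie (toral_val h) x) = kahler_der h.1.2 (central_part x) &
      der_part (lie (toral_val h) x) = 0].
Proof.
split=> [m||//].
- rewrite /= lcoefD lcoef_loop_const; congr (_ + _).
  rewrite degree_der_const subr0 lcoef_lmap ?scaler0 //.
rewrite -[LHS]/(cocycle (monomial (vsval h.1.1) 0) (loop_part x) +
  (kahler_der h.1.2 (central_part x) - kahler_der (der_part x) (h.2.1 *: _ + h.2.2 *: _))).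
by rewrite cocycle_const kahler_der_const subr0 add0r.
Qed.

(** An element of [A] at which [a] is nonzero kills the central and derivation parts, so a weight
    vector lies in the loop part. There d_0 and d_1 read off the exponents, and any nonzero
    coefficient is a weight vector in [L]. *)
Lemma nonisotropic_rootP (a : dual_space A) (c : R[i]^o * R[i]^o) :
  nonisotropic_roots (\1%VF : 'End(L)) s 1 t (a, c) <->
  a != 0 /\ exists m : int * int, c = (m.1%:~R, m.2%:~R) /\
    is_weight s a (@Defs.root_of_unity R t ^ m.2).
Proof.
split.
  move=> [aa [x [[xg xc] hx] x0]]; have a0 : a != 0.
    by apply: contraNneq aa => ->; rewrite /ext_form /= dual_form0r.
  split=> //.
  have [h1 ah1] : exists h1, a h1 != 0.
    apply: contrapT => no; move/eqP: a0; apply; apply/lfunP => h1; rewrite zero_lfunE.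
    by apply/eqP/negPn/negP => ah1; apply: no; exists h1.
  have [_ cen der] := toral_bracket (h1, 0, 0) x.
  have h0 := hx (h1, 0, 0); rewrite /ext_eval /= !mulr0 !addr0 in h0.
  have x2 : x.2 = 0.
    have : a h1 *: x.2 = 0 by rewrite -der h0.
    by move/eqP; rewrite scaler_eq0 (negPf ah1) => /eqP.
  have x12 : x.1.2 = 0.
    have : a h1 *: x.1.2 = 0 by rewrite -[LHS]/(central_part (a h1 *: x)) -h0 cen kahler_der0.
    by move/eqP; rewrite scaler_eq0 (negPf ah1) => /eqP.
  have [m um] : exists m, lcoef (loop_part x) m != 0.
    apply: contrapT => no; move/eqP: x0; apply.
    case: x {xg xc hx cen der h0} x2 x12 no => [[u w] d] /= -> -> no.
    congr (_, _, _); apply: laurentP => m; rewrite lcoef0.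
    by apply/eqP/negPn/negP => um; apply: no; exists m.
  have eigen h : lie (vsval h.1.1) (lcoef (loop_part x) m) +
        (h.1.2.1 * m.1%:~R + h.1.2.2 * m.2%:~R) *: lcoef (loop_part x) m =
        ext_eval (a, c) h *: lcoef (loop_part x) m.
    by have [<- _ _] := toral_bracket h x; rewrite hx -lcoefZ.
  exists m; split.
    have inj (k k' : R[i]) : k *: lcoef (loop_part x) m = k' *: lcoef (loop_part x) m -> k = k'.
      by move/eqP; rewrite -subr_eq0 -scalerBl scaler_eq0 (negPf um) orbF subr_eq0 => /eqP.
    have e0 := eigen (0, (1, 0), 0); have e1 := eigen (0, (0, 1), 0).
    rewrite /ext_eval /= !linear0 lie0l !(mul1r, mul0r, mulr1, mulr0, add0r, addr0) in e0 e1.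
    rewrite [LHS]surjective_pairing; congr pair; exact/esym/inj.
  have : lcoef (loop_part x) m \in gen_weight s a (@Defs.root_of_unity R t ^ m.2).
    apply: weight_vector_mem => [|h]; first by apply/eqP; rewrite -(mem_graded_part t m.1); exact: xg.
    have := eigen (h, 0, 0); rewrite /ext_eval /= !mul0r !addr0 scale0r addr0 => ->.
    by rewrite !mulr0 !addr0.
  by move=> ug; apply/negP => /eqP g0; move: ug um; rewrite g0 memv0 => ->.
move=> [a0 [[m n] [/= -> wa]]].
split; first exact: (weight_dual_neq0 SP wa a0).
pose v := vpick (gen_weight s a (@Defs.root_of_unity R t ^ n)).
have v0 : v != 0 by rewrite vpick0.
have vw : v \in gen_weight s a (@Defs.root_of_unity R t ^ n) by exact: memv_pick.
exists ((monomial v (m, n), 0), 0); last first.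
  apply/negP => /eqP [] /(congr1 (fun u => lcoef u (m, n))).
  by rewrite lcoef_monomial eqxx lcoef0; exact/eqP.
split; first split=> [k|].
- rewrite (mem_graded_part t k.1) /= lcoef_monomial; have [<-|_] := eqVneq (m, n) k => /=.
    by rewrite (gen_weight_aut (sp_toral SP) vw).
  by rewrite linear0 scaler0.
- exists 0; last exact: raddf0.
  by move=> k; rewrite lcoef0 eqxx.
move=> h; have [lo cen der] := toral_bracket h ((monomial v (m, n), 0), 0).
rewrite [lie _ _]surjective_pairing [X in (X, _)]surjective_pairing.
rewrite -/(loop_part _) -/(central_part _) -/(der_part _) cen der (linear_fun0 (kahler_derr _)).
rewrite -[RHS]/(ext_eval (a, (m%:~R, n%:~R)) h *: monomial v (m, n),
  ext_eval (a, (m%:~R, n%:~R)) h *: (0 : kahler _), ext_eval (a, (m%:~R, n%:~R)) h *: (0 : R[i]^o * R[i]^o)).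
rewrite !scaler0; congr (_, _, _); apply: laurentP => k; rewrite lo lcoefZ lcoef_monomial.
have [<-|_] := eqVneq (m, n) k; last by rewrite linear0 !scaler0 addr0.
rewrite (wt_eigen SP _ a0 vw) -scalerDl /ext_eval /=; congr (_ *: _).
by rewrite addrA; congr (_ + _ + _); exact: mulrC.
Qed.

End ToroidalWeights.

Local Open Scope complex_scope.
Local Open Scope classical_set_scope.

(** * Lengths of the roots and divisibility of the exponents *)

Lemma folding_rank X Y t : folding X Y t -> (0 < dynkin_rank X)%N /\ (t = 2%N \/ t = 3%N).
Proof. by case=> [l l2|l l2||]; split; [exact: ltnW|left|exact: ltnW|left|by []|left|by []|right]. Qed.

Lemma ext_dualE (R : realType) (L : finLieAlgType R[i]) (A : {vspace L}) (a : dual_space A)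
    (m n : int) :
  inj_dual a + m%:~R *: delta0 A + n%:~R *: delta1 A = (a, (m%:~R, n%:~R)) :> ext_dual A.
Proof.
rewrite /inj_dual /delta0 /delta1; congr (_, (_, _)); rewrite /= ?scaler0 ?addr0 //.
  by rewrite add0r; exact: mulr1.
by rewrite add0r; exact: mulr1.
Qed.

Theorem mainTheorem3 (R : realType) (X Y : dynkin) (t : nat)
    (L : finLieAlgType R[i])
    (H : {vspace L}) (b : (dynkin_rank Y).-tuple (dual_space H))
    (e f : 'I_(dynkin_rank Y) -> L) (p : 'S_(dynkin_rank Y))
    (sigma1 : 'End(L)) (H0 : {vspace L}) :
  let sigma0 : 'End(L) := \1%VF in
  let g00 := graded_part sigma0 sigma1 1 t 0 0 in
  folding X Y t ->
  (* L is simple of type Y, with Chevalley generators e, f *)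
  simple_lie_algebra L ->
  cartan_subalgebra fullv H ->
  root_base fullv b ->
  has_cartan_matrix (cartan_matrix Y) b ->
  chevalley_generators b e f ->
  (* sigma1 is induced by the diagram automorphism p, of order t *)
  diagram_automorphism p ->
  #[p]%g = t ->
  lie_automorphism sigma1 ->
  has_order sigma1 t ->
  (forall i, sigma1 (e i) = e (p i) /\ sigma1 (f i) = f (p i)) ->
  (* H0 is a Cartan subalgebra of g00, which is of type X *)
  cartan_subalgebra g00 H0 ->
  has_root_system_type g00 H0 X ->
  nonisotropic_roots sigma0 sigma1 1 t (H := H0) =
    [set beta | exists a (m n : int), short_roots g00 a /\
       beta = inj_dual a + m%:~R *: delta0 H0 + n%:~R *: delta1 H0] `|`
    [set beta | exists a (m n : int), long_roots g00 a /\
       beta = inj_dual a + m%:~R *: delta0 H0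
                + (t%:Z * n)%:~R *: delta1 H0].
Proof.
move=> sigma0 g00 XY simple carH base cartan gens auto po aut ord sef carH0 [b' [base' cartan']].
have [rX tE] := folding_rank XY; have t0 : (0 < t)%N by case: tE => ->.
have [_ sM] := aut; have [_ sT sO] := ord.
have GE (x : L) : (x \in g00) = (sigma1 x == x).
  by rewrite mem_graded_part expr0z scale1r.
have SP : split_pair sigma1 t H0.
  exact: (cartan_split t0 sT sM GE simple carH0 base' (cartan_matrix_norm (Ordinal rX) cartan')).
have [x0 sx0] : exists x0, sigma1 x0 != x0.
  by have [|x0 sx0] := sO 1%N; [case: tE => -> | exists x0].
have [x [N [sx xn0 ext le32]]] :=
  folding_extremal simple XY carH base cartan gens auto po (fun i => (sef i).1).
have [Ns [Nl [/andP[Ns0 Nlt] [a1 sa1] [a2 la2] weights]]] := folding_weights simple SP GE XY base'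
  cartan' sx xn0 ext le32 sx0 (fun w w' => @quadratic_inverse _ t w w' tE).
have nz (M : R[i]) (a : dual_space H0) : 0 < M -> root_of_norm sigma1 M a -> a != 0.
  by move=> M0 [_ aM]; apply: contraTneq M0 => a0; rewrite -aM a0 dual_form0r ltxx.
have Nl0 := lt_trans Ns0 Nlt.
have rootP (a : dual_space H0) : lie_roots g00 a <-> root_of_norm sigma1 Ns a \/ root_of_norm sigma1 Nl a.
  rewrite (lie_rootsP GE SP a); split=> [[a0 wa]|].
    by have /(weights _ _ a0 (expr1n _ t))[|[]] := wa; [left|right].
  by move=> [sa|la]; split; [exact: nz Ns0 sa|exact: sa.1|exact: nz Nl0 la|exact: la.1].
have shortP (a : dual_space H0) : short_roots g00 a <-> root_of_norm sigma1 Ns a.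
  split=> [[/rootP[//|la] min]|sa].
    have := min a1 (proj2 (rootP a1) (or_introl sa1)); rewrite la.2 sa1.2 => /(lt_le_trans Nlt).
    by rewrite ltxx.
  split; first by apply/rootP; left.
  by move=> a' /rootP[] [_ ->]; rewrite sa.2 // ltW.
have longP (a : dual_space H0) : long_roots g00 a <-> root_of_norm sigma1 Nl a.
  split=> [[/rootP[sa|//] max]|la].
    have := max a2 (proj2 (rootP a2) (or_intror la2)); rewrite la2.2 sa.2 => /(lt_le_trans Nlt).
    by rewrite ltxx.
  split; first by apply/rootP; right.
  by move=> a' /rootP[] [_ ->]; rewrite la.2 // ltW.
(* The eigenvalue at exponent [n] is a power of the root of unity. It equals 1 exactly when [t]
   divides [n], which confines the long roots to these exponents and leaves the short ones free. *)
have omX (n : int) : (@Defs.root_of_unity R t ^ n) ^+ t = 1.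
  by rewrite exprnP exprz_exp mulrC -exprz_exp -exprnP root_of_unity_order // exp1rz.
apply/predeqP => -[a c]; rewrite (nonisotropic_rootP SP); split.
  move=> [a0 [[m n] [-> /= /(weights _ _ a0 (omX n))]]] [sa|[la /eqP]].
    by left; exists a, m, n; split; [exact/shortP|rewrite ext_dualE].
  rewrite root_of_unity_dvd // => /dvdzP[k kE].
  by right; exists a, m, k; split; [exact/longP|rewrite ext_dualE kE mulrC].
move=> [] [a' [m [n [aP]]]]; rewrite ext_dualE => -[-> ->].
  have /shortP sa := aP; have a0 := nz _ _ Ns0 sa.
  by split=> //; exists (m, n); split=> //=; apply/(weights _ _ a0 (omX n)); left.
have /longP la := aP; have a0 := nz _ _ Nl0 la.
split=> //; exists (m, t%:Z * n); split=> //=; apply/(weights _ _ a0 (omX _)); right; split=> //.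
by apply/eqP; rewrite root_of_unity_dvd // dvdz_mulr.
Qed.
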